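(* Let $(M,F)$ be a Berwald manifold of dimension $n\ge 2$, with flag curvature $\mathbf{K}(P,y)$. Then the following hold. 1. If $\mathbf{K}(P,y)=0$ for all flags $P$ and all flagpoles $y\in P$, then $F$ is locally Minkowskian. 2. If $\mathbf{K}(P,y)\neq 0$ for all flags $P$ and all flagpoles $y\in P$, then $F$ is a Riemannian metric.
   Context: Let $M$ be an $n$-dimensional $C^\infty$ manifold, $TM_0=TM\setminus\{0\}$ the slit tangent bundle, with local coordinates $(x^i,y^i)$. A Finsler metric is a function $F:TM\to[0,\infty)$ that is $C^\infty$ on $TM_0$, satisfies $F(x,\lambda y)=\lambda F(x,y)$ for all $\lambda>0$, and such that for every $y\in T_xM\setminus\{0\}$ the form $\mathbf{g}_y(u,v)=\frac12\frac{\partial^2}{\partial s\partial t}F^2(y+su+tv)|_{s=t=0}$ is positive definite on $T_xM$; write $g_{ij}(x,y)$ for its components and $g^{ij}$ for the inverse matrix. $(M,F)$ is then a Finsler manifold. $F$ is Riemannian if $F^2(x,y)$ is a positive definite quadratic form in $y$ for each $x$. $F$ is locally Minkowskian if around each point there are local coordinates $(x^i)$ in which $F(x,y)$, in the induced coordinates $(x^i,y^i)$, depends only on $y$. The spray coefficients are $G^i=\frac14 g^{im}\left\{\frac{\partial^2 F^2}{\partial x^k\partial y^m}y^k-\frac{\partial F^2}{\partial x^m}\right\}$. The Berwald curvature is $B^i_{\ jkl}=\frac{\partial^3G^i}{\partial y^j\partial y^k\partial y^l}$, and $F$ (or $(M,F)$) is called Berwald if $B^i_{\ jkl}=0$ on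 $TM_0$. The Riemann curvature $\mathbf{R}_y:T_xM\to T_xM$ is $\mathbf{R}_y(u)=R^i_{\ k}(y)u^k\frac{\partial}{\partial x^i}$ with $$R^i_{\ k}=2\frac{\partial G^i}{\partial x^k}-\frac{\partial^2G^i}{\partial x^j\partial y^k}y^j+2G^j\frac{\partial^2G^i}{\partial y^j\partial y^k}-\frac{\partial G^i}{\partial y^j}\frac{\partial G^j}{\partial y^k}.$$ A flag at $x$ is a $2$-plane $P\subset T_xM$ together with a flagpole $0\ne y\in P$; writing $P=\mathrm{span}\{y,u\}$, the flag curvature is $$\mathbf{K}(P,y)=\frac{\mathbf{g}_y(u,\mathbf{R}_y(u))}{\mathbf{g}_y(y,y)\mathbf{g}_y(u,u)-\mathbf{g}_y(y,u)^2},$$ which does not depend on the choice of $u$. *)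

(* Defs.v *)
From HB Require Import structures.
From mathcomp Require Import all_boot all_order all_algebra.
From mathcomp Require Import all_classical all_reals topology normedtype derive.
Import numFieldNormedType.Exports.
Import Order.TTheory GRing.Theory Num.Theory.

Set Implicit Arguments.
Unset Strict Implicit.
Unset Printing Implicit Defensive.

Local Open Scope classical_set_scope.
Local Open Scope ring_scope.

(* Meaningful for open U. In finite dimension, Df is C^k as soon as all the
   directional derivatives 'D_v f are. *)
Fixpoint Ck_on (R : realType) (V W : normedModType R) (k : nat) (U : set V)
    (f : V -> W) : Prop :=
  if k is k'.+1 then
    (forall x, U x -> differentiable f x) /\ forall v, Ck_on k' U ('D_v f)
  else forall x, U x -> {for x, continuous f}.

Definition smooth_on (R : realType) (V W : normedModType R) (U : set V)
  (f : V -> W) : Prop := forall k, Ck_on k U f.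

(* [coord] and [param] are total; their values outside [dom] and [img] are
   irrelevant. *)
Record chart (R : realType) (n : nat) (M : topologicalType) := Chart {
  dom : set M;
  img : set 'rV[R]_n;
  coord : M -> 'rV[R]_n;
  param : 'rV[R]_n -> M;
  dom_open : open dom;
  img_open : open img;
  coord_img : forall p, dom p -> img (coord p);
  param_dom : forall x, img x -> dom (param x);
  coordK : forall p, dom p -> param (coord p) = p;
  paramK : forall x, img x -> coord (param x) = x;
  coord_continuous : forall p, dom p -> {for p, continuous coord};
  param_continuous : forall x, img x -> {for x, continuous param} }.

Section Charts.
Context {R : realType} {n : nat} {M : topologicalType}.
Implicit Types c : chart R n M.

Definition transition c c' : 'rV[R]_n -> 'rV[R]_n :=
  fun x => coord c' (param c x).

Definition compatible c c' : Prop :=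
  smooth_on (coord c @` (dom c `&` dom c')) (transition c c') /\
  smooth_on (coord c' @` (dom c `&` dom c')) (transition c' c).

End Charts.

(* The smooth structure is a maximal atlas, so the local coordinate systems
   of the manifold are exactly the charts in [atlas]. *)
Record manifold (R : realType) (n : nat) := Manifold {
  carrier :> topologicalType;
  atlas : set (chart R n carrier);
  manifold_hausdorff : hausdorff_space carrier;
  manifold_second_countable : @second_countable carrier;
  atlas_cover : forall p, exists2 c, atlas c & dom c p;
  atlas_compatible : forall c c', atlas c -> atlas c' -> compatible c c';
  atlas_maximal : forall c, (forall c', atlas c' -> compatible c c') ->
    atlas c }.

Lemma diff_comp_at (R : realType) (U V W : normedModType R) (f : U -> V)
    (g : V -> W) x (z : V) y : f x = z ->
  differentiable f x -> differentiable g z ->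
  'd (g \o f) x y = 'd g z ('d f x y).
Proof. by move=> <- df dg; rewrite diff_comp. Qed.

Section TangentSpace.
Context {R : realType} {n : nat} {M : manifold R n}.
Implicit Types (p : M) (c : chart R n M) (v : chart R n M -> 'rV[R]_n).

Definition chart_at p : set (chart R n M) := [set c | atlas c /\ dom c p].

(* A tangent vector at p is the family of its components (v^i) in the charts
   around p, related by v'^i = (dx'^i/dx^j) v^j; the components in the other
   charts are set to 0 so that equality of families is equality of vectors. *)
Definition is_tangent p v : Prop :=
  (forall c c', chart_at p c -> chart_at p c' ->
     v c' = 'd (transition c c') (coord c p) (v c)) /\
  (forall c, ~ chart_at p c -> v c = 0).

Definition tangent_pred p : {pred chart R n M -> 'rV[R]_n} :=
  fun v => `[< is_tangent p v >].

Lemma tangent_submod_closed p : submod_closed (tangent_pred p).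
Proof.
split; first by apply/asboolP; split=> // c c' _ _; rewrite linear0.
move=> a u v /asboolP[ut u0] /asboolP[vt v0]; apply/asboolP.
split=> [c c' cp c'p|c cp].
- rewrite -[LHS]/(a *: u c' + v c') -[(_ + _) c]/(a *: u c + v c).
  by rewrite linearP (ut c) // (vt c).
- by rewrite -[LHS]/(a *: u c + v c) u0 // v0 // scaler0 addr0.
Qed.

HB.instance Definition _ p :=
  GRing.isSubmodClosed.Build R (chart R n M -> 'rV[R]_n) (tangent_pred p)
    (tangent_submod_closed p).

Record tangent p := Tangent {
  comp :> chart R n M -> 'rV[R]_n;
  comp_tangent : comp \in tangent_pred p }.

HB.instance Definition _ p := [isSub for @comp p].
HB.instance Definition _ p := [Choice of tangent p by <:].
HB.instance Definition _ p := [SubChoice_isSubLmodule of tangent p by <:].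

Definition tangent_comp c p (y : 'rV[R]_n) : chart R n M -> 'rV[R]_n :=
  fun c' => if `[< chart_at p c /\ chart_at p c' >]
            then 'd (transition c c') (coord c p) y else 0.

Lemma transition_differentiable c c' p : chart_at p c -> chart_at p c' ->
  differentiable (transition c c') (coord c p).
Proof.
move=> [ac cp] [ac' c'p]; have [/(_ 1%N)[+ _] _] := atlas_compatible ac ac'.
by apply; exists p.
Qed.

Lemma transition_diff_comp c c' c'' p y :
  chart_at p c -> chart_at p c' -> chart_at p c'' ->
  'd (transition c c'') (coord c p) y =
  'd (transition c' c'') (coord c' p) ('d (transition c c') (coord c p) y).
Proof.
move=> cp c'p c''p; have [[_ dp] [_ d'p]] := (cp, c'p).
have E : transition c c' (coord c p) = coord c' p.
  by rewrite /transition coordK.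
have d1 := transition_differentiable cp c'p.
have d2 := transition_differentiable cp c''p.
have d3 := transition_differentiable c'p c''p.
have d4 : differentiable (transition c' c'' \o transition c c') (coord c p).
  by apply: differentiable_comp; [exact: d1|rewrite E; exact: d3].
apply: (etrans _ (diff_comp_at y E d1 d3)).
apply: (etrans (esym (deriveE y d2))).
apply: (etrans _ (deriveE y d4)).
apply: near_eq_derive.
have /(_ (dom c')) pc := param_continuous (coord_img dp).
have {}pc : \forall x \near coord c p, dom c' (param c x).
  apply: pc; rewrite coordK //; apply: open_nbhs_nbhs.
  by split=> //; exact: dom_open.
near=> x; rewrite /= /transition coordK //.
by near: x.
Unshelve. all: by end_near. Qed.

Lemma tangent_comp_subproof c p y : tangent_comp c p y \in tangent_pred p.
Proof.
apply/asboolP; split=> [c' c'' c'p c''p|c' c'p]; rewrite /tangent_comp.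
- have [cp|cp] := pselect (chart_at p c).
    by rewrite !asboolT //; exact: transition_diff_comp.
  by rewrite !asboolF ?linear0 // => -[].
- by rewrite asboolF // => -[].
Qed.

(* y^i d/dx^i at p in the coordinates c, for c a chart around p (and the zero
   vector otherwise). *)
Definition tangent_of c p (y : 'rV[R]_n) : tangent p :=
  Tangent (tangent_comp_subproof c p y).

End TangentSpace.

Arguments tangent {R n M} p.
Arguments chart_at {R n M} p _.

Lemma tangent_ofE (R : realType) (n : nat) (M : manifold R n) (p : M) c
    (y : 'rV[R]_n) : chart_at p c -> tangent_of c p y c = y.
Proof.
move=> cp; have [_ dp] := cp; rewrite /= /tangent_comp asboolT //.
have d1 := transition_differentiable cp cp.
rewrite -deriveE // (@near_eq_derive _ _ _ _ id) ?derive_id //.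
near=> x; apply: paramK; near: x.
by apply: open_nbhs_nbhs; split; [exact: img_open|exact: coord_img].
Unshelve. all: by end_near. Qed.

Lemma tangent_ofK (R : realType) (n : nat) (M : manifold R n) (p : M) c
    (v : tangent p) : chart_at p c -> tangent_of c p (v c) = v.
Proof.
move=> cp; apply: val_inj; apply/funext => c' /=; rewrite /tangent_comp.
have [vt v0] := asboolP _ (comp_tangent v).
case: asboolP => [[_ c'p]|Nc']; first by rewrite [RHS](vt c).
by rewrite v0 // => c'p; exact: Nc'.
Qed.

Section Finsler.
Context {R : realType} {n : nat} {M : manifold R n}.
Variable F : forall p : M, tangent p -> R.
Implicit Types (p : M) (c : chart R n M) (x y : 'rV[R]_n) (i j k l m : 'I_n).

Definition fundamental_form p (y u v : tangent p) : R :=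
  2^-1 * derive1 (fun s : R =>
           derive1 (fun t : R => F (y + s *: u + t *: v) ^+ 2) 0) 0.

(* F(x, y) in the coordinates (x^i, y^i) of TM induced by c. *)
Definition local_expr c x y : R := F (tangent_of c (param c x) y).

Record finsler_metric : Prop := FinslerMetric {
  finsler_ge0 : forall p (y : tangent p), 0 <= F y;
  finsler_smooth : forall c, atlas c ->
    smooth_on [set xy : 'rV[R]_n * 'rV[R]_n | img c xy.1 /\ xy.2 != 0]
      (fun xy => local_expr c xy.1 xy.2);
  finsler_homogeneous : forall p (y : tangent p) (lambda : R), 0 < lambda ->
    F (lambda *: y) = lambda * F y;
  finsler_posdef : forall p (y u : tangent p), y != 0 -> u != 0 ->
    0 < fundamental_form y u u }.

Definition riemannian : Prop :=
  forall p, exists b : tangent p -> tangent p -> R,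
    [/\ forall u, scalar (b u), forall u v, b u v = b v u,
        forall u, u != 0 -> 0 < b u u & forall u, F u ^+ 2 = b u u].

Definition locally_minkowskian : Prop :=
  forall p, exists2 c, chart_at p c &
    forall x x' y, img c x -> img c x' -> local_expr c x y = local_expr c x' y.

Definition partial_x k (f : 'rV[R]_n -> 'rV[R]_n -> R) x y : R :=
  'D_('e_k) (f ^~ y) x.

Definition partial_y k (f : 'rV[R]_n -> 'rV[R]_n -> R) x y : R :=
  'D_('e_k) (f x) y.

Definition metric_coef c x y : 'M[R]_n :=
  \matrix_(i, j) fundamental_form (tangent_of c (param c x) y)
    (tangent_of c (param c x) 'e_i) (tangent_of c (param c x) 'e_j).

Definition spray_coef c i x y : R :=
  let F2 x y := local_expr c x y ^+ 2 in
  4^-1 * \sum_m invmx (metric_coef c x y) i m *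
    (\sum_k partial_x k (partial_y m F2) x y * y 0 k - partial_x m F2 x y).

Definition berwald_curvature c i j k l x y : R :=
  partial_y j (partial_y k (partial_y l (spray_coef c i))) x y.

Definition berwald : Prop :=
  forall c x y, atlas c -> img c x -> y != 0 ->
  forall i j k l, berwald_curvature c i j k l x y = 0.

Definition riemann_coef c i k x y : R :=
  let G := spray_coef c in
  2 * partial_x k (G i) x y
  - \sum_j partial_x j (partial_y k (G i)) x y * y 0 j
  + 2 * \sum_j G j x y * partial_y j (partial_y k (G i)) x y
  - \sum_j partial_y j (G i) x y * partial_y k (G j) x y.

(* R_y(u), computed in a chart c around p; it does not depend on c. *)
Definition riemann_curvature c p (y u : tangent p) : tangent p :=
  tangent_of c p
    (\row_i \sum_k riemann_coef c i k (coord c p) (y c) * u c 0 k).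

(* K(P, y) for P = span{y, u}, computed in a chart c around p; it depends
   neither on u nor on c. *)
Definition flag_curvature c p (y u : tangent p) : R :=
  let g := fundamental_form y in
  g u (riemann_curvature c y u) / (g y y * g u u - g y u ^+ 2).

End Finsler.

Section Flags.
Context {R : realType} {V : lmodType R}.

Definition span2 (u v : V) : set V :=
  [set a *: u + b *: v | a in setT & b in setT].

Definition two_plane (P : set V) : Prop :=
  exists u v, (forall a b : R, a *: u + b *: v = 0 -> a = 0 /\ b = 0) /\
    P = span2 u v.

Definition flag (P : set V) (y : V) : Prop :=
  [/\ two_plane P, P y & y != 0].

End Flags.

(* Main.v *)
(* In a chart write L = F^2 and let G^i be the spray coefficients.  Since F is
   Berwald, the Hessian of G^i in y is constant on R^n \ {0}, which is connected
   as n >= 2; hence G^i = (1/2) Gam^i_(jk)(x) y^j y^k for a torsion-free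
   connection Gam, whose parallel transport preserves L:
     D_(u, 0) L = D_(0, Gam(u, y)) L.
   Commuting two such derivatives shows that L(x, .) is constant along the
   linear vector fields y |-> Rm(u, v) y, where Rm is the curvature of Gam, and
   R_y(u) = Rm(u, y) y.

   If K = 0 then, R_y being self-adjoint for g_y by the Bianchi identity,
   R_y = 0 for all y, hence Rm = 0.  A flat torsion-free connection has local
   coordinates with parallel coordinate fields (Frobenius along rays, then the
   inverse function theorem), in which L does not depend on x.

   If K <> 0, the kernel of R_y is spanned by y, so the fields y |-> Rm(u, v) y
   span the tangent spaces of the level sets of L(x, .).  Take an inscribed
   ellipsoid of maximal volume.  At a contact point a field A is tangent to
   both hypersurfaces, and comparing second derivatives and varying the
   ellipsoid gives tr (A + A^T)^2 <= 0 in the coordinates where the ellipsoid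
   is the unit ball.  So all these fields preserve the ellipsoid, and L(x, .) is a
   multiple of its quadratic form. *)
From HB Require Import structures.
From mathcomp Require Import all_boot all_order all_algebra.
From mathcomp Require Import all_classical all_reals topology normedtype derive landau.
From mathcomp Require Import sequences measure lebesgue_measure lebesgue_integral ftc.
From mathcomp Require Import ring lra zify.
Require Import Defs.
Import numFieldNormedType.Exports.
Import Order.TTheory GRing.Theory Num.Theory.

Set Implicit Arguments.
Unset Strict Implicit.
Unset Printing Implicit Defensive.

Local Open Scope classical_set_scope.
Local Open Scope ring_scope.

(** * Smooth maps between normed spaces *)

(** [L] is known to be smooth only off the zero section, so all local work takes place on pairs
    [(x, y)] with [y != 0]. Keeping the pair as one variable lets [schwarz] swap base and fibre
    derivatives. The curvature matrices come one at a time, with no group at hand to average over.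
    The extremal ellipsoid replaces averaging: it shows that each single linear field tangent to the
    level sets of [l] is skew for one common quadratic form. In the code this form lies below [l],
    so the body [|y P| <= 1] encloses [l <= 1], and a maximal [|\det P|] means least volume. The
    Frobenius theorem is quantitative. The solution along a ray predicts, to first order, the
    solution along a neighbouring ray; flatness is exactly what makes the error of this prediction
    quadratic in the displacement, and a quadratic error is differentiability. Coframe and
    coordinates are found together, as one linear system of size [n + 1]: its curvature collects
    both the curvature and the torsion of the connection. *)

Section Differentiability.
Context {R : realType} {V W : normedModType R}.
Implicit Types (f g : V -> W) (x v : V).

(** By uniqueness of the differential, an explicit remainder bound both proves differentiability and
    identifies ['d f x]. The differentials built by hand below (solutions of linear systems, inverse
    maps) go through this criterion. *)
Lemma differentiable_eps f x (l : {linear V -> W}) : continuous l ->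
  (forall e : R, 0 < e ->
     \forall h \near (0 : V), `|f (h + x) - f x - l h| <= e * `|h|) ->
  differentiable f x /\ 'd f x = l :> (V -> W).
Proof.
move=> lc H.
have E : f \o shift x = cst (f x) + l +o_ 0 id.
  apply/eqaddoE; rewrite funeqE => h /=.
  rewrite -[LHS](subrK (f x + l h)) addrC; congr (_ + _).
  transitivity ((fun h => f (h + x) - f x - l h) h); first by rewrite opprD addrA.
  by rewrite littleoE.
have D := diff_unique lc E; split => //.
apply/diff_locallyP; rewrite D; split=> //.
Qed.

Lemma differentiableP_eps f x : differentiable f x ->
  forall e : R, 0 < e ->
    \forall h \near (0 : V), `|f (h + x) - f x - 'd f x h| <= e * `|h|.
Proof.
move=> /diff_locally /eqaddoP H e e0; near=> h.
have : `|(f \o shift x - (cst (f x) + 'd f x)) h| <= e * `|h|.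
  by near: h; exact: H.
by rewrite !fctE opprD addrA.
Unshelve. all: by end_near. Qed.

Lemma near_eq_differentiable f g x :
  (\near x, f x = g x) -> differentiable f x -> differentiable g x.
Proof.
move=> fg df; have dc := diff_continuous df.
suff [] : differentiable g x /\ 'd g x = 'd f x :> (V -> W) by [].
apply: differentiable_eps => // e e0.
have fgx := nbhs_singleton fg.
near=> h; rewrite -fgx; have <- : f (h + x) = g (h + x).
  by near: h; move: fg; rewrite (near_shift 0 x); apply: filterS => y /=; rewrite subr0.
by near: h; exact: differentiableP_eps.
Unshelve. all: by end_near. Qed.

Lemma open_near_eq (U : set V) f g x : open U -> U x ->
  (forall y, U y -> f y = g y) -> \near x, f x = g x.
Proof.
by move=> oU Ux fg; near=> y; apply: fg; near: y; exact: open_nbhs_nbhs.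
Unshelve. all: by end_near. Qed.

End Differentiability.

Section CkGeneral.
Context {R : realType} {V W : normedModType R}.
Implicit Types (f g : V -> W) (x v : V) (U : set V) (k : nat).

Lemma Ck_onW k U f : Ck_on k.+1 U f -> Ck_on k U f.
Proof.
elim: k f => [|k IH] f [df Df]; first by move=> x Ux; apply/differentiable_continuous/df.
by split=> // v; apply: IH; exact: Df.
Qed.

Lemma Ck_on_le k k' U f : (k <= k')%N -> Ck_on k' U f -> Ck_on k U f.
Proof.
move=> /subnK <-; elim: (k' - k)%N => [//|d IH]; rewrite addSn => /Ck_onW; exact: IH.
Qed.

Lemma Ck_on_sub k U U' f : U' `<=` U -> Ck_on k U f -> Ck_on k U' f.
Proof.
move=> sU; elim: k f => [|k IH] f; first by move=> fc x /sU; exact: fc.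
by move=> [df Df]; split=> [x /sU|v]; [exact: df|apply: IH; exact: Df].
Qed.

Lemma Ck_on_eq k U f g : open U -> (forall x, U x -> f x = g x) ->
  Ck_on k U f -> Ck_on k U g.
Proof.
move=> oU; elim: k f g => [|k IH] f g fg /=.
  move=> fc x Ux.
  have fx : f @ x --> f x by exact: fc.
  suff : g @ x --> g x by []; rewrite -(fg _ Ux); apply: cvg_trans fx.
  by apply: near_eq_cvg; have := open_near_eq oU Ux fg; apply: filterS => y ->.
move=> [df Df]; split=> [x Ux|v].
  by apply: near_eq_differentiable (df _ Ux); exact: open_near_eq fg.
apply: IH (Df v) => x Ux; apply: near_eq_derive; exact: open_near_eq fg.
Qed.

Lemma Ck_on_cst k U (a : W) : Ck_on k U (cst a).
Proof.
elim: k a => [|k IH] a; first by move=> x _; exact: cst_continuous.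
split=> [x _|v]; first exact: differentiable_cst.
have -> : 'D_v (cst a : V -> W) = cst 0 by apply/funext => x; rewrite derive_cst.
exact: IH.
Qed.

Lemma Ck_on_linear k U (l : {linear V -> W}) : continuous l -> Ck_on k U l.
Proof.
move=> lc; case: k => [|k]; first by move=> x _; exact: lc.
split=> [x _|v]; first exact: linear_differentiable.
have -> : 'D_v l = cst (l v).
  by apply/funext => x; rewrite deriveE ?diff_lin//; exact: linear_differentiable.
exact: Ck_on_cst.
Qed.

Lemma Ck_onD k U f g : open U -> Ck_on k U f -> Ck_on k U g -> Ck_on k U (f \+ g).
Proof.
move=> oU; elim: k f g => [|k IH] f g; first by move=> fc gc x Ux; apply: continuousD; [exact: fc|exact: gc].
move=> [df Df] [dg Dg]; split=> [x Ux|v]; first by apply: differentiableD; [exact: df|exact: dg].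
apply: (Ck_on_eq oU _ (IH _ _ (Df v) (Dg v))) => x Ux /=.
by rewrite -deriveD //; apply: diff_derivable; [exact: df|exact: dg].
Qed.

End CkGeneral.

Section CkScalar.
Context {R : realType} {V : normedModType R}.
Implicit Types (f g : V -> R) (x v : V) (U : set V) (k : nat).

Lemma Ck_onM k U f g : open U -> Ck_on k U f -> Ck_on k U g -> Ck_on k U (f \* g).
Proof.
move=> oU; elim: k f g => [|k IH] f g; first by move=> fc gc x Ux; apply: continuousM; [exact: fc|exact: gc].
move=> Cf Cg; have [df Df] := Cf; have [dg Dg] := Cg.
split=> [x Ux|v]; first by apply: differentiableM; [exact: df|exact: dg].
have := Ck_onD oU (IH _ _ (Ck_onW Cf) (Dg v)) (IH _ _ (Ck_onW Cg) (Df v)).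
apply: (Ck_on_eq oU) => x Ux /=.
by rewrite [RHS]deriveM //; apply: diff_derivable; [exact: df|exact: dg].
Qed.

Lemma Ck_onN k U f : open U -> Ck_on k U f -> Ck_on k U (fun x => - f x).
Proof.
move=> oU Cf; apply: (Ck_on_eq oU _ (Ck_onM oU (Ck_on_cst k U (-1 : R)) Cf)) => x _ /=.
by rewrite mulN1r.
Qed.

Lemma Ck_onB k U f g : open U -> Ck_on k U f -> Ck_on k U g -> Ck_on k U (f \- g).
Proof. by move=> oU Cf Cg; apply: Ck_onD => //; exact: Ck_onN. Qed.

Lemma Ck_onV k U f : open U -> (forall x, U x -> f x != 0) -> Ck_on k U f ->
  Ck_on k U (fun x => (f x)^-1).
Proof.
move=> oU f0; elim: k => [|k IH] Cf; first by move=> x Ux; apply: continuousV; [exact: f0|exact: Cf].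
have [df Df] := Cf.
split=> [x Ux|v]; first by apply: differentiableV; [exact: df|exact: f0].
have := Ck_onN oU (Ck_onM oU (Ck_onM oU (IH (Ck_onW Cf)) (IH (Ck_onW Cf))) (Df v)).
apply: (Ck_on_eq oU) => x Ux /=.
rewrite deriveV ?f0 //; last by apply: diff_derivable; exact: df.
by rewrite /= -[_ *: _]/(_ * _) expr2 invfM mulNr.
Qed.

Lemma Ck_onX k U f m : open U -> Ck_on k U f -> Ck_on k U (fun x => f x ^+ m).
Proof.
move=> oU Cf; elim: m => [|m IH]; first exact: (Ck_on_eq oU _ (Ck_on_cst k U (1 : R))).
by apply: (Ck_on_eq oU _ (Ck_onM oU Cf IH)) => x _ /=; rewrite exprS.
Qed.

Lemma Ck_on_sum k U (I : Type) (r : seq I) (P : pred I) (F : I -> V -> R) :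
  open U -> (forall i, Ck_on k U (F i)) ->
  Ck_on k U (fun x => \sum_(i <- r | P i) F i x).
Proof.
move=> oU CF; elim: r => [|i r IH].
  by apply: (Ck_on_eq oU _ (Ck_on_cst k U (0 : R))) => x _; rewrite big_nil.
have [Pi|Pi] := boolP (P i); last by apply: (Ck_on_eq oU _ IH) => x _; rewrite big_cons (negbTE Pi).
by apply: (Ck_on_eq oU _ (Ck_onD oU (CF i) IH)) => x _ /=; rewrite big_cons Pi.
Qed.

Lemma Ck_on_prod k U (I : Type) (r : seq I) (P : pred I) (F : I -> V -> R) :
  open U -> (forall i, Ck_on k U (F i)) ->
  Ck_on k U (fun x => \prod_(i <- r | P i) F i x).
Proof.
move=> oU CF; elim: r => [|i r IH].
  by apply: (Ck_on_eq oU _ (Ck_on_cst k U (1 : R))) => x _; rewrite big_nil.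
have [Pi|Pi] := boolP (P i); last by apply: (Ck_on_eq oU _ IH) => x _; rewrite big_cons (negbTE Pi).
by apply: (Ck_on_eq oU _ (Ck_onM oU (CF i) IH)) => x _ /=; rewrite big_cons Pi.
Qed.

Lemma Ck_on_det k U m (A : V -> 'M[R]_m) : open U ->
  (forall i j, Ck_on k U (fun x => A x i j)) -> Ck_on k U (fun x => \det (A x)).
Proof.
move=> oU CA; apply: Ck_on_sum => // s; apply: Ck_onM => //; first exact: Ck_on_cst.
by apply: Ck_on_prod.
Qed.

Lemma Ck_on_invmx k U m (A : V -> 'M[R]_m) : open U ->
  (forall i j, Ck_on k U (fun x => A x i j)) ->
  (forall x, U x -> A x \in unitmx) ->
  forall i j, Ck_on k U (fun x => invmx (A x) i j).
Proof.
move=> oU CA uA i j.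
have C1 : Ck_on k U (fun x => (\det (A x))^-1).
  apply: Ck_onV => // [x Ux|]; last exact: Ck_on_det.
  by have := uA _ Ux; rewrite unitmxE unitfE.
have C2 : Ck_on k U (fun x => cofactor (A x) j i).
  apply: Ck_onM => //; first exact: Ck_on_cst.
  apply: Ck_on_det => // a b; apply: (Ck_on_eq oU _ (CA (lift j a) (lift i b))) => x _.
  by rewrite !mxE.
apply: (Ck_on_eq oU _ (Ck_onM oU C1 C2)) => x Ux /=.
by rewrite /invmx (uA _ Ux) !mxE.
Qed.

End CkScalar.

Section CkMatrix.
Context {R : realType} {V : normedModType R} {m n : nat}.
Implicit Types (f : V -> 'M[R]_(m, n)) (U : set V).

Lemma differentiable_mxP f x :
  differentiable f x <-> forall i j, differentiable (fun y => f y i j) x.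
Proof.
split=> [df i j|df].
  exact: (differentiable_comp (g := fun A : 'M[R]_(m, n) => A i j) df (differentiable_coord _ i j)).
have -> : f = \sum_i \sum_j (fun y => f y i j *: delta_mx i j).
  apply/funext => y; rewrite [LHS]matrix_sum_delta fct_sumE; apply: eq_bigr => i _.
  by rewrite fct_sumE.
by apply: differentiable_sum => i; apply: differentiable_sum => j; exact: differentiableZl.
Qed.

Lemma derive_mxE f x v i j : differentiable f x ->
  'D_v f x i j = 'D_v (fun y => f y i j) x.
Proof. by move=> df; rewrite derive_mx ?mxE//; exact: diff_derivable. Qed.

Lemma Ck_on_mxP k U f : open U ->
  Ck_on k U f <-> forall i j, Ck_on k U (fun y => f y i j).
Proof.
move=> oU; elim: k f => [|k IH] f.
  split=> [fc i j x Ux|fc x Ux].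
    exact: (continuous_comp (f := f) (g := fun A : 'M[R]_(m, n) => A i j) (fc x Ux)
      (differentiable_continuous (differentiable_coord _ i j))).
  have -> : f = \sum_i \sum_j (fun y => f y i j *: delta_mx i j).
    apply/funext => y; rewrite [LHS]matrix_sum_delta fct_sumE; apply: eq_bigr => i _.
    by rewrite fct_sumE.
  suff H (I : finType) (F : I -> V -> 'M[R]_(m, n)) : (forall i, {for x, continuous (F i)}) ->
      {for x, continuous (\sum_i F i)}.
    by apply: (H) => i; apply: (H) => j; apply: continuousZr_tmp; exact: fc.
  move=> cF; elim/big_ind: _ => [|a b|i _].
  - exact: (@cst_continuous V 'M[R]_(m, n) 0 x).
  - by move=> ca cb; apply: continuousD.
  - exact: cF.
split=> [[df Df] i j|Cf].
  split=> [x /df/differentiable_mxP//|v].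
  have /IH/(_ i j) := Df v; apply: (Ck_on_eq oU) => x Ux /=.
  by rewrite derive_mxE//; exact: df.
have df x : U x -> differentiable f x.
  by move=> Ux; apply/differentiable_mxP => i j; have [/(_ x Ux)] := Cf i j.
split=> // v; apply/IH => i j; have [_ /(_ v)] := Cf i j; apply: (Ck_on_eq oU) => x Ux /=.
by rewrite derive_mxE//; exact: df.
Qed.

End CkMatrix.

Section Composition.
Context {R : realType} {X : normedModType R} {n : nat}.

Lemma deriveE_rV (f : 'rV[R]_n -> R) x v : differentiable f x ->
  'D_v f x = \sum_j v 0 j * 'D_('e_j) f x.
Proof.
move=> df; rewrite deriveE // [v in LHS]row_sum_delta linear_sum; apply: eq_bigr => j _.
by rewrite linearZ /= deriveE.
Qed.

(** The intermediate space is a space of rows, so the chain rule writes the derivative as a finite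
    sum of coordinates of ['D_v g] times ['D_('e_j) f] at [g x]. The directions ['e_j] do not depend
    on [x], and the induction hypothesis applies to each factor. *)
Lemma Ck_on_comp k (U : set 'rV[R]_n) (U' : set X) (f : 'rV[R]_n -> R) (g : X -> 'rV[R]_n) :
  open U -> open U' -> (forall x, U' x -> U (g x)) ->
  Ck_on k U f -> Ck_on k U' g -> Ck_on k U' (fun x => f (g x)).
Proof.
move=> oU oU' gU; elim: k f => [|k IH] f.
  by move=> fc gc x Ux; apply: continuous_comp; [exact: gc|exact/fc/gU].
move=> [df Df] Cg; have [dg Dg] := Cg; split=> [x Ux|v].
  by apply: differentiable_comp; [exact: dg|exact/df/gU].
have H : Ck_on k U' (fun x => \sum_j 'D_v g x 0 j * 'D_('e_j) f (g x)).
  apply: Ck_on_sum => // j; apply: Ck_onM => //.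
    by have /(Ck_on_mxP _ _ oU')/(_ 0 j) := Dg v.
  by apply: IH (Df _) (Ck_onW Cg).
apply: (Ck_on_eq oU' _ H) => x Ux /=.
rewrite [RHS]deriveE; last by apply: differentiable_comp; [exact: dg|exact/df/gU].
have := diff_comp_at v (erefl (g x)) (dg _ Ux) (df _ (gU _ Ux)) => ->.
rewrite -!deriveE ?deriveE_rV//; [exact/df/gU|exact: dg|exact/df/gU].
Qed.

Lemma Ck_on_comp_mx m p k (U : set 'rV[R]_n) (U' : set X) (f : 'rV[R]_n -> 'M[R]_(m, p))
  (g : X -> 'rV[R]_n) :
  open U -> open U' -> (forall x, U' x -> U (g x)) ->
  Ck_on k U f -> Ck_on k U' g -> Ck_on k U' (fun x => f (g x)).
Proof.
move=> oU oU' gU /(Ck_on_mxP _ _ oU) Cf Cg; apply/(Ck_on_mxP _ _ oU') => i j.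
exact: (Ck_on_comp oU oU' gU (Cf i j) Cg).
Qed.

End Composition.

(** * Mean values along segments and symmetry of second derivatives *)

Section LineCalculus.
Context {R : realType} {V : normedModType R}.
Implicit Types (f : V -> R) (x u v h : V).

Lemma derive_line (W : normedModType R) (f : V -> W) x h (t : R) :
  'D_1 (fun s : R => f (s *: h + x)) t = 'D_h f (t *: h + x).
Proof.
rewrite /derive; set g1 := fun k => k^-1 *: _; set g2 := fun k => k^-1 *: _.
suff -> : g1 = g2 by [].
by apply/funext => k; rewrite /g1 /g2 /= scalerDl addrA [k *: 1]mulr1.
Qed.

Lemma is_derive_line (W : normedModType R) (f : V -> W) x h (t : R) :
  differentiable f (t *: h + x) ->
  is_derive t 1 (fun s : R => f (s *: h + x)) ('D_h f (t *: h + x)).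
Proof.
move=> df; apply: DeriveDef; last exact: derive_line.
apply/derivable1_diffP.
apply: (differentiable_comp (f := fun s : R => s *: h + x)) => //.
Qed.

Lemma derive_translate (W : normedModType R) (f : V -> W) a x h :
  'D_h (fun y => f (a + y)) x = 'D_h f (a + x).
Proof.
rewrite /derive; set g1 := fun k => k^-1 *: _; set g2 := fun k => k^-1 *: _.
by suff -> : g1 = g2 by []; apply/funext => k; rewrite /g1 /g2 /= addrCA.
Qed.

Lemma differentiable_translate (W : normedModType R) (f : V -> W) a x :
  differentiable f (a + x) -> differentiable (fun y => f (a + y)) x.
Proof. by move=> df; apply: (differentiable_comp (f := fun y => a + y)). Qed.

Lemma deriveZv (W : normedModType R) (f : V -> W) (t : R) x h :
  differentiable f x -> 'D_(t *: h) f x = t *: 'D_h f x.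
Proof. by move=> df; rewrite !deriveE // linearZ. Qed.

Lemma deriveDv (W : normedModType R) (f : V -> W) x h k :
  differentiable f x -> 'D_(h + k) f x = 'D_h f x + 'D_k f x.
Proof. by move=> df; rewrite !deriveE // linearD. Qed.

Lemma MVT_line f x h :
  (forall t : R, 0 <= t <= 1 -> differentiable f (t *: h + x)) ->
  exists2 t : R, 0 < t < 1 & f (h + x) - f x = 'D_h f (t *: h + x).
Proof.
move=> df.
have dl (t : R) : 0 <= t <= 1 ->
    is_derive t 1 (fun s : R => f (s *: h + x)) ('D_h f (t *: h + x)).
  by move=> /df; exact: is_derive_line.
have [||c c01] := @MVT R (fun s => f (s *: h + x)) (fun t => 'D_h f (t *: h + x)) 0 1 ltr01.
- by move=> t; rewrite in_itv /= => /andP[t0 t1]; apply: dl; rewrite !ltW.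
- apply: derivable_within_continuous => t; rewrite in_itv /= => /dl tt.
  exact: ex_derive.
rewrite scale1r scale0r add0r subr0 mulr1 => ->.
by exists c => //; move: c01; rewrite in_itv.
Qed.

Lemma ler_distM (a b c e : R) : 0 < c -> `|b - a| <= e -> `|c * a - c * b| <= c * e.
Proof. by move=> c0 ab; rewrite -mulrBr normrM gtr0_norm // ler_pM2l // distrC. Qed.

Lemma ler_dist_half (P a b c e : R) : 0 < c -> `|P - c * a| <= c * (e / 2) ->
  `|P - c * b| <= c * (e / 2) -> `|a - b| <= e.
Proof.
move=> c0 Ha Hb; rewrite -(ler_pM2l c0) -{1}(gtr0_norm c0) -normrM mulrBr.
have -> : c * a - c * b = (P - c * b) - (P - c * a) by ring.
by rewrite (le_trans (ler_normB _ _)) // (le_trans (lerD Hb Ha)) // -mulrDr -splitr.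
Qed.

(** The second difference of [f] over the parallelogram spanned by [t u] and [t v] is symmetric in
    [u] and [v]. Two mean values write it as [t^2] times a mixed derivative at a nearby point, and
    continuity of that derivative lets [t] shrink. *)
Lemma schwarz (U : set V) f x u v : open U -> Ck_on 2 U f -> U x ->
  'D_u ('D_v f) x = 'D_v ('D_u f) x.
Proof.
move=> oU [df Df] Ux.
have dDf w y : U y -> differentiable ('D_w f) y by move=> Uy; have [H _] := Df w; exact: H.
have cDf w w' : {for x, continuous ('D_w' ('D_w f))} by have [_ H] := Df w; exact: H.
have key (w w' : V) (e : R) : 0 < e -> exists2 d : R, 0 < d & forall t, 0 < t < d ->
    `|(f (t *: w + (t *: w' + x)) - f (t *: w' + x) - (f (t *: w + x) - f x))
       - t ^+ 2 * 'D_w' ('D_w f) x| <= t ^+ 2 * e.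
  move=> e0.
  have /cvgrPdist_le/(_ e e0) /nbhs_normP [d /= d0 dP] := cDf w w'.
  have /nbhs_normP [d' /= d'0 dU] := open_nbhs_nbhs (conj oU Ux).
  (* [M] bounds the displacement per unit of [t] over the whole parallelogram; the summand 1 keeps
     it positive when both vectors vanish. *)
  pose M := `|w| + `|w'| + 1.
  have M0 : 0 < M by rewrite ltr_wpDl // addr_ge0.
  have near_x (t a b : R) : 0 < t < Num.min d d' / M -> 0 <= a <= 1 -> 0 <= b <= 1 ->
     U (a *: (t *: w) + (b *: (t *: w') + x)) /\
     `|'D_w' ('D_w f) x - 'D_w' ('D_w f) (a *: (t *: w) + (b *: (t *: w') + x))| <= e.
    move=> /andP[t0 td] /andP[a0 a1] /andP[b0 b1].
    have D : `|x - (a *: (t *: w) + (b *: (t *: w') + x))| < Num.min d d'.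
      rewrite addrA opprD addrCA subrr addr0 normrN.
      move: td; rewrite ltr_pdivlMr //; apply: le_lt_trans.
      rewrite (le_trans (ler_normD _ _)) // !normrZ !ger0_norm // ?(ltW t0) // /M !mulrDr.
      have ha : a * (t * `|w|) <= t * `|w| by rewrite ler_piMl // mulr_ge0 // ltW.
      have hb : b * (t * `|w'|) <= t * `|w'| by rewrite ler_piMl // mulr_ge0 // ltW.
      by rewrite (le_trans (lerD ha hb)) // lerDl mulr1 ltW.
    move: D; rewrite lt_min => /andP[Dd Dd']; split; first exact: dU.
    exact: dP.
  exists (Num.min d d' / M); first by rewrite divr_gt0 // lt_min d0.
  move=> t td; have t0 : 0 < t by case/andP: td.
  have z1 : 0 <= (0 : R) <= 1 by rewrite lexx ler01.
  have o1 : 0 <= (1 : R) <= 1 by rewrite lexx ler01.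

  have z01 (s : R) : 0 < s < 1 -> 0 <= s <= 1 by case/andP=> *; rewrite !ltW.
  have Ul (a b : R) : 0 <= a <= 1 -> 0 <= b <= 1 -> U (a *: (t *: w) + (b *: (t *: w') + x)).
    by move=> a01 b01; have [] := near_x t a b td a01 b01.
  have U1 s : 0 <= s <= 1 -> U (s *: (t *: w) + x).
    by move=> s01; have := Ul s 0 s01 z1; rewrite scale0r add0r.
  have U2 s r : 0 <= s <= 1 -> 0 <= r <= 1 -> U (r *: (t *: w') + (s *: (t *: w) + x)).
    by move=> s01 r01; rewrite addrCA; exact: Ul.
  have U3 s : 0 <= s <= 1 -> U (t *: w' + (s *: (t *: w) + x)).
    by move=> s01; have := U2 s 1 s01 o1; rewrite scale1r.
  (* First mean value, along [w], for the difference of [f] at two points [t w'] apart; the second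
     one, along [w'], is for ['D_w f]. *)
  have [s s01'|s s01 Es] := @MVT_line (fun y => f (t *: w' + y) - f y) x (t *: w).
    apply: differentiableB; last exact/df/U1.
    by apply: differentiable_translate; exact/df/U3.
  have s01' := z01 _ s01.
  pose g y := t *: 'D_w f y.
  have {}Es : f (t *: w + (t *: w' + x)) - f (t *: w' + x) - (f (t *: w + x) - f x)
      = g (t *: w' + (s *: (t *: w) + x)) - g (s *: (t *: w) + x).
    have Eg y : U y -> g y = 'D_(t *: w) f y by move=> Uy; rewrite deriveZv //; exact: df.
    rewrite !Eg; [|exact: U1|exact: U3].
    rewrite -derive_translate -deriveB; first last.
    - by apply/diff_derivable/df/U1.
    - by apply/diff_derivable/differentiable_translate/df/U3.
    rewrite -[RHS]Es addrCA; ring.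
  have [r r01'|r r01 Er] := @MVT_line g (s *: (t *: w) + x) (t *: w').
    by apply: differentiableZ; exact/dDf/U2.
  have r01' := z01 _ r01.
  have [_] := near_x t s r td s01' r01'; rewrite addrCA => near1.
  rewrite Es Er deriveZ; last by apply/diff_derivable/dDf/U2.
  rewrite deriveZv; last exact/dDf/U2.
  move: near1; set A := 'D_w' ('D_w f) (r *: _ + _) => near1.
  have -> : t *: (t *: A) = t ^+ 2 * A by rewrite expr2 -mulrA.
  by apply: ler_distM => //; exact: exprn_gt0.
apply/eqP; rewrite -subr_eq0 -normr_le0; apply/ler_addgt0Pl => e e0; rewrite addr0.
have e20 : 0 < e / 2 by rewrite divr_gt0.
have [d1 d10 H1] := key u v _ e20; have [d2 d20 H2] := key v u _ e20.
pose t := Num.min d1 d2 / 2.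
have t0 : 0 < t by rewrite divr_gt0 // lt_min d10.
have tm : t < Num.min d1 d2 by rewrite ltr_pdivrMr // ltr_pMr ?lt_min ?d10 // ltr1n.
move: (tm); rewrite lt_min => /andP[td1 td2].
have := H1 t; rewrite t0 td1 => /(_ isT) {}H1.
have := H2 t; rewrite t0 td2 => /(_ isT) {}H2.
apply: (ler_dist_half (exprn_gt0 2 t0) H2); apply: le_trans H1.
by rewrite [t *: v + (t *: u + x)]addrCA le_eqVlt; apply/orP; left; apply/eqP; congr (`|_|); ring.
Qed.

End LineCalculus.

(** * Linear differential equations and flat connections *)

Section MatrixNorm.
Context {R : realType}.

Lemma mx_coord_norm m n (A : 'M[R]_(m, n)) i j : `|A i j| <= `|A|.
Proof.
rewrite [leRHS]/Num.Def.normr /= mx_normrE.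
exact: (le_bigmax _ (fun ij : 'I_m * 'I_n => `|A ij.1 ij.2|) (i, j)).
Qed.

Lemma mx_norm_le m n (A : 'M[R]_(m, n)) e : 0 <= e ->
  (forall i j, `|A i j| <= e) -> `|A| <= e.
Proof.
move=> e0 Ae; rewrite [leLHS]/Num.Def.normr /= mx_normrE.
by apply: bigmax_le => // -[i j] _; exact: Ae.
Qed.

(** The norm is the maximum of the entries, which is submultiplicative only up to the inner
    dimension. This is where the factors [n] and [m] in later constants come from. *)
Lemma mulmx_norm m n p (A : 'M[R]_(m, n)) (B : 'M[R]_(n, p)) :
  `|A *m B| <= n%:R * (`|A| * `|B|).
Proof.
apply: mx_norm_le => [|i j]; first by rewrite !mulr_ge0.
rewrite mxE (le_trans (ler_norm_sum _ _ _)) //.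
rewrite -[X in X%:R * _]card_ord -sumr_const mulr_suml; apply: ler_sum => k _.
by rewrite mul1r normrM ler_pM // mx_coord_norm.
Qed.

End MatrixNorm.

Lemma Ck_on_mulmx {R : realType} {V : normedModType R} m n p k (U : set V)
  (f : V -> 'M[R]_(m, n)) (g : V -> 'M[R]_(n, p)) : open U ->
  Ck_on k U f -> Ck_on k U g -> Ck_on k U (fun x => f x *m g x).
Proof.
move=> oU /(Ck_on_mxP _ _ oU) Cf /(Ck_on_mxP _ _ oU) Cg; apply/(Ck_on_mxP _ _ oU) => i j.
apply: (Ck_on_eq oU (f := fun x => \sum_l f x i l * g x l j)) => [x _|]; first by rewrite mxE.
by apply: Ck_on_sum => // l; apply: Ck_onM.
Qed.

Lemma continuous_Ck0 {R : realType} {V W : normedModType R} (f : V -> W) :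
  continuous f <-> Ck_on 0 setT f.
Proof. by split=> [fc x _|fc x]; [exact: fc|exact: (fc x I)]. Qed.

Lemma exprV2_lt {R : realType} (C e : R) : 0 < e -> exists k, C * 2^-1 ^+ k < e.
Proof.
move=> e0; have := @cvg_geometric R C 2^-1.
rewrite gtr0_norm ?invr_gt0 // invf_lt1 // ltr1n => /(_ isT) /cvgrPdist_lt /(_ e e0) [N _ HN].
exists N; apply: le_lt_trans (ler_norm _) _; rewrite -normrN -sub0r; exact: HN (leqnn _).
Qed.

(** * Picard iteration for linear systems on the unit interval *)

Section LinearODE.
Context {R : realType} {m : nat}.

(** Integrating from -1 and differentiating on [(-1, 2)] puts [[0, 1]] in the interior, so the
    derivatives at 0 and 1 are two-sided. *)
Lemma antiderivative (f : R -> R) : continuous f ->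
  exists2 g : R -> R, g 0 = 0 & forall t : R, -1 < t < 2 -> is_derive t 1 g (f t).
Proof.
move=> fc; pose G (x : R) := (\int[lebesgue_measure]_(t in `[-1, x]) f t)%R.
have dG (t : R) : -1 < t < 2 -> is_derive t 1 G (f t).
  move=> /andP[t1 t2].
  have [|||dG1 dGE] := @continuous_FTC1_closed R f (-1) t 2 t2.
  - apply: continuous_compact_integrable; first exact: segment_compact.
    exact: continuous_subspaceT.
  - exact: t1.
  - exact: fc.
  by apply: (DeriveDef dG1); rewrite -dGE derive1E.
exists (fun x => G x - G 0); first by rewrite subrr.
move=> t /dG dGt; have -> : f t = f t - 0 by rewrite subr0.
by apply: is_deriveB.
Qed.

Lemma antiderivative_rV (f : R -> 'rV[R]_m) : continuous f ->
  exists2 g : R -> 'rV[R]_m, g 0 = 0 &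
    forall t : R, -1 < t < 2 -> is_derive t 1 g (f t).
Proof.
move=> fc.
have fic i : continuous (fun t => f t 0 i).
  move=> t; apply: (continuous_comp (f := f) (g := fun A : 'rV[R]_m => A 0 i)); first exact: fc.
  exact: differentiable_continuous (differentiable_coord _ _ _).
pose g i := sval (cid2 (antiderivative (fic i))).
have g0 i : g i 0 = 0 by rewrite /g; case: cid2.
have dg i (t : R) : -1 < t < 2 -> is_derive t 1 (g i) (f t 0 i) by rewrite /g; case: cid2 => /= ? _; exact.
exists (fun t => \row_i g i t); first by apply/rowP => i; rewrite !mxE g0.
move=> t t12; have D : derivable (fun t => \row_i g i t) t 1.
  apply/derivable_mxP => i j; have := dg j t t12; rewrite ord1 => -[+ _].
  by have -> : g j = fun x => (\row_i g i x) 0 j by apply/funext => x; rewrite mxE.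
apply: DeriveDef => //; rewrite derive_mx //; apply/rowP => i; rewrite !mxE.
have <- : g i = fun x => (\row_i g i x) 0 i by apply/funext => x; rewrite mxE.
by have [] := dg i t t12.
Qed.

(** The mean value theorem is applied coordinate by coordinate; with the sup norm no dimension
    factor appears. *)
Lemma rV_mean_value (g df : R -> 'rV[R]_m) (K : R) (t : R) : 0 <= t <= 1 -> 0 <= K ->
  (forall s : R, 0 <= s <= 1 -> is_derive s 1 g (df s)) ->
  (forall s : R, 0 <= s <= 1 -> `|df s| <= K) -> `|g t - g 0| <= K.
Proof.
move=> /andP[t0 t1] K0 dg dfK; apply: mx_norm_le => // i j; rewrite ord1.
have dgj (s : R) : 0 <= s <= 1 -> is_derive s 1 (fun u => g u 0 j) (df s 0 j).
  move=> /dg [/[dup] D /derivable_mxP/(_ 0 j) Dj <-]; apply: DeriveDef => //.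
  by rewrite derive_mx // mxE.
have [||c] := @MVT_segment R (fun u => g u 0 j) (fun u => df u 0 j) 0 t t0.
- move=> x; rewrite in_itv /= => /andP[x0 xt]; apply: dgj.
  by rewrite ltW //= (le_trans (ltW xt)).
- apply: derivable_within_continuous => x; rewrite in_itv /= => /andP[x0 xt].
  by apply: (@ex_derive _ _ _ _ _ _ (df x 0 j)); apply: dgj; rewrite x0 (le_trans xt).
rewrite in_itv /= subr0 => /andP[c0 ct] E; rewrite !mxE E normrM (ger0_norm t0).
have : `|df c 0 j| <= K by rewrite (le_trans (mx_coord_norm _ _ _)) // dfK // c0 (le_trans ct).
by move=> H; rewrite -[leRHS]mulr1 ler_pM.
Qed.

(** Completeness with an explicit rate: it serves both Picard iteration and the fixed-point
    iteration of the inverse function theorem. *)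
Lemma geometric_limit (u : nat -> 'rV[R]_m) (C : R) :
  (forall k, `|u k.+1 - u k| <= C * 2^-1 ^+ k) ->
  exists l : 'rV[R]_m, forall k, `|l - u k| <= C * 2 * 2^-1 ^+ k.
Proof.
move=> uC.
have C0 : 0 <= C by have := uC 0; rewrite expr0 mulr1; apply: le_trans.
(* The factor [1 - 2^-1 ^+ j] is the exact partial geometric sum; with it the induction on [j]
   closes with equality. *)
have ud k j : `|u (k + j)%N - u k| <= C * 2 * 2^-1 ^+ k * (1 - 2^-1 ^+ j).
  elim: j => [|j IH]; first by rewrite addn0 !subrr normr0 mulr0.
  rewrite addnS -(subrK (u (k + j)%N) (u _.+1)) -addrA (le_trans (ler_normD _ _)) //.
  rewrite (le_trans (lerD (uC _) IH)) // exprD exprS le_eqVlt; apply/orP; left; apply/eqP.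
  by field.
have ud' k j : (k <= j)%N -> `|u j - u k| <= C * 2 * 2^-1 ^+ k.
  move=> kj; rewrite -(subnKC kj) (le_trans (ud _ _)) // ler_piMr //.
    by rewrite !mulr_ge0 // exprn_ge0 // invr_ge0.
  by rewrite lerBlDr lerDl exprn_ge0 // invr_ge0.
have cu : cvgn u.
  apply/cauchy_cvgP/cauchy_exP => e e0.
  have [N HN] := exprV2_lt (C * 2) e0.
  exists (u N); exists N => // j /= Nj; rewrite -ball_normE /=.
  by rewrite distrC (le_lt_trans (ud' _ _ Nj)).
exists (limn u) => k; rewrite distrC.
apply/ler_addgt0Pl => e e0.
have /cvgrPdist_lt /(_ e e0) [N _ HN] := cu.
have H1 := HN (maxn N k) (leq_maxl _ _).
have H2 := ud' k (maxn N k) (leq_maxr _ _).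
rewrite -(subrK (u (maxn N k)) (u k)) -addrA addrC (le_trans (ler_normD _ _)) //.
by rewrite lerD // distrC // ltW // distrC.
Qed.

(** The retraction onto [[0, 1]]: precomposing with it extends data given on [[0, 1]] to the whole
    line, preserving continuity and bounds. *)
Definition clamp (t : R) : R := Num.max 0 (Num.min 1 t).

Lemma clamp_itv t : 0 <= clamp t <= 1.
Proof. by rewrite /clamp le_max lexx /= ge_max ler01 ge_min lexx. Qed.

Lemma clamp_id t : 0 <= t <= 1 -> clamp t = t.
Proof. by rewrite /clamp => /andP[t0 t1]; rewrite (min_r t1) (max_r t0). Qed.

Lemma clamp_continuous : continuous clamp.
Proof.
move=> t; apply: continuous_max; first exact: cst_continuous.
by apply: continuous_min => //; exact: cst_continuous.
Qed.

Lemma clamp12 (t : R) : 0 <= t <= 1 -> -1 < t < 2.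
Proof. by move=> /andP[t0 t1]; apply/andP; split; lra. Qed.

(** The bound [m K <= 1/2] makes the integral operator contract by 1/2 on all of [[0, 1]]. The
    corrections then sum to at most [|z0|], whence the bound [2 |z0|] on the solution. *)
Lemma linear_ode (A : R -> 'M[R]_m) (K : R) (z0 : 'rV[R]_m) : continuous A ->
  (forall t, `|A t| <= K) -> m%:R * K <= 2^-1 ->
  exists2 z : R -> 'rV[R]_m, z 0 = z0 &
    forall t : R, 0 <= t <= 1 -> is_derive t 1 z (z t *m A t) /\ `|z t| <= 2 * `|z0|.
Proof.
move=> Ac AK mK.
have mulc (y : R -> 'rV[R]_m) : continuous y -> continuous (fun t => y t *m A t).
  by move=> /continuous_Ck0 yc; apply/continuous_Ck0/Ck_on_mulmx => //; [exact: openT|exact/continuous_Ck0].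
have K0 : 0 <= K by apply: le_trans (AK 0).
pose C := {y : R -> 'rV[R]_m | continuous y}.
pose I (y : C) := sval (cid2 (antiderivative_rV (mulc _ (svalP y)))).
have I0 y : I y 0 = 0 by rewrite /I; case: cid2.
have dI y (t : R) : -1 < t < 2 -> is_derive t 1 (I y) (sval y t *m A t).
  by rewrite /I; case: cid2 => /= g _; exact.
have Ibound (y y' : C) e : 0 <= e -> (forall t, `|sval y t - sval y' t| <= e) ->
    forall t, 0 <= t <= 1 -> `|I y t - I y' t| <= e / 2.
  move=> e0 ye t t01.
  have := @rV_mean_value (fun t => I y t - I y' t) (fun t => (sval y t - sval y' t) *m A t) (e / 2) t t01.
  rewrite !I0 !subr0; apply; first by rewrite divr_ge0.
    by move=> s /clamp12 s12; rewrite mulmxBl; apply: is_deriveB; exact: dI.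
  move=> s _; rewrite (le_trans (mulmx_norm _ _)) // mulrCA.
  by rewrite ler_pM // ?mulr_ge0 // (le_trans _ mK) // ler_wpM2l.
(* The integral [I y] is controlled only on [(-1, 2)]. Composed with [clamp] it is continuous
   everywhere, so the iteration stays in the type [C]. *)
have Tc (y : C) : continuous (fun t => z0 + I y (clamp t)).
  move=> t; apply: cvgD; first exact: cvg_cst.
  apply: (continuous_comp (f := clamp) (g := I y) (@clamp_continuous t)).
  have [D _] := dI y _ (clamp12 (clamp_itv t)).
  exact/differentiable_continuous/derivable1_diffP.
pose T (y : C) : C := exist _ _ (Tc y).
pose Y k : C := iter k T (exist _ _ (@cst_continuous _ _ z0)).
have YC t k : `|sval (Y k.+1) t - sval (Y k) t| <= `|z0| / 2 * 2^-1 ^+ k.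
  elim: k t => [|k IH] t.
    rewrite /= addrAC subrr add0r expr0 mulr1.
    have := @rV_mean_value (I (Y 0)) (fun t => z0 *m A t) (`|z0| / 2) _ (clamp_itv t).
    rewrite I0 subr0; apply; first by rewrite divr_ge0.
      by move=> s /clamp12 s12; exact: dI.
    move=> s _; rewrite (le_trans (mulmx_norm _ _)) // mulrCA.
    by rewrite ler_pM // ?mulr_ge0 // (le_trans _ mK) // ler_wpM2l.
  rewrite exprSr mulrA; have -> : sval (Y k.+2) t - sval (Y k.+1) t =
      I (Y k.+1) (clamp t) - I (Y k) (clamp t) by rewrite /= opprD addrACA subrr add0r.
  apply: Ibound (clamp_itv t) => //.
  by rewrite !mulr_ge0 // ?exprn_ge0 ?invr_ge0.
have {}YC t := geometric_limit (YC t).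
pose y t := sval (cid (YC t)).
have yY t k : `|y t - sval (Y k) t| <= `|z0| * 2^-1 ^+ k.
  by rewrite (le_trans (svalP (cid (YC t)) k)) // divfK ?pnatr_eq0.
have yc : continuous y.
  move=> t; apply/cvgrPdist_le => e e0.
  have e30 : 0 < e / 3 by rewrite divr_gt0.
  have [k Hk] := exprV2_lt `|z0| e30.
  have /cvgrPdist_le /(_ _ e30) := svalP (Y k) t.
  apply: filterS => s Hs.
  have -> : y t - y s = (y t - sval (Y k) t) + (sval (Y k) t - sval (Y k) s) - (y s - sval (Y k) s).
    by rewrite addrA subrK opprB addrA subrK.
  rewrite (le_trans (ler_normB _ _)) // (le_trans (lerD (ler_normD _ _) (lexx _))) //.
  have := yY t k; have := yY s k; move: Hs Hk; lra.
pose yC : C := exist _ y yc.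
have yT t : 0 <= t <= 1 -> y t = z0 + I yC t.
  move=> t01; apply/eqP; rewrite -subr_eq0 -normr_le0; apply/ler_addgt0Pl => e e0; rewrite addr0.
  have [k Hk] := exprV2_lt `|z0| e0.
  apply: le_trans (ltW Hk).
  have -> : y t - (z0 + I yC t) = (y t - sval (Y k.+1) t) + (I (Y k) t - I yC t).
    by rewrite /= (clamp_id t01) !opprD !addrA subrK.
  have H1 := yY t k.+1; have H2 : `|I (Y k) t - I yC t| <= `|z0| * 2^-1 ^+ k / 2.
    apply: Ibound => // [|s]; first by rewrite mulr_ge0 // exprn_ge0 // invr_ge0.
    by rewrite distrC; exact: yY.
  rewrite (le_trans (ler_normD _ _)) // (le_trans (lerD H1 H2)) // exprS; lra.
exists (fun t => z0 + I yC t); first by rewrite I0 addr0.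
move=> t t01; rewrite -yT //; split; last first.
  have := yY t 0; rewrite expr0 mulr1 /= => H.
  by rewrite -(subrK z0 (y t)) (le_trans (ler_normD _ _)) // mulr_natl mulr2n lerD.
have -> : y t *m A t = 0 + y t *m A t by rewrite add0r.
by apply: is_deriveD; exact: dI (clamp12 t01).
Qed.

End LinearODE.

Section Taylor.
Context {R : realType} {n : nat}.
Implicit Types (f : 'rV[R]_n -> R) (U : set 'rV[R]_n).

Lemma rV_coord_norm (v : 'rV[R]_n) j : `|v 0 j| <= `|v|.
Proof. exact: mx_coord_norm. Qed.

Lemma derive_bound f x v K : differentiable f x ->
  (forall j, `|'D_('e_j) f x| <= K) -> `|'D_v f x| <= n%:R * K * `|v|.
Proof.
move=> df fK; rewrite deriveE_rV // (le_trans (ler_norm_sum _ _ _)) //.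
rewrite -mulrA -[X in X%:R * _]card_ord -sumr_const mulr_suml; apply: ler_sum => k _.
by rewrite mul1r normrM mulrC ler_pM // rV_coord_norm.
Qed.

Lemma deriveD_rV U f x u v : open U -> U x -> Ck_on 2 U f ->
  'D_u ('D_v f) x = \sum_j v 0 j * 'D_u ('D_('e_j) f) x.
Proof.
move=> oU Ux Cf; have [df Df] := Cf.
rewrite (schwarz u v oU Cf Ux) deriveE_rV; last by have [H _] := Df u; exact: H.
by apply: eq_bigr => j _; rewrite (schwarz 'e_j u oU Cf Ux).
Qed.

Lemma derive2_bound U f x u v K : open U -> U x -> Ck_on 2 U f ->
  (forall i j, `|'D_('e_i) ('D_('e_j) f) x| <= K) ->
  `|'D_u ('D_v f) x| <= n%:R ^+ 2 * K * (`|u| * `|v|).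
Proof.
move=> oU Ux Cf fK; rewrite (deriveD_rV _ _ oU Ux Cf) (le_trans (ler_norm_sum _ _ _)) //.
rewrite expr2 -!mulrA -[X in X%:R * (n%:R * _)]card_ord -sumr_const mulr_suml; apply: ler_sum => k _.
rewrite mul1r normrM !mulrA [leRHS]mulrC ler_pM ?rV_coord_norm //.
by apply: derive_bound => [|j]; [have [_ /(_ 'e_k) [H _]] := Cf; exact: H|exact: fK].
Qed.

(** Two nested mean values replace the exact Taylor formula; the lost factor 1/2 only affects
    constants. *)
Lemma taylor2 (V : normedModType R) (U : set V) (f : V -> R) x h M : open U -> Ck_on 2 U f ->
  (forall t : R, 0 <= t <= 1 -> U (t *: h + x)) ->
  (forall t : R, 0 <= t <= 1 -> `|'D_h ('D_h f) (t *: h + x)| <= M) ->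
  `|f (h + x) - f x - 'D_h f x| <= M.
Proof.
move=> oU [df Df] sU fM.
have [t t01|t /andP[t0 t1] ->] := @MVT_line _ _ f x h; first exact/df/sU.
have sub s : 0 <= s <= 1 -> 0 <= s * t <= 1.
  by move=> /andP[s0 s1]; rewrite mulr_ge0 ?(ltW t0) //= mulr_ile1 // ltW.
have [s s01|s /andP[s0 s1]] := @MVT_line _ _ ('D_h f) x (t *: h).
  by have [H _] := Df h; apply: H; rewrite scalerA; exact/sU/sub.
move=> ->; have stU : 0 <= s * t <= 1 by apply: sub; rewrite !ltW.
rewrite scalerA deriveZv; last by have [H _] := Df h; exact/H/sU.
rewrite normrZ (gtr0_norm t0) (le_trans _ (fM _ stU)) //.
by rewrite ler_piMl // ltW.
Qed.

End Taylor.

Section MatrixDerivatives.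
Context {R : realType}.

Lemma is_derive_mxP (V : normedModType R) m n (f : V -> 'M[R]_(m, n)) x v df :
  is_derive x v f df <-> forall i j, is_derive x v (fun y => f y i j) (df i j).
Proof.
split=> [[D <-] i j|H].
  by apply: DeriveDef; [move/derivable_mxP: D; exact|rewrite derive_mx // mxE].
have D : derivable f x v by apply/derivable_mxP => i j; have [] := H i j.
apply: DeriveDef => //; rewrite derive_mx //; apply/matrixP => i j; rewrite mxE.
by have [] := H i j.
Qed.

Lemma is_derive_bigsum (V W : normedModType R) (I : Type) (r : seq I) (f : I -> V -> W) x v (df : I -> W) :
  (forall i, is_derive x v (f i) (df i)) ->
  is_derive x v (fun y => \sum_(i <- r) f i y) (\sum_(i <- r) df i).
Proof.
move=> H; elim: r => [|a r IH].
  rewrite big_nil; have -> : (fun y => \sum_(i <- [::]) f i y) = cst 0 by apply/funext => y; rewrite big_nil.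
  exact: is_derive_cst.
rewrite big_cons; have -> : (fun y => \sum_(i <- a :: r) f i y) = f a \+ (fun y => \sum_(i <- r) f i y).
  by apply/funext => y; rewrite big_cons.
by have Ha := H a; apply: is_deriveD.
Qed.

Lemma is_derive_mulmx (V : normedModType R) m n p (f : V -> 'M[R]_(m, n)) (g : V -> 'M[R]_(n, p)) x v df dg :
  is_derive x v f df -> is_derive x v g dg ->
  is_derive x v (fun y => f y *m g y) (df *m g x + f x *m dg).
Proof.
move=> /is_derive_mxP Hf /is_derive_mxP Hg; apply/is_derive_mxP => i j.
have -> : (fun y => (f y *m g y) i j) = fun y => \sum_k f y i k * g y k j.
  by apply/funext => y; rewrite mxE.
rewrite !mxE -big_split /=; apply: is_derive_bigsum => k.
have Hfk := Hf i k; have Hgk := Hg k j.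
apply: is_derive_eq; rewrite -![_ *: _]/(_ * _); ring.
Qed.

Lemma is_derive_scale (V : normedModType R) m n (f : V -> R) (g : V -> 'M[R]_(m, n)) x v df dg :
  is_derive x v f df -> is_derive x v g dg ->
  is_derive x v (fun y => f y *: g y) (df *: g x + f x *: dg).
Proof.
move=> Hf /is_derive_mxP Hg; apply/is_derive_mxP => i j.
have -> : (fun y => (f y *: g y) i j) = f \* (fun y => g y i j) by apply/funext => y; rewrite mxE.
have Hgk := Hg i j; apply: is_derive_eq; rewrite !mxE -![_ *: _]/(_ * _); ring.
Qed.

Lemma differentiable_is_derive (V W : normedModType R) (f : V -> W) x v :
  differentiable f x -> is_derive x v f ('D_v f x).
Proof. by move=> df; apply: DeriveDef => //; exact: diff_derivable. Qed.

End MatrixDerivatives.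

(** * Integrability of flat linear systems *)

Section Frobenius.
Context {R : realType} {n m : nat}.
Implicit Types (x u v h a : 'rV[R]_n).

Variables (U : set 'rV[R]_n) (Om : 'I_n -> 'rV[R]_n -> 'M[R]_m).
Hypothesis oU : open U.
Hypothesis COm : forall k, Ck_on 2 U (Om k).

(** The matrix-valued 1-form with components [Om k], evaluated on [v]. Matrices act on rows from the
    right, so the system to be solved is [dz = z Om]. In [dconn] the form is differentiated along
    [u] with [v] frozen. *)
Definition conn x v : 'M[R]_m := \sum_k v 0 k *: Om k x.
Definition dconn x u v : 'M[R]_m := \sum_k v 0 k *: 'D_u (Om k) x.

Lemma connD x u v : conn x (u + v) = conn x u + conn x v.
Proof. by rewrite /conn -big_split; apply: eq_bigr => k _; rewrite mxE scalerDl. Qed.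

Lemma dconnDr x u v w : dconn x u (v + w) = dconn x u v + dconn x u w.
Proof. by rewrite /dconn -big_split; apply: eq_bigr => k _; rewrite mxE scalerDl. Qed.

Let dOm k x : U x -> differentiable (Om k) x.
Proof. by case: (COm k) => H _ /H. Qed.

Lemma conn_derive x u v : U x -> is_derive x u (conn ^~ v) (dconn x u v).
Proof.
move=> Ux; apply: is_derive_bigsum => k.
by apply: is_deriveZ; apply: differentiable_is_derive; exact: dOm.
Qed.

Lemma conn_differentiable x v : U x -> differentiable (conn ^~ v) x.
Proof.
move=> Ux; have -> : conn ^~ v = \sum_k (v 0 k *: Om k).
  by apply/funext => y; rewrite fct_sumE.
by apply: differentiable_sum => k; apply: differentiableZ; exact: dOm.
Qed.

Lemma dconn_sum x u v : U x -> dconn x u v = \sum_k u 0 k *: dconn x 'e_k v.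
Proof.
move=> Ux; rewrite /dconn.
under [RHS]eq_bigr do rewrite scaler_sumr.
rewrite [RHS]exchange_big /=; apply: eq_bigr => k _.
rewrite deriveE; last exact: dOm.
rewrite [u in LHS]row_sum_delta linear_sum scaler_sumr; apply: eq_bigr => j _.
by rewrite linearZ /= deriveE ?scalerA 1?mulrC; last exact: dOm.
Qed.

Lemma sum_norm_bound (p q : nat) (F : 'I_n -> 'M[R]_(p, q)) v K : 0 <= K ->
  (forall k, `|F k| <= K) -> `|\sum_k v 0 k *: F k| <= n%:R * K * `|v|.
Proof.
move=> K0 FK; rewrite (le_trans (ler_norm_sum _ _ _)) //.
rewrite -mulrA -[X in X%:R * _]card_ord -sumr_const mulr_suml; apply: ler_sum => k _.
by rewrite mul1r normrZ mulrC ler_pM // rV_coord_norm.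
Qed.

Variables (x0 : 'rV[R]_n) (r K : R).
Hypothesis K0 : 0 <= K.
(** Half a unit of radius keeps the displacements [h] of norm at most 1, so that higher powers of
    [|h|] are bounded by lower ones. The next hypothesis makes [linear_ode] applicable along every
    ray and lets half of an error be absorbed in [ray_estimate]. *)
Hypothesis r_small : 0 < r <= 2^-1.
Hypothesis mrK : m%:R * (n%:R * K) * r <= 2^-1 / 2.
Let B := [set x | `|x - x0| < r].
Hypothesis BU : B `<=` U.
Hypothesis OmK : forall k x, B x -> `|Om k x| <= K.
Hypothesis dOmK : forall k j x, B x -> `|'D_('e_j) (Om k) x| <= K.
Hypothesis ddOmK : forall k i j x, B x -> `|'D_('e_i) ('D_('e_j) (Om k)) x| <= K.
(** The integrability condition: for a solution, the second derivative along [v] and then [u] is [z]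
    times [conn x u *m conn x v + dconn x u v], which has to be symmetric in [u] and [v]. *)
Hypothesis flat : forall x u v, U x ->
  dconn x u v - dconn x v u + (conn x u *m conn x v - conn x v *m conn x u) = 0.

Lemma conn_bound x v : B x -> `|conn x v| <= n%:R * K * `|v|.
Proof. by move=> Bx; apply: sum_norm_bound => // k; exact: OmK. Qed.

Lemma dconn_bound x u v : B x -> `|dconn x u v| <= n%:R ^+ 2 * K * (`|u| * `|v|).
Proof.
move=> Bx.
have -> : n%:R ^+ 2 * K * (`|u| * `|v|) = n%:R * (n%:R * K * `|u|) * `|v| by ring.
apply: sum_norm_bound => [|k]; first by rewrite !mulr_ge0.
apply: mx_norm_le => [|i j]; first by rewrite !mulr_ge0.
rewrite derive_mxE; last exact/dOm/BU.
apply: derive_bound; first by apply: (differentiable_mxP _ _).1; exact/dOm/BU.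
move=> l; rewrite -derive_mxE; last exact/dOm/BU.
by rewrite (le_trans (mx_coord_norm _ _ _)) // dOmK.
Qed.

Lemma ballt a (t : R) : `|a| < r -> 0 <= t <= 1 -> B (t *: a + x0).
Proof.
move=> ar /andP[t0 t1]; rewrite /B /= addrK normrZ ger0_norm //.
by rewrite (le_lt_trans _ ar) // ler_piMl.
Qed.

Lemma ballc a h (t s : R) : `|a| < r -> `|a + h| < r -> 0 <= t <= 1 -> 0 <= s <= 1 ->
  B (s *: (t *: h) + (t *: a + x0)).
Proof.
move=> ar ahr t01 /andP[s0 s1].
have -> : s *: (t *: h) + (t *: a + x0) = t *: ((1 - s) *: a + s *: (a + h)) + x0.
  rewrite addrA; congr (_ + _).
  by apply/rowP => j; rewrite !mxE; ring.
apply: ballt t01; rewrite (le_lt_trans (ler_normD _ _)) // !normrZ.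
rewrite (ger0_norm s0) ger0_norm ?subr_ge0 //.
apply: (@le_lt_trans _ _ (Num.max `|a| `|a + h|)); last by rewrite gt_max ar.
have -> : Num.max `|a| `|a + h| = (1 - s) * Num.max `|a| `|a + h| + s * Num.max `|a| `|a + h| by ring.
by rewrite lerD // ler_wpM2l ?subr_ge0 // le_max lexx ?orbT.
Qed.

Lemma taylor_conn x h v : (forall s : R, 0 <= s <= 1 -> B (s *: h + x)) ->
  `|conn (h + x) v - conn x v - dconn x h v| <= n%:R ^+ 3 * K * (`|h| ^+ 2 * `|v|).
Proof.
move=> sB.
have -> : conn (h + x) v - conn x v - dconn x h v =
    \sum_k v 0 k *: (Om k (h + x) - Om k x - 'D_h (Om k) x).
  by rewrite /conn /dconn -!sumrB; apply: eq_bigr => k _; rewrite !scalerBr.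
have -> : n%:R ^+ 3 * K * (`|h| ^+ 2 * `|v|) = n%:R * (n%:R ^+ 2 * K * (`|h| * `|h|)) * `|v| by ring.
have Bx : B x by have := sB 0; rewrite scale0r add0r lexx ler01; exact.
apply: sum_norm_bound => [|k]; first by rewrite !mulr_ge0 // exprn_ge0.
apply: mx_norm_le => [|i j]; first by rewrite !mulr_ge0 // exprn_ge0.
rewrite !mxE derive_mxE; last exact/dOm/BU.
have Cij : Ck_on 2 U (fun y => Om k y i j) by apply: (Ck_on_mxP _ _ oU).1; exact: COm.
apply: (taylor2 oU Cij) => t t01; first exact/BU/sB.
have Bt := sB t t01.
apply: (@derive2_bound _ _ U _ _ h h K oU (BU Bt) Cij) => a b.
have E : 'D_'e_a ('D_'e_b (fun y => Om k y i j)) (t *: h + x) = 'D_('e_a) ('D_('e_b) (Om k)) (t *: h + x) i j.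
  rewrite derive_mxE; last by have [_ /(_ 'e_b) [H _]] := COm k; exact/H/BU.
  apply: near_eq_derive; apply: (open_near_eq oU (BU Bt)) => y Uy.
  by rewrite derive_mxE //; exact: dOm.
by rewrite E (le_trans (mx_coord_norm _ _ _)) // ddOmK.
Qed.

Definition ray_solution a (z0 : 'rV[R]_m) (z : R -> 'rV[R]_m) := z 0 = z0 /\
  forall t : R, 0 <= t <= 1 ->
    is_derive t 1 z (z t *m conn (t *: a + x0) a) /\ `|z t| <= 2 * `|z0|.

Lemma ray_solution_exists a z0 : `|a| < r -> exists z, ray_solution a z0 z.
Proof.
move=> ar; pose A t := conn (clamp t *: a + x0) a.
have BA t : B (clamp t *: a + x0) by apply: ballt (clamp_itv t).
have Ac : continuous A.
  move=> t; have -> : A = \sum_k (fun t => a 0 k *: Om k (clamp t *: a + x0)).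
    by apply/funext => s; rewrite fct_sumE.
  apply: (big_ind (fun f : R -> 'M[R]_m => {for t, continuous f})).
  - exact: (@cst_continuous R 'M[R]_m 0 t).
  - by move=> f g cf cg; apply: continuousD.
  - move=> k _; apply: (@continuousZl_tmp _ _ _ (fun t => Om k (clamp t *: a + x0))).
    apply: (continuous_comp (f := fun t => clamp t *: a + x0) (g := Om k)).
      by apply: cvgD; [apply: cvgZr_tmp; exact: clamp_continuous|exact: cvg_cst].
    exact/differentiable_continuous/dOm/BU.
have r0 : 0 <= r by case/andP: r_small => /ltW.
have [||z z00 Hz] := @linear_ode _ _ A (n%:R * K * r) z0 Ac.
- move=> t; rewrite (le_trans (conn_bound _ (BA t))) // ler_wpM2l ?mulr_ge0 //; exact: ltW.
- rewrite mulrA (le_trans mrK) // ler_pdivrMr // ler_peMr ?invr_ge0 // ler1n //.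
by exists z; split => // t t01; have [D Hb] := Hz t t01; move: D; rewrite /A clamp_id.
Qed.

(** The summands bound, in this order, the Taylor remainder of the form, the second-order term
    [dconn x h h], and the product of [Bh] with [Bh + W] in [ray_error]. *)
Let CE : R := n%:R ^+ 3 * K + n%:R ^+ 2 * K
  + m%:R * (n%:R * K * (n%:R * K + (n%:R ^+ 3 * K + n%:R ^+ 2 * K))).

Let CE0 : 0 <= CE.
Proof. by rewrite /CE; do ?[apply: addr_ge0|apply: mulr_ge0|apply: exprn_ge0]. Qed.

(** If [z] solves the system along the ray [a], then [z (1 + t conn x h)] is the first-order
    prediction along the ray [a + h]. The matrix estimated here is its defect in the equation of
    that ray, and flatness cancels every term linear in [h]. *)
Lemma ray_error a h (t : R) x : `|a| < r -> `|a + h| < r -> 0 <= t <= 1 ->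
  x = t *: a + x0 ->
  `|(1%:M + t *: conn x h) *m conn (t *: (a + h) + x0) (a + h)
    - conn x a *m (1%:M + t *: conn x h) - conn x h - t *: dconn x a h| <= CE * `|h| ^+ 2.
Proof.
move=> ar ahr t01 xE.
have [t0 t1] := andP t01.
have h1 : `|h| <= 1.
  have -> : h = (a + h) - a by rewrite addrAC subrr add0r.
  case/andP: r_small => _ r2; rewrite (le_trans (ler_normB _ _)) //; lra.
have ah1 : `|a + h| <= 1 by case/andP: r_small => _ r2; lra.
have Bx : B x by rewrite xE; exact: ballt.
have Bseg s : 0 <= s <= 1 -> B (s *: (t *: h) + x) by move=> s01; rewrite xE; exact: ballc.
have yE : t *: (a + h) + x0 = t *: h + x by rewrite xE addrA -scalerDr [h + a]addrC.
rewrite yE.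
pose rho := conn (t *: h + x) (a + h) - conn x (a + h) - t *: dconn x h (a + h).
have rhoE : `|rho| <= n%:R ^+ 3 * K * `|h| ^+ 2.
  have := taylor_conn (a + h) Bseg; rewrite -/rho.
  have -> : dconn x (t *: h) (a + h) = t *: dconn x h (a + h).
    rewrite /dconn scaler_sumr; apply: eq_bigr => k _.
    by rewrite deriveZv ?scalerA 1?mulrC //; exact/dOm/BU.
  move/le_trans; apply; rewrite ler_wpM2l ?mulr_ge0 ?exprn_ge0 //.
  rewrite normrZ exprMn (ger0_norm t0) -[leRHS]mulr1 ler_pM // ?mulr_ge0 ?exprn_ge0 //.
  by rewrite ler_piMl ?exprn_ge0 // exprn_ile1.
have dhE v : `|v| <= 1 -> `|dconn x h v| <= n%:R ^+ 2 * K * `|h|.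
  move=> v1; rewrite (le_trans (dconn_bound _ _ Bx)) // ler_wpM2l ?mulr_ge0 ?exprn_ge0 //.
  by rewrite ler_piMr.
pose Bh := conn x h; have BhE : `|Bh| <= n%:R * K * `|h| by exact: conn_bound.
pose W := rho + t *: dconn x h (a + h).
have WE : `|W| <= (n%:R ^+ 3 * K + n%:R ^+ 2 * K) * `|h|.
  rewrite mulrDl (le_trans (ler_normD _ _)) // lerD //.
    rewrite (le_trans rhoE) // ler_wpM2l ?mulr_ge0 ?exprn_ge0 // expr2 ler_piMr //.
  rewrite normrZ (ger0_norm t0) (le_trans _ (dhE _ ah1)) // ler_piMl //.
have connW : conn (t *: h + x) (a + h) = conn x a + Bh + W.
  rewrite /W /rho [conn x (a + h)]connD -/Bh.
  move: (conn (t *: h + x) _) (conn x a) (Bh) (dconn _ _ _) => A1 A2 A3 A4.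
  by apply/matrixP => i j; rewrite !mxE; ring.
(* The two sides differ by [t] times the flatness relation for the pair [(h, a)]. *)
have -> : (1%:M + t *: Bh) *m conn (t *: h + x) (a + h) - conn x a *m (1%:M + t *: Bh) - Bh
     - t *: dconn x a h = rho + t *: dconn x h h + t *: (Bh *m (Bh + W)).
  rewrite connW /W dconnDr scalerDr.
  have := flat h a (BU Bx); rewrite -/Bh.
  move: (rho) => rh; rewrite [(1%:M + _) *m _]mulmxDl [conn x a *m (_ + _)]mulmxDr mul1mx mulmx1.
  rewrite -scalemxAl !mulmxDr -!scalemxAr.
  move: (Bh *m conn x a) (conn x a *m Bh) (Bh *m Bh) (Bh *m rh) => P1 P2 P3 P4.
  move: (Bh *m _) (Bh *m _) => P6 P7.
  move: rh (Bh) (conn x a) (dconn x h a) (dconn x a h) (dconn x h h) => Q1 Q2 Q3 Q4 Q5 Q6 E.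
  apply/matrixP => i j; have := congr1 (fun A : 'M[R]_m => t * A i j) E; rewrite !mxE mulr0 => F.
  apply/eqP; rewrite -subr_eq0 -F; apply/eqP; ring.
rewrite (le_trans (ler_normD _ _)) // /CE 2!mulrDl lerD //.
  rewrite (le_trans (ler_normD _ _)) // lerD // normrZ (ger0_norm t0).
  rewrite (le_trans (ler_piMl _ t1)) // (le_trans (dconn_bound _ _ Bx)) // expr2 //.
rewrite normrZ (ger0_norm t0) (le_trans (ler_piMl _ t1)) // (le_trans (mulmx_norm _ _)) //.
apply: (@le_trans _ _ (m%:R * (n%:R * K * `|h| *
    ((n%:R * K + (n%:R ^+ 3 * K + n%:R ^+ 2 * K)) * `|h|)))); last first.
  by rewrite le_eqVlt; apply/orP; left; apply/eqP; ring.
rewrite ler_wpM2l // ler_pM // (le_trans (ler_normD _ _)) // mulrDl lerD //.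
Qed.

Lemma ler_half_absorb (p q c : R) : p <= p / 2 + c -> q <= p -> q <= 2 * c.
Proof. by move=> H1 H2; lra. Qed.

Lemma ray_algebra (zb za : 'rV[R]_m) (Ob Oa T Bh dB : 'M[R]_m) :
  zb *m Ob - (za *m Oa *m T + za *m (Bh + dB)) =
  (zb - za *m T) *m Ob + za *m (T *m Ob - Oa *m T - Bh - dB).
Proof.
rewrite 3!mulmxBr mulmxBl mulmxDr !mulmxA.
move: (zb *m Ob) (za *m T *m Ob) (za *m Oa *m T) (za *m Bh) (za *m dB) => P1 P2 P3 P4 P5.
by apply/matrixP => i j; rewrite !mxE; ring.
Qed.

(** The deviation [D] from the prediction starts at 0 and solves the linear system of the ray
    [a + h] up to the quadratic defect of [ray_error]. In place of Gronwall's inequality, the linear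
    term is at most half the maximum of [|D|] and is absorbed on the left. *)
Lemma ray_estimate a h z0 za zb : `|a| < r -> `|a + h| < r ->
  ray_solution a z0 za -> ray_solution (a + h) z0 zb ->
  `|zb 1 - za 1 *m (1%:M + conn (a + x0) h)| <= 2 * (m%:R * (2 * `|z0| * (CE * `|h| ^+ 2))).
Proof.
move=> ar ahr [za0 Ha] [zb0 Hb].
pose xt (t : R) := t *: a + x0.
pose D (t : R) := zb t - za t *m (1%:M + t *: conn (xt t) h).
pose E (t : R) := (1%:M + t *: conn (xt t) h) *m conn (t *: (a + h) + x0) (a + h)
    - conn (xt t) a *m (1%:M + t *: conn (xt t) h) - conn (xt t) h - t *: dconn (xt t) a h.
pose dD (t : R) := D t *m conn (t *: (a + h) + x0) (a + h) + za t *m E t.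
have Dd (t : R) : 0 <= t <= 1 -> is_derive t 1 D (dD t).
  move=> t01; have [dza _] := Ha t t01; have [dzb _] := Hb t t01.
  have d1 : is_derive t 1 (fun s => conn (xt s) h) (dconn (xt t) a h).
    have Ux : U (xt t) by apply/BU/ballt.
    have := is_derive_line (f := conn ^~ h) (x := x0) (h := a) (t := t) (conn_differentiable h Ux).
    by have dc := conn_derive a h Ux; rewrite derive_val.
  have d2 := is_derive_scale (@is_derive_id _ _ t 1) d1.
  have d3 := is_deriveD (@is_derive_cst _ _ _ (1%:M : 'M[R]_m) t 1) d2.
  have d4 := is_derive_mulmx dza d3.
  have d5 := is_deriveB dzb d4.
  apply: (is_derive_eq d5); rewrite /dD /E /D add0r scale1r.
  by rewrite -/(xt t) -[(cst _ + _) t]/(1%:M + t *: conn (xt t) h) ray_algebra.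
have Dc : {within `[0, 1], continuous (fun t : R => `|D t|)}.
  apply: continuous_in_subspaceT => t; rewrite inE /= in_itv /= => /Dd [Dt _].
  apply: (continuous_comp (f := D) (g := fun v : 'rV[R]_m => `|v|)).
    exact/differentiable_continuous/derivable1_diffP.
  exact: norm_continuous.
have [c] := EVT_max ler01 Dc; rewrite in_itv /= => c01 Dmax.
have D0 : D 0 = 0 by rewrite /D za0 zb0 scale0r addr0 mulmx1 subrr.
pose c0 := m%:R * (2 * `|z0| * (CE * `|h| ^+ 2)).
have c00 : 0 <= c0 by rewrite /c0 !mulr_ge0 // exprn_ge0.
have bound : `|D c| <= `|D c| / 2 + c0.
  rewrite -[X in `|X| <= _](subr0 (D c)) -D0.
  apply: (rV_mean_value c01 _ Dd); first by rewrite addr_ge0 ?divr_ge0.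
  move=> s s01; rewrite (le_trans (ler_normD _ _)) // lerD //.
    rewrite (le_trans (mulmx_norm _ _)) // mulrCA ler_pM ?mulr_ge0 //.
      by apply: Dmax; rewrite in_itv.
    have Bb : B (s *: (a + h) + x0) by exact: ballt.
    apply: (@le_trans _ _ (m%:R * (n%:R * K) * r)).
      by rewrite -[leRHS]mulrA ler_wpM2l // (le_trans (conn_bound _ Bb)) // ler_wpM2l ?mulr_ge0 // ltW.
    by rewrite (le_trans mrK) // ler_pdivrMr // ler_peMr ?invr_ge0 // ler1n.
  rewrite (le_trans (mulmx_norm _ _)) // ler_wpM2l // ler_pM //.
    by have [_] := Ha s s01.
  exact: (ray_error ar ahr s01 erefl).
have D1 : `|D 1| <= `|D c| by apply: Dmax; rewrite in_itv /= ler01 lexx.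
have <- : D 1 = zb 1 - za 1 *m (1%:M + conn (a + x0) h) by rewrite /D /xt !scale1r.
exact: (ler_half_absorb bound D1).
Qed.

(** The value at [x] is the endpoint, at time 1, of the solution along the ray from [x0] to [x].
    Since [ray_estimate] is quadratic in [h], it directly gives the differential at [x]. *)
Lemma frobenius_ball (z0 : 'rV[R]_m) : exists z : 'rV[R]_n -> 'rV[R]_m, z x0 = z0 /\
  forall x, B x -> differentiable z x /\ forall v, 'D_v z x = z x *m conn x v.
Proof.
have Hz a : exists z : R -> 'rV[R]_m, `|a| < r -> ray_solution a z0 z.
  have [ar|ar] := pselect (`|a| < r); last by exists (cst 0).
  by have [z Hz] := ray_solution_exists z0 ar; exists z.
pose z x := sval (cid (Hz (x - x0))) 1.
have zP a : `|a| < r -> ray_solution a z0 (sval (cid (Hz a))) by exact: (svalP (cid (Hz a))).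
have r0 : 0 < r by case/andP: r_small.
exists z; split.
  rewrite /z subrr; have [|z00 Hd] := zP 0; first by rewrite normr0.
  apply/eqP; rewrite -subr_eq0 -normr_le0 -[X in _ - X]z00.
  have z01 : 0 <= (1 : R) <= 1 by rewrite lexx ler01.
  (* The ray of length zero carries a constant solution, because the form vanishes on the zero
     vector. *)
  apply: (@rV_mean_value _ _ (sval (cid (Hz 0))) (fun=> 0) 0 1 z01 (lexx 0)) => s s01.
    have [+ _] := Hd s s01; rewrite (_ : conn _ 0 = 0) ?mulmx0 //.
    by rewrite /conn big1 // => k _; rewrite mxE scale0r.
  by rewrite normr0.
move=> x Bx; pose J : 'M[R]_(n, m) := \matrix_k (z x *m Om k x).
have JE v : mulmxr J v = z x *m conn x v.
  rewrite /= mulmx_sum_row /conn mulmx_sumr; apply: eq_bigr => k _.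
  by rewrite rowK scalemxAr.
have Jc : continuous (mulmxr J : 'rV[R]_n -> 'rV[R]_m).
  apply/continuous_Ck0/Ck_on_mulmx; first exact: openT.
    by move=> y _; exact: cvg_id.
  exact: Ck_on_cst.
pose C := 2 * (m%:R * (2 * `|z0| * CE)).
have C0 : 0 <= C by rewrite /C !mulr_ge0.
have [e|dz dE] := differentiable_eps (f := z) (x := x) (l := mulmxr J) Jc; last first.
  by split => // v; rewrite deriveE // dE; exact: JE.
move=> e0; have xr : `|x - x0| < r by [].
have rx : 0 < r - `|x - x0| by rewrite subr_gt0.
have eC : 0 < e / (C + 1) by rewrite divr_gt0 // ltr_pwDr.
near=> h.
have xhr : `|x - x0 + h| < r.
  have : `|h| < r - `|x - x0| by near: h; exact: (@nbhs0_lt R 'rV[R]_n _ rx).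
  by rewrite ltrBrDl; apply: le_lt_trans; exact: ler_normD.
suff : `|z (h + x) - z x - z x *m conn x h| <= e * `|h| by rewrite -JE.
have := ray_estimate xr xhr (zP _ xr) (zP _ xhr).
rewrite subrK mulmxDr mulmx1 opprD addrA.
have -> : x - x0 + h = h + x - x0 by rewrite [h + x]addrC addrAC.
rewrite -/(z x) -/(z (h + x)) => /le_trans; apply.
have he : `|h| <= e / (C + 1) by near: h; exact: (@nbhs0_le R 'rV[R]_n _ eC).
have -> : 2 * (m%:R * (2 * `|z0| * (CE * `|h| ^+ 2))) = C * `|h| * `|h| by rewrite /C; ring.
rewrite ler_wpM2r // (le_trans (ler_wpM2l C0 he)) // mulrCA ler_piMr ?(ltW e0) //.
by rewrite ler_pdivrMr ?mul1r ?lerDl // ltr_pwDr.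
Unshelve. all: by end_near. Qed.

End Frobenius.

Lemma locally_bounded_family {R : realType} {V W : normedModType R} (I : finType) (f : I -> V -> W) x :
  (forall i, {for x, continuous (f i)}) ->
  exists2 K : R, 0 <= K & \forall y \near x, forall i, `|f i y| <= K.
Proof.
move=> fc; exists (\sum_i (`|f i x| + 1)); first by apply: sumr_ge0 => i _; rewrite addr_ge0.
apply: filter_forall => i.
have /cvgrPdist_le /(_ _ ltr01) := fc i.
apply: filterS => y H; rewrite (bigD1 i) //= -(subrK (f i x) (f i y)).
have S0 : 0 <= \sum_(j | j != i) (`|f j x| + 1) by apply: sumr_ge0 => j _; rewrite addr_ge0.
rewrite (le_trans (ler_normD _ _)) // distrC; move: H S0.
move: (`|_ - _|) (`|f i x|) (\sum_(_ | _) _) => p q s; lra.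
Qed.

(** Local bounds on the form and its first two derivatives provide [K], and [r] is shrunk
    accordingly. The radius is fixed before [z0], so that several solutions can share one ball. *)
Theorem frobenius {R : realType} {n m : nat} (U : set 'rV[R]_n)
    (Om : 'I_n -> 'rV[R]_n -> 'M[R]_m) x0 : open U -> U x0 ->
  (forall k, Ck_on 2 U (Om k)) ->
  (forall x u v, U x -> dconn Om x u v - dconn Om x v u +
     (conn Om x u *m conn Om x v - conn Om x v *m conn Om x u) = 0) ->
  exists2 r : R, 0 < r & forall z0 : 'rV[R]_m,
    exists z : 'rV[R]_n -> 'rV[R]_m, z x0 = z0 /\ forall x, `|x - x0| < r ->
      [/\ U x, differentiable z x & forall v, 'D_v z x = z x *m conn Om x v].
Proof.
move=> oU Ux0 COm flat.
have [K1 K10 H1] := @locally_bounded_family _ _ _ _ Om x0 (fun k => Ck_on_le (leq0n 2) (COm k) x0 Ux0).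
have C1 k v : Ck_on 1 U ('D_v (Om k)) by have [_ H] := COm k; exact: H.
have [K2 K20 H2] := @locally_bounded_family _ _ _ _ (fun kj : 'I_n * 'I_n => 'D_('e_kj.2) (Om kj.1)) x0
  (fun kj => Ck_on_le (leq0n 1) (C1 kj.1 'e_kj.2) x0 Ux0).
have C2 k u v : Ck_on 0 U ('D_u ('D_v (Om k))) by have [_ H] := C1 k v; exact: H.
have [K3 K30 H3] := @locally_bounded_family _ _ _ _
  (fun kij : 'I_n * 'I_n * 'I_n => 'D_('e_kij.1.2) ('D_('e_kij.2) (Om kij.1.1))) x0
  (fun kij => C2 kij.1.1 'e_kij.1.2 'e_kij.2 x0 Ux0).
have HU := open_nbhs_nbhs (conj oU Ux0).
pose P x := [/\ U x, forall k, `|Om k x| <= K1,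
    forall kj : 'I_n * 'I_n, `|'D_('e_kj.2) (Om kj.1) x| <= K2 &
    forall kij : 'I_n * 'I_n * 'I_n, `|'D_('e_kij.1.2) ('D_('e_kij.2) (Om kij.1.1)) x| <= K3].
have HP : \forall x \near x0, P x.
  by near=> x; split; near: x.
have [d /= d0 Hd] := (nbhs_normP _ _).1 HP.
pose K := K1 + K2 + K3.
have K0 : 0 <= K by rewrite !addr_ge0.
(* The largest admissible radius for the smallness condition on [r]; the summand 1 avoids dividing
   by zero. *)
pose q := 2^-1 / 2 / (m%:R * (n%:R * K) + 1).
have mK0 : 0 <= m%:R * (n%:R * K) by rewrite !mulr_ge0.
have q0 : 0 < q by rewrite /q divr_gt0 ?divr_gt0 ?invr_gt0 // ltr_pwDr.
pose r := Num.min d (Num.min 2^-1 q).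
have r0 : 0 < r by rewrite !lt_min d0 invr_gt0 ltr0n /=.
have rd : r <= d by rewrite ge_min lexx.
have rhalf : 0 < r <= 2^-1 by rewrite r0 /= !ge_min lexx orbT.
have rq : r <= q by rewrite !ge_min lexx !orbT.
have mrK : m%:R * (n%:R * K) * r <= 2^-1 / 2.
  rewrite (le_trans (ler_wpM2l mK0 rq)) // /q mulrCA ler_piMr ?divr_ge0 ?invr_ge0 //.
  by rewrite ler_pdivrMr ?mul1r ?lerDl // ltr_pwDr.
have Bd x : `|x - x0| < r -> P x.
  by move=> xr; apply: Hd; rewrite /= distrC (lt_le_trans xr).
exists r => // z0.
have [||||z [zx0 zd]] := @frobenius_ball R n m U Om oU COm x0 r K K0 rhalf mrK _ _ _ _ flat z0.
- by move=> x /Bd [].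
- by move=> k x /Bd [_ H _ _]; rewrite (le_trans (H k)) // /K -addrA lerDl addr_ge0.
- by move=> k j x /Bd [_ _ H _]; rewrite (le_trans (H (k, j))) // /K addrAC lerDr addr_ge0.
- by move=> k i j x /Bd [_ _ _ H]; rewrite (le_trans (H (k, i, j))) // /K lerDr addr_ge0.
exists z; split => // x xr; have [zdx zE] := zd x xr; split => //.
by have [] := Bd x xr.
Unshelve. all: by end_near. Qed.

(** * Inverse functions and flat coordinates *)

Lemma nbhs_translate {R : numFieldType} {V : normedModType R} (y : V) (P : set V) :
  nbhs y P -> \forall k \near (0 : V), P (k + y).
Proof.
move=> H; have : \near y, P y by [].
by rewrite (near_shift 0 y); apply: filterS => z /=; rewrite subr0.
Qed.

Lemma unitmx_kernel {F : fieldType} n (A : 'M[F]_n) :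
  (forall v : 'rV_n, v *m A = 0 -> v = 0) -> A \in unitmx.
Proof.
move=> Ainj; rewrite -row_free_unit -kermx_eq0; apply/rowV0P => v.
by rewrite sub_kermx => /eqP; exact: Ainj.
Qed.

Lemma mulmxr_continuous {R : realType} m n (A : 'M[R]_(m, n)) :
  continuous (mulmxr A : 'rV[R]_m -> 'rV[R]_n).
Proof.
apply/continuous_Ck0/Ck_on_mulmx; first exact: openT.
  by move=> y _; exact: cvg_id.
exact: Ck_on_cst.
Qed.

Lemma differentiable_eps_mx {R : realType} m n (f : 'rV[R]_m -> 'rV[R]_n) x (A : 'M[R]_(m, n)) :
  (forall e : R, 0 < e ->
     \forall h \near (0 : 'rV[R]_m), `|f (h + x) - f x - h *m A| <= e * `|h|) ->
  differentiable f x /\ forall v, 'D_v f x = v *m A.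
Proof.
move=> H; have [df dE] := differentiable_eps (l := mulmxr A) (@mulmxr_continuous _ _ _ A) H.
by split => // v; rewrite deriveE // dE.
Qed.

Lemma quarter_half_le {R : realType} (r : R) : 0 <= r -> r / 4 + r / 2 <= r.
Proof. by move=> r0; lra. Qed.

Lemma double_lt_quarter {R : realType} (a r : R) : 0 < r -> a < r / 4 -> 2 * a < r.
Proof. by move=> r0 ar; lra. Qed.

Lemma ler_halving {R : realType} (a b c d q : R) :
  a <= c * (2^-1 * q) -> b <= d / 2 -> d <= c * q -> a + b <= c * q.
Proof. by move=> *; lra. Qed.

(** * The inverse function theorem for a Jacobian close to the identity *)

Section InverseFunction.
Context {R : realType} {n : nat}.
Variables (phi : 'rV[R]_n -> 'rV[R]_n) (J : 'rV[R]_n -> 'M[R]_n) (x0 : 'rV[R]_n) (r : R).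
Hypothesis r0 : 0 < r.
Hypothesis dphi : forall x, `|x - x0| < r ->
  differentiable phi x /\ forall v, 'D_v phi x = v *m J x.
Hypothesis J_near : forall x, `|x - x0| < r -> n%:R * `|J x - 1%:M| <= 2^-1.

(** As [J] is within [1/(2n)] of the identity, the displacement [g] is 1/2-Lipschitz, and
    [phi x = y] becomes the fixed-point equation [x = y - g x]. *)
Let g x := phi x - x.

Lemma mulmx_near1 x (v : 'rV[R]_n) : `|x - x0| < r -> `|v *m J x - v| <= `|v| / 2.
Proof.
move=> xr; have -> : v *m J x - v = v *m (J x - 1%:M) by rewrite mulmxBr mulmx1.
by rewrite (le_trans (mulmx_norm _ _)) // mulrCA ler_wpM2l // J_near.
Qed.

Lemma jacobian_unit x : `|x - x0| < r -> J x \in unitmx.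
Proof.
move=> xr; apply: unitmx_kernel => v vJ0; have := mulmx_near1 v xr.
rewrite vJ0 sub0r normrN => H; apply/eqP; rewrite -normr_eq0 eq_le normr_ge0 andbT; lra.
Qed.

Lemma ball_segment (x y : 'rV[R]_n) (t : R) : `|x - x0| < r -> `|y - x0| < r -> 0 <= t <= 1 ->
  `|t *: (y - x) + x - x0| < r.
Proof.
move=> xr yr /andP[t0 t1].
have -> : t *: (y - x) + x - x0 = (1 - t) *: (x - x0) + t *: (y - x0).
  by apply/rowP => j; rewrite !mxE; ring.
rewrite (le_lt_trans (ler_normD _ _)) // !normrZ (ger0_norm t0) ger0_norm ?subr_ge0 //.
apply: (@le_lt_trans _ _ (Num.max `|x - x0| `|y - x0|)); last by rewrite gt_max xr.
have -> : Num.max `|x - x0| `|y - x0| =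
  (1 - t) * Num.max `|x - x0| `|y - x0| + t * Num.max `|x - x0| `|y - x0| by ring.
by rewrite lerD // ler_wpM2l ?subr_ge0 // le_max lexx ?orbT.
Qed.

Lemma displacement_contraction x y : `|x - x0| < r -> `|y - x0| < r ->
  `|g y - g x| <= `|y - x| / 2.
Proof.
move=> xr yr; apply: mx_norm_le => [|i j]; first by rewrite divr_ge0.
rewrite ord1.
have dg z : `|z - x0| < r -> differentiable g z.
  by move=> /dphi [dz _]; apply: differentiableB.
have [t t01|t /andP[t0 t1] E] := @MVT_line _ _ (fun z => g z 0 j) x (y - x).
  by apply: (differentiable_mxP _ _).1; exact/dg/ball_segment.
have t01 : 0 <= t <= 1 by rewrite !ltW.
have zr := ball_segment xr yr t01.
move: E; rewrite subrK => E; rewrite [X in `|X|]mxE [X in _ + X]mxE E.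
rewrite -derive_mxE; last exact: dg.
have [dz dzE] := dphi zr.
rewrite deriveB; [|exact: diff_derivable|exact: derivable_id].
rewrite derive_id dzE (le_trans (mx_coord_norm _ _ _)) // mulmx_near1 //.
Qed.

Lemma local_lower_bound x y : `|x - x0| < r -> `|y - x0| < r -> `|y - x| <= 2 * `|phi y - phi x|.
Proof.
move=> xr yr; have := displacement_contraction xr yr.
have -> : y - x = (phi y - phi x) - (g y - g x).
  by rewrite /g; apply/rowP => j; rewrite !mxE; ring.
move: (ler_normB (phi y - phi x) (g y - g x)).
set A := `|_ - _ - _|; set B := `|g y - g x|; set C := `|phi y - phi x|; lra.
Qed.

(** Fixed-point iteration from [x0]. The iterates stay in the ball because [r/4 + r/2 <= r], and the
    geometric rate yields the factor 2, which puts the limit within [r/2] of [x0]. *)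
Lemma local_preimage y : `|y - phi x0| < r / 4 ->
  exists2 x, `|x - x0| <= 2 * `|y - phi x0| & phi x = y.
Proof.
move=> yr; pose u k := iter k (fun x => y - g x) x0.
have ub k : `|u k - x0| < r.
  elim: k => [|k IH] /=; first by rewrite subrr normr0.
  have -> : y - g (u k) - x0 = (y - phi x0) - (g (u k) - g x0).
    by rewrite {2}/g; apply/rowP => j; rewrite !mxE; ring.
  have x0r : `|x0 - x0| < r by rewrite subrr normr0.
  have H1 := ler_normB (y - phi x0) (g (u k) - g x0).
  have H2 := displacement_contraction x0r IH.
  apply: (le_lt_trans H1); apply: (le_lt_trans (lerD (lexx _) H2)).
  have H3 : `|u k - x0| / 2 < r / 2 by rewrite ltr_pM2r ?invr_gt0.
  apply: (lt_le_trans (ltrD yr H3)); exact: (quarter_half_le (ltW r0)).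
have uS k : `|u k.+1 - u k| <= `|y - phi x0| * 2^-1 ^+ k.
  elim: k => [|k IH].
    have -> : u 1%N - u 0%N = y - phi x0 by rewrite /= /g; apply/rowP => j; rewrite !mxE; ring.
    by rewrite expr0 mulr1.
  have -> : u k.+2 - u k.+1 = - (g (u k.+1) - g (u k)) by rewrite /=; apply/rowP => j; rewrite !mxE; ring.
  rewrite normrN (le_trans (displacement_contraction (ub k) (ub k.+1))) // exprSr mulrA.
  by rewrite ler_wpM2r ?invr_ge0.
have [x Hx] := geometric_limit uS.
have xx0 : `|x - x0| <= 2 * `|y - phi x0| by have := Hx 0; rewrite expr0 mulr1 mulrC.
exists x => //; have xr : `|x - x0| < r by rewrite (le_lt_trans xx0) // double_lt_quarter.
apply/eqP; rewrite -subr_eq0 -normr_le0; apply/ler_addgt0Pl => e e0; rewrite addr0.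
have [k Hk] := exprV2_lt (`|y - phi x0| * 2) e0.
apply: le_trans (ltW Hk).
have -> : phi x - y = (x - u k.+1) + (g x - g (u k)).
  by rewrite /= {1}/g; apply/rowP => j; rewrite !mxE; ring.
rewrite (le_trans (ler_normD _ _)) //.
have H1 := Hx k.+1; have H2 := displacement_contraction (ub k) xr; have H3 := Hx k.
by rewrite exprS in H1; exact: ler_halving H1 H2 H3.
Qed.

(** [W] is exported as a norm ball because a mean value is later taken along its segments, in
    [minkowski_coordinates]. *)
Theorem inverse_function : exists (U W : set 'rV[R]_n) (psi : 'rV[R]_n -> 'rV[R]_n),
  [/\ [/\ open U, U x0 & U `<=` [set x | `|x - x0| < r]],
      exists2 e : R, 0 < e & W = [set y | `|y - phi x0| < e],
      forall x, U x -> W (phi x) /\ psi (phi x) = x,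
      forall y, W y -> U (psi y) /\ phi (psi y) = y &
      forall y, W y -> differentiable psi y /\
        forall v, 'D_v psi y = v *m invmx (J (psi y))].
Proof.
pose W := [set y | `|y - phi x0| < r / 4].
pose U := [set x | `|x - x0| < r /\ W (phi x)].
have Hpsi y : exists x, W y -> U x /\ phi x = y.
  have [Wy|Wy] := pselect (W y); last by exists y.
  have [x xx0 phx] := local_preimage Wy; exists x => _; split; [split|] => //; last by rewrite phx.
  by rewrite (le_lt_trans xx0) // double_lt_quarter.
pose psi y := sval (cid (Hpsi y)).
have psiP y : W y -> U (psi y) /\ phi (psi y) = y by exact: (svalP (cid (Hpsi y))).
have oball (c : 'rV[R]_n) e : open [set y | `|y - c| < e].
  have -> : [set y | `|y - c| < e] = ball_ Num.norm c e by apply/seteqP; split => y /=; rewrite distrC.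
  rewrite ball_normE; have [e0|e0] := ltP 0 e; first exact: ball_open.
  rewrite (_ : ball c e = set0); first exact: open0.
  apply/seteqP; split => // y; rewrite -ball_normE /= => /(le_lt_trans (normr_ge0 _)).
  by rewrite ltNge e0.
have oU : open U.
  rewrite openE => x [xr Wx]; rewrite /interior.
  have [dx _] := dphi xr; have cx := differentiable_continuous dx.
  apply: filterI; first by apply: open_nbhs_nbhs; split => //; exact: oball.
  by apply: cx; apply: open_nbhs_nbhs; split => //; exact: oball.
have Ux0 : U x0 by rewrite /U /W /= !subrr !normr0 r0 divr_gt0.
have inj x y : `|x - x0| < r -> `|y - x0| < r -> phi x = phi y -> x = y.
  move=> xr yr E; have := local_lower_bound xr yr; rewrite E subrr normr0 mulr0 normr_le0 subr_eq0.
  by move=> /eqP ->.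
exists U, W, psi; split => //.
- by split => // x [].
- by exists (r / 4); rewrite ?divr_gt0.
- move=> x [xr Wx]; split => //; have [[pr _] E] := psiP _ Wx; exact: inj E.
move=> y Wy; have [[xr _] phx] := psiP _ Wy; set x := psi y in xr phx *.
have [dx dxE] := dphi xr.
apply: differentiable_eps_mx => e e0.
pose N := n%:R * `|invmx (J x)|; have N0 : 0 <= N by rewrite mulr_ge0.
(* The remainder of [psi] at [k] is that of [phi] at [h] times the inverse Jacobian, up to sign. The
   factor [N] bounds this product, and the 2 comes from [|h| <= 2 |k|]. *)
pose e' := e / (2 * N + 1); have e'0 : 0 < e' by rewrite divr_gt0 // ltr_pwDr // mulr_ge0.
have [d /= d0 Hd] := (nbhs_normP _ _).1 (differentiableP_eps dx e'0).
have oWy : \forall k \near (0 : 'rV[R]_n), W (k + y).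
  by apply: nbhs_translate; apply: open_nbhs_nbhs; split => //; exact: oball.
near=> k.
have Wk : W (k + y) by near: k; exact: oWy.
have [[xkr _] phk] := psiP _ Wk.
set h := psi (k + y) - x; have hk : `|h| <= 2 * `|k|.
  by have := local_lower_bound xr xkr; rewrite phk phx addrK.
have hd : `|h| < d.
  rewrite (le_lt_trans hk) // mulrC -ltr_pdivlMr //; near: k.
  by apply: (@nbhs0_lt R 'rV[R]_n); rewrite divr_gt0.
have := Hd h; rewrite /= sub0r normrN => /(_ hd).
rewrite /h subrK phk phx addrK -deriveE // dxE -/h => He.
have uJ := jacobian_unit xr.
have -> : psi (k + y) - psi y - k *m invmx (J x) = - ((k - h *m J x) *m invmx (J x)).
  by rewrite mulmxBl mulmxK // opprB.
rewrite normrN (le_trans (mulmx_norm _ _)) //.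
have -> : n%:R * (`|k - h *m J x| * `|invmx (J x)|) = `|k - h *m J x| * N by rewrite /N; ring.
rewrite (le_trans (ler_wpM2r N0 He)) //.
rewrite (le_trans (ler_wpM2r N0 (ler_wpM2l (ltW e'0) hk))) //.
have -> : e' * (2 * `|k|) * N = e * `|k| * (2 * N / (2 * N + 1)).
  by rewrite /e'; ring.
rewrite ler_piMr ?mulr_ge0 ?(ltW e0) // ler_pdivrMr ?mul1r ?lerDl //.
by rewrite ltr_pwDr // mulr_ge0.
Unshelve. all: by end_near. Qed.

End InverseFunction.

(** For maps solving a first-order equation with smooth coefficients: the derivative is as regular
    as the map itself, so regularity climbs by induction. *)
Lemma smooth_bootstrap {R : realType} {V W : normedModType R} (U : set V) (f : V -> W) :
  (forall x, U x -> differentiable f x) ->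
  (forall k, Ck_on k U f -> forall v, Ck_on k U ('D_v f)) -> smooth_on U f.
Proof.
move=> df H; elim=> [|k IH]; first by move=> x Ux; exact/differentiable_continuous/df.
by split=> //; exact: H.
Qed.

Lemma open_norm_ball {R : realType} {V : normedModType R} (c : V) (e : R) :
  open [set y : V | `|y - c| < e].
Proof.
have -> : [set y | `|y - c| < e] = ball_ Num.norm c e.
  by apply/seteqP; split => y /=; rewrite distrC.
rewrite ball_normE; have [e0|e0] := ltP 0 e; first exact: ball_open.
rewrite (_ : ball c e = set0); first exact: open0.
apply/seteqP; split => // y; rewrite -ball_normE /= => /(le_lt_trans (normr_ge0 _)).
by rewrite ltNge e0.
Qed.

Lemma Ck_on_conn {R : realType} {n m : nat} k (U : set 'rV[R]_n) (Om : 'I_n -> 'rV[R]_n -> 'M[R]_m)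
    (v : 'rV[R]_n) : open U -> (forall l, Ck_on k U (Om l)) -> Ck_on k U (conn Om ^~ v).
Proof.
move=> oU COm; apply/(Ck_on_mxP _ _ oU) => i j.
apply: (Ck_on_eq oU (f := fun x => \sum_l v 0 l * Om l x i j)) => [x _|].
  by rewrite /conn summxE; apply: eq_bigr => l _; rewrite mxE.
apply: Ck_on_sum => // l; apply: Ck_onM => //; first exact: Ck_on_cst.
by apply: (Ck_on_mxP _ _ oU).1; exact: COm.
Qed.

(** * Coordinates in which a flat torsion-free connection vanishes *)

Section FlatCoordinates.
Context {R : realType} {n : nat}.
Variables (U : set 'rV[R]_n) (Gam : 'I_n -> 'rV[R]_n -> 'M[R]_n) (x0 : 'rV[R]_n).
Hypothesis oU : open U.
Hypothesis Ux0 : U x0.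
Hypothesis CGam : forall l, smooth_on U (Gam l).
Hypothesis torsion_free : forall x (u w : 'rV[R]_n), U x ->
  w *m conn Gam x u = u *m conn Gam x w.
(** The commutator has the opposite sign to that in [frobenius]: the system solved for the coframe
    uses the transposes of [Gam], and transposition reverses products. *)
Hypothesis flat : forall x u v, U x ->
  dconn Gam x u v - dconn Gam x v u +
    (conn Gam x v *m conn Gam x u - conn Gam x u *m conn Gam x v) = 0.

(* The system [d theta = theta o Gam, d phi = theta] for a parallel coframe
   and its primitives. *)
Definition affine_system (k : 'I_n) (x : 'rV[R]_n) : 'M[R]_(n + 1) :=
  block_mx (Gam k x)^T ('e_k)^T 0 0.

Lemma conn_affine x v : conn affine_system x v = block_mx (conn Gam x v)^T v^T 0 0.
Proof.
apply/matrixP => i j; rewrite {1}/conn summxE /affine_system.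
case: (split_ordP i) => i' ->; case: (split_ordP j) => j' ->.
- rewrite block_mxEul mxE /conn summxE; apply: eq_bigr => k _.
  by rewrite mxE [RHS]mxE block_mxEul mxE.
- rewrite block_mxEur mxE ord1 [v in RHS]row_sum_delta summxE; apply: eq_bigr => k _.
  by rewrite mxE [RHS]mxE block_mxEur mxE.
- by rewrite block_mxEdl mxE big1 // => k _; rewrite mxE block_mxEdl mxE mulr0.
- by rewrite block_mxEdr mxE big1 // => k _; rewrite mxE block_mxEdr mxE mulr0.
Qed.

Lemma Ck_affine k l : Ck_on k U (affine_system l).
Proof.
apply/(Ck_on_mxP _ _ oU) => i j; rewrite /affine_system.
have C0 (a : R) : Ck_on k U (fun _ : 'rV[R]_n => a) by exact: Ck_on_cst.
case: (split_ordP i) => i' ->; case: (split_ordP j) => j' ->.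
- apply: (Ck_on_eq oU (f := fun x => Gam l x j' i')) => [x _|]; first by rewrite block_mxEul mxE.
  by apply: (Ck_on_mxP _ _ oU).1; exact: CGam.
- by apply: (Ck_on_eq oU _ (C0 ('e_l 0 i'))) => x _; rewrite block_mxEur [RHS]mxE ord1.
- by apply: (Ck_on_eq oU _ (C0 0)) => x _; rewrite block_mxEdl mxE.
- by apply: (Ck_on_eq oU _ (C0 0)) => x _; rewrite block_mxEdr mxE.
Qed.

Lemma dconn_affine x u v : U x ->
  dconn affine_system x u v = block_mx (dconn Gam x u v)^T 0 0 0.
Proof.
move=> Ux; have d1 := conn_derive (fun l => Ck_affine 2 l) u v Ux.
have d2 := conn_derive (fun l => CGam l 2) u v Ux.
have /is_derive_mxP d3 := d1; have /is_derive_mxP d4 := d2.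
apply/matrixP => i j; have [_ <-] := d3 i j.
case: (split_ordP i) => i' ->; case: (split_ordP j) => j' ->.
- rewrite block_mxEul mxE; have [_ <-] := d4 j' i'; congr ('D_u _ x).
  by apply/funext => y; rewrite conn_affine block_mxEul mxE.
- rewrite block_mxEur mxE -(derive_cst (v 0 i') x u); congr ('D_u _ x).
  by apply/funext => y; rewrite conn_affine block_mxEur mxE ord1.
- rewrite block_mxEdl mxE -(derive_cst (0 : R) x u); congr ('D_u _ x).
  by apply/funext => y; rewrite conn_affine block_mxEdl mxE.
- rewrite block_mxEdr mxE -(derive_cst (0 : R) x u); congr ('D_u _ x).
  by apply/funext => y; rewrite conn_affine block_mxEdr mxE.
Qed.

Lemma block_mx_cancel (A B C D : 'M[R]_n) (c d : 'cV[R]_n) : A - B + (C - D) = 0 -> c = d ->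
  block_mx A 0 0 0 - block_mx B 0 0 0 + (block_mx C c 0 0 - block_mx D d 0 0) =
  0 :> 'M[R]_(n + 1).
Proof.
move=> E ->; rewrite !opp_block_mx !add_block_mx E !oppr0 !addr0 add0r.
by rewrite addrN block_mx0.
Qed.

(** The two nonzero blocks carry the two hypotheses: the upper left one is the curvature of [Gam],
    the upper right one its torsion, which is the obstruction to a parallel 1-form being closed. *)
Lemma affine_flat x u v : U x ->
  dconn affine_system x u v - dconn affine_system x v u +
  (conn affine_system x u *m conn affine_system x v
   - conn affine_system x v *m conn affine_system x u) = 0.
Proof.
move=> Ux; rewrite !dconn_affine // !conn_affine !mulmx_block !mulmx0 !mul0mx !addr0.
apply: block_mx_cancel; last by rewrite -!trmx_mul torsion_free.
rewrite -[RHS]trmx0 -(flat u v Ux) -!trmx_mul.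
move: (dconn _ _ _ _) (dconn _ _ _ _) (_ *m _) (_ *m _) => P1 P2 P3 P4.
by apply/matrixP => i j; rewrite !mxE.
Qed.

Lemma affine_mul (z : 'rV[R]_(n + 1)) (A : 'M[R]_n) (v : 'rV[R]_n) :
  (forall k, (z *m block_mx A^T v^T 0 0) 0 (lshift 1 k) = \sum_l A k l * z 0 (lshift 1 l)) /\
  (z *m block_mx A^T v^T 0 0) 0 (rshift n ord0) = \sum_l v 0 l * z 0 (lshift 1 l).
Proof.
split=> [k|]; rewrite mxE big_split_ord /= big_ord1.
- rewrite block_mxEdl mxE mulr0 addr0; apply: eq_bigr => l _.
  by rewrite block_mxEul mxE mulrC.
- rewrite block_mxEdr mxE mulr0 addr0; apply: eq_bigr => l _.
  by rewrite block_mxEur mxE mulrC.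
Qed.

(** Column [a] of [J] is a parallel 1-form, and coordinate [a] of [phi] is its primitive; both are
    read off from one solution of the affine system. *)
Theorem flat_coordinates : exists (U' W : set 'rV[R]_n) (phi psi : 'rV[R]_n -> 'rV[R]_n)
  (J : 'rV[R]_n -> 'M[R]_n),
  [/\ [/\ open U', U' x0 & U' `<=` U],
      exists2 e : R, 0 < e & W = [set y | `|y - phi x0| < e],
      [/\ forall x, U' x -> W (phi x) /\ psi (phi x) = x,
          forall y, W y -> U' (psi y) /\ phi (psi y) = y,
          smooth_on U' phi & smooth_on W psi],
      forall x, U' x -> [/\ differentiable J x, J x \in unitmx &
          forall v, 'D_v J x = conn Gam x v *m J x] &
      forall y, W y -> forall v, 'D_v psi y = v *m invmx (J (psi y))].
Proof.
have [r r0 Hr] := frobenius oU Ux0 (fun l => Ck_affine 2 l) affine_flat.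
(* Starting from the standard coframe makes [J x0] the identity, the normalisation required by
   [inverse_function]; the primitives start at 0. *)
pose z a := sval (cid (Hr (row_mx 'e_a 0))).
have z0 a : z a x0 = row_mx 'e_a 0 by rewrite /z; case: cid => ? [].
pose B := [set x : 'rV[R]_n | `|x - x0| < r].
have zP a x : B x -> [/\ U x, differentiable (z a) x &
    forall v, 'D_v (z a) x = z a x *m conn affine_system x v].
  by rewrite /z; case: cid => /= f [_ H]; exact: H.
have oB : open B by exact: open_norm_ball.
have BU : B `<=` U.
  by move=> x Bx; have [f [_ H]] := Hr 0; have [] := H x Bx.
have Cz a : smooth_on B (z a).
  apply: smooth_bootstrap => [x /(zP a)[]//|k Ck v].
  have : Ck_on k B (fun x => z a x *m conn affine_system x v).
    apply: Ck_on_mulmx => //; apply: Ck_on_conn => // l.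
    by apply: Ck_on_sub (Ck_affine k l).
  by apply: (Ck_on_eq oB) => x /(zP a)[_ _ ->].
pose phi x : 'rV[R]_n := \row_a z a x 0 (rshift n ord0).
pose J x : 'M[R]_n := \matrix_(k, a) z a x 0 (lshift 1 k).
have zdE a x i v : B x -> 'D_v (fun y => z a y 0 i) x = (z a x *m conn affine_system x v) 0 i.
  by move=> /(zP a) [_ dz <-]; rewrite derive_mxE.
have zd a x i : B x -> differentiable (fun y => z a y 0 i) x.
  by move=> /(zP a) [_ dz _]; exact: (differentiable_mxP _ _).1.
have dphi x : B x -> differentiable phi x /\ forall v, 'D_v phi x = v *m J x.
  move=> Bx; have dp : differentiable phi x.
    apply/differentiable_mxP => i j.
    by have -> : (fun y => phi y i j) = fun y => z j y 0 (rshift n ord0);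
      [apply/funext => y; rewrite mxE|exact: zd].
  split => // v; apply/rowP => a; rewrite derive_mxE // [RHS]mxE.
  have -> : (fun y => phi y 0 a) = fun y => z a y 0 (rshift n ord0) by apply/funext => y; rewrite mxE.
  rewrite zdE // conn_affine (affine_mul _ _ _).2; apply: eq_bigr => l _.
  by rewrite [J x l a]mxE.
have JE k a : (fun y => J y k a) = fun y => z a y 0 (lshift 1 k) by apply/funext => y; rewrite mxE.
have dJ x : B x -> differentiable J x /\ forall v, 'D_v J x = conn Gam x v *m J x.
  move=> Bx; have dp : differentiable J x by apply/differentiable_mxP => i j; rewrite JE; exact: zd.
  split => // v; apply/matrixP => k a; rewrite derive_mxE // [RHS]mxE JE.
  rewrite zdE // conn_affine (affine_mul _ _ _).1; apply: eq_bigr => l _.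
  by rewrite [J x l a]mxE.
have Bx0 : B x0 by rewrite /B /= subrr normr0.
have Jx0 : J x0 = 1%:M.
  by apply/matrixP => k a; rewrite mxE z0 row_mxEl !mxE eqxx eq_sym.
have e0 : 0 < 2^-1 / (n%:R + 1) :> R by rewrite divr_gt0 ?invr_gt0 // ltr_pwDr.
have cJ := differentiable_continuous (dJ x0 Bx0).1.
have [d /= d0 Hd] := (nbhs_normP _ _).1 ((cvgrPdist_le _ _).1 cJ _ e0).
pose r' := Num.min r d.
have r'0 : 0 < r' by rewrite lt_min r0.
have rr' x : `|x - x0| < r' -> B x /\ `|x - x0| < d by rewrite lt_min => /andP[].
have Jnear x : `|x - x0| < r' -> n%:R * `|J x - 1%:M| <= 2^-1.
  move=> /rr' [_ xd]; have := Hd x; rewrite /= Jx0 distrC => /(_ xd); rewrite distrC => H.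
  rewrite (le_trans (ler_wpM2l _ H)) // mulrCA ler_piMr ?invr_ge0 //.
  by rewrite ler_pdivrMr ?mul1r ?lerDl // ltr_pwDr.
have dphi' x : `|x - x0| < r' -> differentiable phi x /\ forall v, 'D_v phi x = v *m J x.
  by move=> /rr' [Bx _]; exact: dphi.
have [U' [W [psi [[oU' U'x0 U'r] WE Uphi Wpsi dpsi]]]] := inverse_function r'0 dphi' Jnear.
have U'B : U' `<=` B by move=> x /U'r /rr' [].
have CJ k : Ck_on k U' J.
  apply: (Ck_on_sub U'B); apply/(Ck_on_mxP _ _ oB) => i j; rewrite JE.
  by apply: (Ck_on_mxP _ _ oB).1; exact: Cz.
have uJ x : U' x -> J x \in unitmx by move=> /U'r xr; exact: (jacobian_unit Jnear xr).
have oW : open W by have [e _ ->] := WE; exact: open_norm_ball.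
exists U', W, phi, psi, J; split => //.
- by split => // x /U'B /BU.
- split => // [k|].
    apply: (Ck_on_sub U'B); apply/(Ck_on_mxP _ _ oB) => i j.
    have -> : (fun y => phi y i j) = fun y => z j y 0 (rshift n ord0).
      by apply/funext => y; rewrite mxE.
    by apply: (Ck_on_mxP _ _ oB).1; exact: Cz.
  apply: smooth_bootstrap => [y /dpsi []//|k Ck v].
  have : Ck_on k W (fun y => v *m invmx (J (psi y))).
    apply: Ck_on_mulmx => //; first exact: Ck_on_cst.
    apply/(Ck_on_mxP _ _ oW); apply: Ck_on_invmx => // [i j|y /Wpsi [/uJ]//].
    apply: (Ck_on_comp oU' oW (f := fun x => J x i j) (g := psi)) => //.
      by move=> y /Wpsi [].
    by apply: (Ck_on_mxP _ _ oU').1.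
  by apply: (Ck_on_eq oW) => y /dpsi [_ ->].
- by move=> x U'x; have [? ?] := dJ x (U'B x U'x); split => //; exact: uJ.
- by move=> y /dpsi [].
Qed.

End FlatCoordinates.

(** * Maximal inscribed ellipsoids *)

Section PuncturedSpace.
Context {R : realType} {n : nat}.
Hypothesis n2 : (2 <= n)%N.

Lemma exists_independent (y : 'rV[R]_n) : y != 0 -> exists w : 'rV[R]_n, forall a, w <> a *: y.
Proof.
move=> y0; have /rV0Pn[j yj] := y0.
have [k kj] : exists k : 'I_n, k != j.
  have [->|j0] := eqVneq j (Ordinal (ltnW n2)); first by exists (Ordinal n2).
  by exists (Ordinal (ltnW n2)); rewrite eq_sym.
exists 'e_k => a E.
have := congr1 (fun v : 'rV[R]_n => v 0 j) E; rewrite !mxE eqxx /= eq_sym (negbTE kj) => /esym/eqP.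
rewrite mulf_eq0 (negbTE yj) orbF => /eqP a0.
have := congr1 (fun v : 'rV[R]_n => v 0 k) E; rewrite !mxE !eqxx a0 mul0r /= => /eqP.
by rewrite oner_eq0.
Qed.

(** The segment between two independent vectors avoids 0, so the mean value theorem compares them.
    Arbitrary [y] and [z] are joined through a vector independent of [y], which exists as
    [n >= 2]. *)
Lemma constant_punctured (f : 'rV[R]_n -> R) :
  (forall y, y != 0 -> differentiable f y) -> (forall y v, y != 0 -> 'D_v f y = 0) ->
  forall y z, y != 0 -> z != 0 -> f y = f z.
Proof.
move=> df Df.
have H y w : y != 0 -> (forall a, w <> a *: y) -> f y = f w.
  move=> y0 wy.
  have seg (t : R) : t *: (w - y) + y != 0.
    apply/eqP => E; have tw : t *: w = (t - 1) *: y.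
      by apply/eqP; rewrite -subr_eq0 -E; apply/eqP/rowP => i; rewrite !mxE; ring.
    have [t0|t0] := eqVneq t 0.
      by move: E; rewrite t0 scale0r add0r => /eqP; rewrite (negbTE y0).
    by apply: (wy (t^-1 * (t - 1))); rewrite -scalerA -tw scalerA mulVf // scale1r.
  have [t _|t _] := @MVT_line _ _ f y (w - y); first exact/df/seg.
  by rewrite Df ?seg // subrK => /eqP; rewrite subr_eq0 => /eqP.
move=> y z y0 z0; have [w wy] := exists_independent y0.
(* If the intermediate vector is a multiple of [z], then [z] itself is independent of [y] and can be
   compared directly. *)
have [[a wz]|wz] := pselect (exists a, w = a *: z); last first.
  by rewrite (H y w) // (H z w) // => a wa; apply: wz; exists a.
apply: H => // b zb; apply: (wy (a * b)); rewrite wz zb scalerA //.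
Qed.

End PuncturedSpace.

Section DotProduct.
Context {R : realType} {n : nat}.
Implicit Types (u v w : 'rV[R]_n).

Definition dot u v : R := \sum_i u 0 i * v 0 i.

Lemma dotC u v : dot u v = dot v u.
Proof. by apply: eq_bigr => i _; rewrite mulrC. Qed.

Lemma dotDl u v w : dot (u + v) w = dot u w + dot v w.
Proof. by rewrite /dot -big_split; apply: eq_bigr => i _; rewrite mxE mulrDl. Qed.

Lemma dotZl a u v : dot (a *: u) v = a * dot u v.
Proof. by rewrite /dot mulr_sumr; apply: eq_bigr => i _; rewrite mxE mulrA. Qed.

Lemma dotDr u v w : dot w (u + v) = dot w u + dot w v.
Proof. by rewrite dotC dotDl !(dotC w). Qed.

Lemma dotZr a u v : dot u (a *: v) = a * dot u v.
Proof. by rewrite dotC dotZl dotC. Qed.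

Lemma dot_mulmx u v (A : 'M[R]_n) : dot (u *m A) v = dot u (v *m A^T).
Proof.
have E a b : dot a b = (a *m b^T) 0 0 by rewrite mxE; apply: eq_bigr => i _; rewrite mxE.
by rewrite !E trmx_mul trmxK mulmxA.
Qed.

Lemma dot_ge0 u : 0 <= dot u u.
Proof. by apply: sumr_ge0 => i _; rewrite -expr2 sqr_ge0. Qed.

Lemma dot_gt0 u : u != 0 -> 0 < dot u u.
Proof.
move=> /rV0Pn[j uj]; rewrite /dot (bigD1 j) //= ltr_pwDl //.
  by rewrite -expr2 exprn_even_gt0.
by apply: sumr_ge0 => i _; rewrite -expr2 sqr_ge0.
Qed.

Lemma dot_le_norm u : dot u u <= n%:R * `|u| ^+ 2.
Proof.
rewrite -[X in X%:R * _]card_ord -sumr_const mulr_suml; apply: ler_sum => i _.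
by rewrite mul1r -expr2 -real_normK ?num_real // ler_sqr ?nnegrE // rV_coord_norm.
Qed.

Lemma coord_dot u j : u 0 j ^+ 2 <= dot u u.
Proof.
rewrite /dot (bigD1 j) //= -expr2 lerDl; apply: sumr_ge0 => i _.
by rewrite -expr2 sqr_ge0.
Qed.

Lemma Ck_on_dot k (V : normedModType R) (U : set V) (f g : V -> 'rV[R]_n) : open U ->
  Ck_on k U f -> Ck_on k U g -> Ck_on k U (fun x => dot (f x) (g x)).
Proof.
move=> oU /(Ck_on_mxP _ _ oU) Cf /(Ck_on_mxP _ _ oU) Cg.
by apply: Ck_on_sum => // i; apply: Ck_onM.
Qed.

Lemma Ck_on_id k (V : normedModType R) (U : set V) : Ck_on k U (@idfun V).
Proof. by apply: Ck_on_linear => x; exact: cvg_id. Qed.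

Lemma is_derive_sqn u v : is_derive u v (fun w => dot w w) (2 * dot u v).
Proof.
have dc i : is_derive u v (fun w : 'rV[R]_n => w 0 i) (v 0 i).
  by have /is_derive_mxP := @is_derive_id R 'rV[R]_n u v; exact.
have -> : 2 * dot u v = \sum_i (u 0 i * v 0 i + u 0 i * v 0 i).
  by rewrite /dot mulr_sumr; apply: eq_bigr => i _; rewrite mulr_natl mulr2n.
by apply: is_derive_bigsum => i; have dci := dc i; apply: is_deriveM.
Qed.

End DotProduct.

(** The product rule for a vanishing function whose direction of differentiation is linear in the
    point. It is used along [u = y A] at contact points, and in a fibre for the skewness of the
    curvature. *)
Lemma derive_linear_field {R : realType} {n : nat} (U : set 'rV[R]_n) (f : 'rV[R]_n -> R)
    (A : 'M[R]_n) y u : open U -> Ck_on 2 U f -> U y ->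
  (forall z, U z -> 'D_(z *m A) f z = 0) ->
  'D_u ('D_(y *m A) f) y + 'D_(u *m A) f y = 0.
Proof.
move=> oU Cf Uy fA; have [df Df] := Cf.
pose g z := \sum_j (z *m A) 0 j * 'D_('e_j) f z.
have g0 : 'D_u g y = 0.
  rewrite -(derive_cst (0 : R) y u); apply: near_eq_derive.
  by apply: (open_near_eq oU Uy) => z Uz; rewrite /g -deriveE_rV ?fA //; exact: df.
have dmul j : is_derive y u (fun z => (z *m A) 0 j) ((u *m A) 0 j).
  have := is_derive_mulmx (@is_derive_id _ _ y u) (@is_derive_cst _ _ _ A y u).
  by rewrite mulmx0 addr0 => /is_derive_mxP; exact.
have dg : is_derive y u g (\sum_j ((y *m A) 0 j * 'D_u ('D_('e_j) f) y + (u *m A) 0 j * 'D_('e_j) f y)).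
  apply: is_derive_bigsum => j; have d1 := dmul j.
  have d2 : is_derive y u ('D_('e_j) f) ('D_u ('D_('e_j) f) y).
    by apply: differentiable_is_derive; have [H _] := Df 'e_j; exact: H.
  by apply: is_derive_eq; rewrite -![_ *: _]/(_ * _) [X in _ + X]mulrC.
rewrite (deriveD_rV _ _ oU Uy Cf) [X in _ + X]deriveE_rV; last exact: df.
by have [_ E] := dg; rewrite -big_split /= -E g0.
Qed.

Section DetPerturbation.
Context {R : realType} {n : nat}.

Lemma det_char_poly (N : 'M[R]_n) (t : R) : t != 0 ->
  \det (1%:M + t *: N) = t ^+ n * (char_poly (- N)).[t^-1].
Proof.
move=> t0; rewrite /char_poly -horner_evalE -det_map_mx -detZ; congr (\det _).
apply/matrixP => i j; rewrite !mxE /= /horner_eval !hornerE.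
rewrite opprK mulrDr; congr (_ + _).
by case: (i == j); rewrite ?mulr1n ?mulr0n ?hornerE ?mulr0 // mulfV.
Qed.

(** The determinant is [1 + t \tr N] plus terms bounded by [C t^2] for [t <= 1], where [C] sums the
    absolute values of the lower coefficients of the characteristic polynomial; below [t0] the
    linear term dominates. *)
Lemma det_gt1 (N : 'M[R]_n) : (2 <= n)%N -> 0 < \tr N ->
  exists2 t0 : R, 0 < t0 & forall t, 0 < t <= t0 -> 1 < \det (1%:M + t *: N).
Proof.
move=> n2 trN; pose p := char_poly (- N).
pose C := \sum_(i < n.-1) `|p`_i|.
have C0 : 0 <= C by apply: sumr_ge0.
have C10 : 0 < C + 1 by rewrite ltr_pwDr.
exists (Num.min 1 (\tr N / 2 / (C + 1))); first by rewrite lt_min ltr01 !divr_gt0.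
move=> t /andP[t0]; rewrite le_min => /andP[t1 tC].
rewrite det_char_poly ?gt_eqF // (@horner_coef_wide _ n.+1) ?size_char_poly // -/p.
have nE : n = n.-2.+2 by case: n n2 => [|[|]].
have pn : p`_n = 1.
  by have /monicP := char_poly_monic (- N); rewrite lead_coefE size_char_poly.
have pn1 : p`_n.-1 = \tr N by rewrite char_poly_trace ?(ltnW n2) // raddfN /= opprK.
rewrite big_ord_recr /= pn mul1r mulrDr -exprMn divff ?gt_eqF // expr1n.
have -> : \sum_(i < n) p`_i * t^-1 ^+ i =
    \sum_(i < n.-1) p`_i * t^-1 ^+ i + p`_n.-1 * t^-1 ^+ n.-1.
  by rewrite nE big_ord_recr.
rewrite pn1 mulrDr.
have -> : t ^+ n * (\tr N * t^-1 ^+ n.-1) = t * \tr N.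
  rewrite mulrCA exprVn -[in t ^+ n](ltn_predK n2) exprS -mulrA mulfV ?mulr1 1?mulrC //.
  by rewrite expf_neq0 // gt_eqF.
have : `|t ^+ n * (\sum_(i < n.-1) p`_i * t^-1 ^+ i)| <= t ^+ 2 * C.
  rewrite mulr_sumr (le_trans (ler_norm_sum _ _ _)) // /C mulr_sumr; apply: ler_sum => i _.
  rewrite mulrCA normrM mulrC ler_pM // exprVn.
  have iE : n = (n - i + i)%N by rewrite subnK // (leq_trans (ltnW (ltn_ord i))) // leq_pred.
  rewrite {1}iE exprD mulfK ?expf_neq0 ?gt_eqF // ger0_norm ?exprn_ge0 ?(ltW t0) //.
  apply: ler_wiXn2l => //; first exact: ltW.
  by have := ltn_ord i; move: (nat_of_ord i) n2 => j n2 ji; clear -ji n2; lia.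
rewrite ler_norml => /andP[+ _] => H.
have tCC : t * C < \tr N.
  have tC1 : t * (C + 1) <= \tr N / 2 by rewrite -ler_pdivlMr.
  by move: tC1; rewrite mulrDr mulr1; lra.
have : t * (t * C) < t * \tr N by rewrite ltr_pM2l.
rewrite mulrA -expr2 => H'; lra.
Qed.

End DetPerturbation.

Lemma ge0_limit {R : realType} {V : normedModType R} (g : V -> R) w : {for w, continuous g} ->
  (forall d : R, 0 < d -> exists2 x, `|w - x| < d & 0 <= g x) -> 0 <= g w.
Proof.
move=> gc H; rewrite leNgt; apply/negP => gw.
have gw2 : 0 < - g w by rewrite oppr_gt0.
have [d /= d0 Hd] := (nbhs_normP _ _).1 ((cvgrPdist_lt _ _).1 gc _ gw2).
have [x xd gx] := H d d0; have := Hd x xd.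
by rewrite /= ltr_norml => /andP[+ _]; rewrite opprK ltrBrDr; lra.
Qed.

(** Mean values on shrinking segments produce points near [w] where the first, then the second,
    derivative is nonnegative, and continuity passes this to [w]. Using [-v] along with [v] kills
    the gradient. *)
Lemma interior_min {R : realType} {V : normedModType R} (U : set V) (f : V -> R) w u :
  open U -> Ck_on 2 U f -> U w -> (forall y, U y -> f w <= f y) ->
  'D_u f w = 0 /\ 0 <= 'D_u ('D_u f) w.
Proof.
move=> oU Cf Uw fmin; have [df Df] := Cf.
have [d /= d0 HU] := (nbhs_normP _ _).1 (open_nbhs_nbhs (conj oU Uw)).
have small (v : V) (e : R) : 0 < e -> exists2 t : R, 0 < t &
    forall s, 0 <= s <= 1 -> `|w - (s *: (t *: v) + w)| < e /\ U (s *: (t *: v) + w).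
  move=> e0; pose m := Num.min d e; have m0 : 0 < m by rewrite lt_min d0.
  have v0 : 0 < `|v| + 1 by rewrite ltr_pwDr.
  pose t := m / (`|v| + 1); have t0 : 0 < t by rewrite divr_gt0.
  exists t => // s /andP[s0 s1]; have st0 : 0 <= s * t by exact: mulr_ge0 s0 (ltW t0).
  have : `|w - (s *: (t *: v) + w)| < m.
    rewrite opprD addrCA subrr addr0 normrN scalerA normrZ ger0_norm //.
    apply: (@le_lt_trans _ _ (t * `|v|)); first by rewrite ler_wpM2r // (ler_piMl (ltW t0)).
    by rewrite /t mulrAC ltr_pdivrMr // ltr_pM2l // ltrDl.
  rewrite lt_min => /andP[md me]; split => //; exact: HU.
have cD v : {for w, continuous ('D_v f)}.
  by apply: differentiable_continuous; have [H _] := Df v; exact: H.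
have D_ge0 v : 0 <= 'D_v f w.
  apply: (ge0_limit (cD v)) => e e0; have [t t0 Ht] := small v e e0.
  have [s s01|s /andP[s0 s1] E] := @MVT_line _ _ f w (t *: v).
    by have [_ Us] := Ht s s01; exact: df.
  have s01 : 0 <= s <= 1 by rewrite !ltW.
  have [xe Us] := Ht s s01; exists (s *: (t *: v) + w) => //.
  move: E; rewrite deriveZv; last exact: df.
  have o1 : 0 <= (1 : R) <= 1 by rewrite ler01 lexx.
  have [_] := Ht 1 o1; rewrite scale1r => /fmin; rewrite -subr_ge0 => + E; rewrite E.
  by rewrite -[_ *: _]/(_ * _) pmulr_rge0.
have Dv0 v : 'D_v f w = 0.
  apply/eqP; rewrite eq_le D_ge0 andbT -oppr_ge0.
  by have := D_ge0 ((-1) *: v); rewrite deriveZv ?scaleN1r //; exact: df.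
split => //.
have cDD : {for w, continuous ('D_u ('D_u f))} by have [_ H] := Df u; exact: H.
apply: (ge0_limit cDD) => e e0; have [t t0 Ht] := small u e e0.
have [s s01|s /andP[s0 s1] E] := @MVT_line _ _ f w (t *: u).
  by have [_ Us] := Ht s s01; exact: df.
have s01 : 0 <= s <= 1 by rewrite !ltW.
have sub r : 0 <= r <= 1 -> 0 <= r * s <= 1.
  by move=> /andP[r0 r1]; rewrite mulr_ge0 ?(ltW s0) //= mulr_ile1 // ltW.
have [_ Us] := Ht s s01.
have [r r01|r /andP[r0 r1] E'] := @MVT_line _ _ ('D_u f) w (s *: (t *: u)).
  have [H _] := Df u; apply: H; rewrite [r *: _]scalerA.
  by have [_] := Ht (r * s) (sub r r01).
have rs01 : 0 <= r * s <= 1 by apply: sub; rewrite !ltW.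
have [xe Urs] := Ht (r * s) rs01; exists ((r * s) *: (t *: u) + w) => //.
have o1 : 0 <= (1 : R) <= 1 by rewrite ler01 lexx.
have [_] := Ht 1 o1; rewrite scale1r => /fmin; rewrite -subr_ge0 E.
rewrite deriveZv; last exact: df.
have dz : differentiable ('D_u f) ((r * s) *: (t *: u) + w) by have [H _] := Df u; exact: H.
move: E'; rewrite Dv0 subr0 [r *: _]scalerA => ->; rewrite [s *: (t *: u)]scalerA deriveZv //.
rewrite -![_ *: _]/(_ * _) !pmulr_rge0 ?mulr_gt0 //.
Qed.

(** * Extremal quadratic forms below a homogeneous function *)

Section Minkowski.
Context {R : realType} {n : nat}.
Hypothesis n2 : (2 <= n)%N.
Variable l : 'rV[R]_n -> R.
Let V0 := [set y : 'rV[R]_n | y != 0].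
Hypothesis Cl : Ck_on 2 V0 l.
Hypothesis l_homogeneous : forall y (t : R), 0 < t -> l (t *: y) = t ^+ 2 * l y.
Hypothesis l_pos : forall y, y != 0 -> 0 < l y.
Hypothesis l0 : l 0 = 0.

Let S := [set y : 'rV[R]_n | `|y| = 1].

Let norm_rV_continuous : continuous (fun y : 'rV[R]_n => `|y| : R^o).
Proof. exact: norm_continuous. Qed.

Lemma open_punctured : open V0.
Proof.
have -> : V0 = (fun y : 'rV[R]_n => `|y|) @^-1` [set a | a != 0].
  by apply/seteqP; split => y /=; rewrite normr_eq0.
by move/continuousP: norm_rV_continuous; apply; exact: open_neq.
Qed.

Lemma unit_sphere_compact : compact S.
Proof.
apply: bounded_closed_compact.
  by exists 1; split => // M M1 y /= ->; exact: ltW.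
have -> : S = (fun y : 'rV[R]_n => `|y|) @^-1` [set 1] by [].
by move/continuous_closedP: norm_rV_continuous; apply; exact: closed_eq.
Qed.

Lemma unit_sphere_neq0 y : S y -> y != 0.
Proof. by move=> Sy; rewrite -normr_gt0 Sy. Qed.

Lemma unit_sphere_nonempty : S !=set0.
Proof.
pose e : 'rV[R]_n := 'e_(Ordinal n2).
have e0 : e != 0 by apply/rV0Pn; exists (Ordinal n2); rewrite mxE !eqxx oner_eq0.
exists (`|e|^-1 *: e); rewrite /S /= normrZ normfV normr_id mulVf // normr_eq0 //.
Qed.

Lemma polar_decomposition y : y != 0 -> exists2 u, S u & y = `|y| *: u.
Proof.
move=> y0; exists (`|y|^-1 *: y).
  by rewrite /S /= normrZ normfV normr_id mulVf // normr_eq0.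
by rewrite scalerA mulfV ?scale1r // normr_eq0.
Qed.

(* It suffices to compare quadratic forms with [l] on the unit sphere. *)
Lemma quadratic_le_on_sphere (P : 'M[R]_n) :
  (forall u, S u -> dot (u *m P) (u *m P) <= l u) ->
  forall y, dot (y *m P) (y *m P) <= l y.
Proof.
move=> H y; have [->|y0] := eqVneq y 0.
  by rewrite mul0mx l0 /dot big1 // => i _; rewrite mxE mul0r.
have [u Su ->] := polar_decomposition y0.
rewrite -scalemxAl dotZl dotZr mulrA -expr2 l_homogeneous ?normr_gt0 //.
by rewrite ler_wpM2l ?exprn_ge0 // H.
Qed.

(** The matrices whose form lies below [l] make a compact set: the condition is closed, and the
    squared entries of row [i] are at most [l 'e_i]. A small multiple of the identity belongs to it,
    so the maximal determinant is nonzero. *)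
Lemma inscribed_form : exists P : 'M[R]_n, [/\ P \in unitmx,
  forall y, dot (y *m P) (y *m P) <= l y &
  forall P' : 'M[R]_n, (forall y, dot (y *m P') (y *m P') <= l y) -> `|\det P'| <= `|\det P|].
Proof.
pose K := [set p : 'rV[R]_(n * n) | forall y, dot (y *m vec_mx p) (y *m vec_mx p) <= l y].
have lc : {in S, continuous l}.
  move=> y; rewrite inE => Sy; apply/differentiable_continuous.
  by case: Cl => dl _; apply: dl; exact: unit_sphere_neq0.
have Cvec k : Ck_on k setT (vec_mx : 'rV[R]_(n * n) -> 'M[R]_n).
  apply/(Ck_on_mxP _ _ openT) => i j.
  apply: (Ck_on_eq openT (f := fun p : 'rV[R]_(n * n) => p 0 (mxvec_index i j))) => [p _|].
    by rewrite mxE.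
  by apply: (Ck_on_mxP _ _ openT).1; exact: Ck_on_id.
have Ccont (f : 'rV[R]_(n * n) -> R) : Ck_on 0 setT f -> continuous f by move=> H x; exact: (H x I).
have Kc : compact K.
  apply: bounded_closed_compact.
    pose M := \sum_i l 'e_i; exists (1 + M); split; first exact: num_real.
    have e0 i : 'e_i != 0 :> 'rV[R]_n by apply/rV0Pn; exists i; rewrite mxE !eqxx oner_eq0.
    have M0 : 0 <= M by apply: sumr_ge0 => i _; exact/ltW/l_pos/e0.
    suff KM (p : 'rV[R]_(n * n)) : K p -> `|p| <= 1 + M.
      by move=> b Mb p /KM; move/le_trans; apply; exact: ltW.
    move=> Kp; apply: mx_norm_le => [|a k]; first by rewrite addr_ge0.
    rewrite ord1; case/mxvec_indexP: k => i j.
    have pE : p 0 (mxvec_index i j) = (('e_i : 'rV[R]_n) *m vec_mx p) 0 j by rewrite -rowE !mxE.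
    have := le_trans (coord_dot ('e_i *m (vec_mx p : 'M[R]_n)) j) (Kp 'e_i); rewrite -pE => H.
    have : p 0 (mxvec_index i j) ^+ 2 <= M.
      rewrite (le_trans H) // /M (bigD1 i) //= lerDl; apply: sumr_ge0 => k _; exact/ltW/l_pos/e0.
    rewrite -real_normK ?num_real //; move: (`|p 0 _|) (normr_ge0 (p 0 (mxvec_index i j))) => c c0 cM.
    rewrite leNgt; apply/negP => Mc; move: cM; apply/negP; rewrite -ltNge expr2.
    have c1 : 1 <= c by rewrite (le_trans _ (ltW Mc)) // lerDl.
    rewrite (lt_le_trans _ (ler_peMl c0 c1)) // (le_lt_trans _ Mc) // lerDr //.
  have -> : K = \bigcap_(y in [set: 'rV[R]_n])
      ((fun p => dot (y *m vec_mx p) (y *m vec_mx p)) @^-1` [set a | a <= l y]).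
    by apply/seteqP; split => p Kp y; [move=> _; exact: Kp|exact: (Kp y I)].
  apply: closed_bigI => y _; apply: ((continuous_closedP _).1 _ _ (@closed_le R (l y))).
  apply: Ccont; apply: Ck_on_dot; [exact: openT| |];
    by apply: Ck_on_mulmx; [exact: openT|exact: Ck_on_cst|exact: Cvec].
have [m m0 lm] : exists2 m : R, 0 < m & forall u, S u -> m <= l u.
  have [u Su Hu] := compact_EVT_min unit_sphere_nonempty unit_sphere_compact
     (continuous_in_subspaceT lc).
  exists (l u); first by apply/l_pos/unit_sphere_neq0; rewrite inE in Su.
  by move=> v Sv; apply: Hu; rewrite inE.
(* On the unit sphere of the sup norm [dot u u <= n]; with [e <= 1] this gives
   [e^2 n <= e (n + 1) <= m <= l u]. *)
pose e := Num.min 1 (m / (n%:R + 1)).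
have e0 : 0 < e by rewrite lt_min ltr01 divr_gt0 // ltr_pwDr.
have Ke : K (mxvec (e%:M : 'M[R]_n)).
  move=> y; rewrite mxvecK; move: y; apply: quadratic_le_on_sphere => u Su.
  rewrite mul_mx_scalar dotZl dotZr (le_trans _ (lm u Su)) //.
  have e1 : e <= 1 by rewrite ge_min lexx.
  have em : e * (n%:R + 1) <= m by rewrite -ler_pdivlMr ?ltr_pwDr // ge_min lexx orbT.
  have un : dot u u <= n%:R by rewrite (le_trans (dot_le_norm _)) // (_ : `|u| = 1) // expr1n mulr1.
  have := dot_ge0 u; move: (dot u u) un => d dn d0.
  have n0 : 0 <= n%:R :> R by [].
  apply: le_trans em; rewrite ler_pM ?(ltW e0) ?mulr_ge0 ?(ltW e0) //.
  apply: (@le_trans _ _ d); first by rewrite ler_piMl.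
  by rewrite (le_trans dn) // lerDl.
have Cdet : continuous (fun p : 'rV[R]_(n * n) => `|\det (vec_mx p)|).
  move=> p; apply: (continuous_comp (f := fun p : 'rV[R]_(n * n) => \det (vec_mx p)) (g := Num.norm)).
    apply: Ccont; apply: Ck_on_det; first exact: openT.
    by move=> i j; apply: (Ck_on_mxP _ _ openT).1.
  exact: norm_continuous.
have [p Kp Hp] := compact_EVT_max (ex_intro _ _ Ke) Kc (continuous_subspaceT Cdet).
rewrite inE in Kp; exists (vec_mx p); split => // [|P' HP'].
  have := Hp (mxvec e%:M); rewrite inE => /(_ Ke); rewrite mxvecK det_scalar => H.
  rewrite unitmxE unitfE -normr_gt0; apply: lt_le_trans H.
  by rewrite normr_gt0 expf_neq0 // gt_eqF.
by have := Hp (mxvec P'); rewrite inE mxvecK; apply; exact: HP'.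
Qed.

Section Extremal.
(** Coordinates are normalised here so that the extremal form of [inscribed_form] is the standard
    one, with the identity as its matrix. *)
Hypothesis l_ge : forall w, dot w w <= l w.
Hypothesis l_max : forall T : 'M[R]_n, (forall w, dot (w *m T) (w *m T) <= l w) -> `|\det T| <= 1.
Variable A : 'M[R]_n.
Hypothesis lA : forall y, y != 0 -> 'D_(y *m A) l y = 0.

(* Half of the second derivative of [dot w w] along the flow of [A]. *)
Let S2 : 'M[R]_n := A *m A^T + 2^-1 *: (A *m A + (A *m A)^T).

Lemma dot_S2 w : dot w (w *m S2) = dot (w *m A) (w *m A) + dot w (w *m A *m A).
Proof.
have E : dot w (w *m (A *m A)^T) = dot w (w *m A *m A).
  by rewrite -dot_mulmx dotC mulmxA.
rewrite /S2 mulmxDr dotDr -scalemxAr dotZr mulmxDr dotDr E [w *m (A *m A)]mulmxA.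
rewrite [w *m (A *m A^T)]mulmxA -dot_mulmx; congr (_ + _); lra.
Qed.

Lemma excess_min w u : w != 0 -> l w = dot w w ->
  'D_u (fun y => l y - dot y y) w = 0 /\ 0 <= 'D_u ('D_u (fun y => l y - dot y y)) w.
Proof.
move=> w0 lw.
have Cd : Ck_on 2 V0 (fun y => dot y y).
  by apply: Ck_on_dot; [exact: open_punctured|exact: Ck_on_id|exact: Ck_on_id].
have Cf : Ck_on 2 V0 (fun y => l y - dot y y) by exact: (Ck_onB open_punctured Cl Cd).
have fmin y : V0 y -> l w - dot w w <= l y - dot y y by rewrite lw subrr subr_ge0.
exact: (interior_min u open_punctured Cf w0 fmin).
Qed.

Lemma excess_derive w u : w != 0 -> 'D_u (fun y => l y - dot y y) w = 'D_u l w - 2 * dot w u.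
Proof.
move=> w0; have dl : is_derive w u l ('D_u l w).
  by apply: differentiable_is_derive; case: Cl => H _; exact: H.
have dd := is_derive_sqn w u.
by have [_ <-] := is_deriveB dl dd.
Qed.

Lemma contact_derivative w u : w != 0 -> l w = dot w w -> 'D_u l w = 2 * dot w u.
Proof.
move=> w0 lw; have [+ _] := excess_min u w0 lw.
by rewrite excess_derive // => /eqP; rewrite subr_eq0 => /eqP.
Qed.

Lemma contact_second_derivative w u : w != 0 -> l w = dot w w ->
  2 * dot u u <= 'D_u ('D_u l) w.
Proof.
move=> w0 lw; have [_] := excess_min u w0 lw.
suff -> : 'D_u ('D_u (fun y => l y - dot y y)) w = 'D_u ('D_u l) w - 2 * dot u u by rewrite subr_ge0.
transitivity ('D_u (fun y => 'D_u l y - 2 * dot y u) w).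
  apply: near_eq_derive; apply: (open_near_eq open_punctured w0) => y.
  exact: excess_derive.
have d1 : is_derive w u ('D_u l) ('D_u ('D_u l) w).
  by apply: differentiable_is_derive; case: Cl => _ /(_ u) [H _]; exact: H.
have d2 : is_derive w u (fun y => 2 * dot y u) (2 * dot u u).
  apply: is_deriveZ; apply: is_derive_bigsum => i.
  have := @is_derive_id R 'rV[R]_n w u => /is_derive_mxP/(_ 0 i) di.
  by apply: is_derive_eq; rewrite -![_ *: _]/(_ * _) mulr0 add0r mulrC.
by have [_ <-] := is_deriveB d1 d2.
Qed.

(** Along the flow of [A] the function [l] is constant, and [dot w w] stays below it with equality
    at the contact point. So [dot w w] is maximal there along the orbit, and [S2] is half its second
    derivative. *)
Lemma contact_le0 w : w != 0 -> l w = dot w w -> dot w (w *m S2) <= 0.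
Proof.
move=> w0 lw; rewrite dot_S2.
have := contact_second_derivative (w *m A) w0 lw.
have := derive_linear_field (w *m A) open_punctured Cl w0 lA.
rewrite (contact_derivative _ w0 lw); lra.
Qed.

Lemma trace_S2 : \tr S2 = 2^-1 * \sum_i \sum_j (A i j + A j i) ^+ 2.
Proof.
have E : \sum_i \sum_j A j i ^+ 2 = \sum_i \sum_j A i j ^+ 2 by rewrite exchange_big.
transitivity (\sum_i \sum_j A i j ^+ 2 + \sum_i \sum_j A i j * A j i).
  rewrite /mxtrace -big_split /=; apply: eq_bigr => i _; rewrite !mxE; congr (_ + _).
    by apply: eq_bigr => j _; rewrite mxE expr2.
  lra.
transitivity (2^-1 * (\sum_i \sum_j A i j ^+ 2 + \sum_i \sum_j A j i ^+ 2
    + 2 * \sum_i \sum_j A i j * A j i)); first by rewrite E; lra.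
congr (_ * _); rewrite mulr_sumr -!big_split /=; apply: eq_bigr => i _.
by rewrite mulr_sumr -!big_split /=; apply: eq_bigr => j _; ring.
Qed.

(** Either the gap [q] is at least [m] and outweighs the whole perturbation, or the first-order gain
    [g] is at least [m] and outweighs the quadratic term. *)
Lemma perturbation_ge0 (t C m q g c : R) : t * C <= m -> `|g| + c <= C ->
  0 <= t -> t <= 1 -> 0 <= c -> 0 <= q -> (m <= q) || (m <= g) ->
  0 <= q + t * g - t ^+ 2 * c.
Proof.
move=> tC gC t0 t1 c0 q0; have cC : c <= C by rewrite (le_trans _ gC) // lerDr.
have tg : - (t * `|g|) <= t * g by rewrite -mulrN ler_wpM2l // lerNl -normrN ler_norm.
have tc : t ^+ 2 * c <= t * c by rewrite expr2 -mulrA ler_piMl // mulr_ge0.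
case/orP => mH.
  have : t * (`|g| + c) <= m by rewrite (le_trans _ tC) // ler_wpM2l.
  by rewrite mulrDr; lra.
have H1 : t * m <= t * g by rewrite ler_wpM2l.
have H2 : t * (t * c) <= t * m by rewrite ler_wpM2l // (le_trans _ tC) // ler_wpM2l.
by rewrite expr2 -mulrA; lra.
Qed.

(** If the trace were positive, [1 + t N] would have determinant above 1 for small [t] while its
    form still lay below [l], against maximality. *)
Lemma trace_S2_le0 : \tr S2 <= 0.
Proof.
rewrite leNgt; apply/negP => trS.
have n0 : 0 < n%:R :> R by rewrite ltr0n ltnW.
(* Subtracting [e] only halves the trace, and makes the form of [N] strictly negative at contact
   points. *)
pose e := \tr S2 / (2 * n%:R); have e0 : 0 < e by rewrite divr_gt0 // mulr_gt0.
pose N := S2 - e%:M.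
have trN : 0 < \tr N.
  have -> : \tr N = \tr S2 / 2.
    rewrite linearB /= mxtrace_scalar -mulr_natr /e.
    have nn : n%:R != 0 :> R by rewrite gt_eqF.
    by field.
  by rewrite divr_gt0.
have [t0 t00 Ht0] := det_gt1 n2 trN.
pose q w := l w - dot w w.
pose g w := - (2 * dot w (w *m N)).
(* [h] is positive on the sphere: off the contact set [q] is, on it [g] is. Compactness turns this
   into a positive minimum. *)
pose h w := Num.max (q w) (g w).
have CN k : Ck_on k V0 (fun w : 'rV[R]_n => w *m N).
  by apply: Ck_on_mulmx; [exact: open_punctured|exact: Ck_on_id|exact: Ck_on_cst].
have Cq : Ck_on 0 V0 q.
  apply: (Ck_onB open_punctured (Ck_on_le (leq0n 2) Cl)).
  by apply: Ck_on_dot; [exact: open_punctured|exact: Ck_on_id|exact: Ck_on_id].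
have Cg : Ck_on 0 V0 g.
  apply: Ck_onN; first exact: open_punctured.
  apply: Ck_onM; [exact: open_punctured|exact: Ck_on_cst|].
  by apply: Ck_on_dot; [exact: open_punctured|exact: Ck_on_id|exact: CN].
pose c w := dot (w *m N) (w *m N).
have Cc : Ck_on 0 V0 c by apply: Ck_on_dot; [exact: open_punctured|exact: CN|exact: CN].
have hc : {in S, continuous h}.
  move=> w; rewrite inE => /unit_sphere_neq0 w0.
  by apply: continuous_max; [exact: Cq|exact: Cg].
have kc : {in S, continuous (fun w => `|g w| + c w)}.
  move=> w; rewrite inE => /unit_sphere_neq0 w0.
  have H1 : {for w, continuous (fun w => `|g w|)}.
    by apply: (continuous_comp (f := g) (g := Num.norm)); [exact: Cg|exact: norm_continuous].
  exact: (continuousD H1 (Cc w w0)).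
have [w1 Sw1 Hw1] := compact_EVT_min unit_sphere_nonempty unit_sphere_compact
  (continuous_in_subspaceT hc).
have [w2 Sw2 Hw2] := compact_EVT_max unit_sphere_nonempty unit_sphere_compact
  (continuous_in_subspaceT kc).
pose m := h w1; pose C := `|g w2| + c w2.
have m0 : 0 < m.
  rewrite /m /h lt_max; have [//|q0] := ltP 0 (q w1).
  rewrite inE in Sw1; have w10 := unit_sphere_neq0 Sw1.
  have lw1 : l w1 = dot w1 w1 by apply/eqP; rewrite eq_le l_ge andbT -subr_le0.
  rewrite /g /N mulmxBr mul_mx_scalar dotDr -[- (e *: w1)]scaleN1r !dotZr /=.
  have := contact_le0 w10 lw1; have := mulr_gt0 e0 (dot_gt0 w10); lra.
have C0 : 0 <= C by rewrite addr_ge0 // dot_ge0.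
pose t := Num.min t0 (Num.min 1 (m / (C + 1))).
have t_gt0 : 0 < t by rewrite !lt_min t00 ltr01 divr_gt0 // ltr_pwDr.
have tt0 : t <= t0 by rewrite ge_min lexx.
have t1 : t <= 1 by rewrite !ge_min lexx orbT.
have tC : t * C <= m.
  have : t * (C + 1) <= m by rewrite -ler_pdivlMr ?ltr_pwDr // !ge_min lexx !orbT.
  by apply: le_trans; rewrite ler_wpM2l ?(ltW t_gt0) // lerDl.
have : `|\det (1%:M + t *: N)| <= 1.
  apply: l_max; apply: quadratic_le_on_sphere => w Sw.
  have Hm : m <= h w by apply: Hw1; rewrite inE.
  have HC : `|g w| + c w <= C by apply: Hw2; rewrite inE.
  have c0 : 0 <= c w by exact: dot_ge0.
  have q0 : 0 <= q w by rewrite subr_ge0.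
  have -> : dot (w *m (1%:M + t *: N)) (w *m (1%:M + t *: N)) = dot w w - t * g w + t ^+ 2 * c w.
    rewrite mulmxDr mulmx1 -scalemxAr dotDl !dotDr !dotZl !dotZr (dotC (w *m N) w) /g /c; ring.
  have : 0 <= q w + t * g w - t ^+ 2 * c w.
    have Hm' : (m <= q w) || (m <= g w) by rewrite -le_max.
    exact: (perturbation_ge0 tC HC (ltW t_gt0) t1 c0 q0 Hm').
  by rewrite /q; lra.
by apply/negP; rewrite -ltNge (lt_le_trans (Ht0 t _)) ?ler_norm // t_gt0.
Qed.

Lemma extremal_skew w : dot w (w *m A) = 0.
Proof.
have := trace_S2_le0; rewrite trace_S2 pmulr_rle0 ?invr_gt0 // => H.
have sq0 i j : 0 <= (A i j + A j i) ^+ 2 by exact: sqr_ge0.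
have row0 i : 0 <= \sum_j (A i j + A j i) ^+ 2 by apply: sumr_ge0.
have /eqP : \sum_i \sum_j (A i j + A j i) ^+ 2 = 0.
  by apply/eqP; rewrite eq_le H sumr_ge0.
rewrite psumr_eq0 // => /allP H1.
have AT : A^T = - A.
  apply/matrixP => i j; rewrite !mxE; apply/eqP; rewrite eq_sym -subr_eq0 -opprD oppr_eq0.
  have := H1 i (mem_index_enum i); rewrite psumr_eq0 // => /allP /(_ j (mem_index_enum j)).
  by rewrite sqrf_eq0.
have : dot w (w *m A) = - dot w (w *m A).
  by rewrite {1}dotC dot_mulmx AT mulmxN -scaleN1r dotZr mulN1r.
lra.
Qed.

End Extremal.

End Minkowski.

Lemma euler_homogeneous {R : realType} {V : normedModType R} (f : V -> R) (y : V) (d : nat) :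
  (forall t : R, 0 < t -> f (t *: y) = t ^+ d * f y) -> 'D_y f y = d%:R * f y.
Proof.
move=> hom; have := derive_line f y y 0; rewrite scale0r add0r => <-.
have d1 : is_derive (0 : R) 1 (fun s : R => (s + 1) ^+ d * f y) (d%:R * f y).
  have d2 : is_derive (0 : R) 1 (fun s : R => (s + 1) ^+ d) d%:R.
    have d3 : is_derive (0 : R) 1 (fun s : R => s + 1) 1.
      by have := is_deriveD (@is_derive_id _ _ (0 : R) 1) (@is_derive_cst _ _ _ (1 : R) (0 : R) 1); rewrite addr0.
    have -> : (fun s : R => (s + 1) ^+ d) = (fun s : R => s + 1) ^+ d.
      by apply/funext => s; rewrite fctE.
    by apply: (is_derive_eq (is_deriveX d d3)); rewrite add0r expr1n mulr1 [_ *: _]mulr1.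
  have d4 := @is_derive_cst _ _ _ (f y) (0 : R) 1.
  have := is_deriveM d2 d4 => H; apply: (is_derive_eq H).
  by rewrite -![_ *: _]/(_ * _) mulr0 add0r mulrC.
have [_ E] := d1; rewrite -E; apply: near_eq_derive.
near=> s; have s1 : 0 < s + 1.
  have : `|s| < 1 by near: s; exact: (@nbhs0_lt R R^o 1 ltr01).
  by rewrite ltr_norml => /andP[+ _]; lra.
by rewrite -[X in _ *: y + X]scale1r -scalerDl hom.
Unshelve. all: by end_near. Qed.

(** Once the extremal form is normalised, the fields of [h] are skew, so [w] is orthogonal to every
    direction tangent to the level set of [l'] at [w]. Hence [dot w w / l' w] has zero derivatives
    and is constant off the origin. Transitivity is pointwise: the matrix may vary with [y] and
    [w]. *)
Theorem transitive_isometries_quadratic {R : realType} {n : nat} (l : 'rV[R]_n -> R)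
    (h : set 'M[R]_n) : (2 <= n)%N ->
  Ck_on 2 [set y : 'rV[R]_n | y != 0] l ->
  (forall y (t : R), 0 < t -> l (t *: y) = t ^+ 2 * l y) ->
  (forall y, y != 0 -> 0 < l y) -> l 0 = 0 ->
  (forall A, h A -> forall y, y != 0 -> 'D_(y *m A) l y = 0) ->
  (forall y w, y != 0 -> 'D_w l y = 0 -> exists2 A, h A & y *m A = w) ->
  exists P : 'M[R]_n, forall y, l y = dot (y *m P) (y *m P).
Proof.
move=> n2 Cl l_hom l_pos l0 lh htrans.
pose V0 := [set y : 'rV[R]_n | y != 0].
have oV0 : open V0 by exact: open_punctured.
have [P [uP Ple Pmax]] := inscribed_form n2 Cl l_hom l_pos l0.
pose Q := invmx P; have QP (w : 'rV[R]_n) : w *m Q *m P = w by rewrite mulmxKV.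
have PQ (w : 'rV[R]_n) : w *m P *m Q = w by rewrite mulmxK.
have Q0 (w : 'rV[R]_n) : w != 0 -> w *m Q != 0.
  by apply: contra_neq => E; rewrite -(QP w) E mul0mx.
pose l' (w : 'rV[R]_n) := l (w *m Q).
have CQ k : Ck_on k V0 (fun w : 'rV[R]_n => w *m Q).
  by apply: Ck_on_mulmx => //; [exact: Ck_on_id|exact: Ck_on_cst].
have Cl' : Ck_on 2 V0 l' by apply: (Ck_on_comp oV0 oV0 Q0 Cl); exact: CQ.
have dl' w u : w != 0 -> 'D_u l' w = 'D_(u *m Q) l (w *m Q).
  move=> w0; have [dl _] := Cl; have [dQ _] := CQ 1%N.
  have dQE : 'D_u (fun w : 'rV[R]_n => w *m Q) w = u *m Q.
    have := is_derive_mulmx (@is_derive_id _ _ w u) (@is_derive_cst _ _ _ Q w u).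
    by rewrite mulmx0 addr0 => -[_ <-].
  have dlQ := dl _ (Q0 _ w0).
  have dl'w : differentiable l' w by case: Cl' => H _; exact: H.
  have E1 := diff_comp_at u (erefl (w *m Q)) (dQ w w0) dlQ.
  by rewrite (deriveE u dl'w) (deriveE (u *m Q) dlQ) -dQE (deriveE u (dQ w w0)); exact: E1.
have l'_hom w (t : R) : 0 < t -> l' (t *: w) = t ^+ 2 * l' w.
  by move=> t0; rewrite /l' -scalemxAl l_hom.
have l'_pos w : w != 0 -> 0 < l' w by move=> w0; exact/l_pos/Q0.
have l'0 : l' 0 = 0 by rewrite /l' mul0mx.
have l'_ge w : dot w w <= l' w by rewrite -{1 2}(QP w) Ple.
have l'_max (T : 'M[R]_n) : (forall w, dot (w *m T) (w *m T) <= l' w) -> `|\det T| <= 1.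
  move=> HT; have : `|\det (P *m T)| <= `|\det P|.
    by apply: Pmax => y; rewrite mulmxA (le_trans (HT _)) // /l' PQ.
  rewrite det_mulmx normrM ger_pMr // normr_gt0.
  by move: uP; rewrite unitmxE unitfE.
have l'_skew A w : h A -> dot w (w *m (Q *m A *m P)) = 0.
  move=> hA; apply: (extremal_skew n2 Cl' l'_hom l'0 l'_ge l'_max) => y y0.
  by rewrite dl' // mulmxA PQ !mulmxA lh ?Q0.
have l'_euler w : 'D_w l' w = 2 * l' w by apply: euler_homogeneous => t; exact: l'_hom.
have dl1 w : w != 0 -> differentiable l' w by case: Cl' => H _; exact: H.
pose f w := dot w w / l' w.
have df w v : w != 0 -> is_derive w v f 0.
  (* By Euler's relation this [a] makes [v0] tangent to the level set of [l']. The radial part of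
     [v] leaves a quotient of two functions of degree 2 unchanged. *)
  move=> w0; pose a : R := 'D_v l' w / (2 * l' w); pose v0 := v - a *: w.
  have l'w := l'_pos w w0.
  have lv0 : 'D_v0 l' w = 0.
    rewrite /v0 -scaleNr (deriveDv _ _ (dl1 w w0)) (deriveZv (- a) w (dl1 w w0)) l'_euler -[_ *: _]/(_ * _) /a.
    by field; rewrite gt_eqF.
  have [A hA EA] : exists2 A, h A & (w *m Q) *m A = v0 *m Q.
    by apply: htrans; rewrite ?Q0 // -dl'.
  have wv0 : dot w v0 = 0 by rewrite -(QP v0) -EA -(l'_skew A w hA) !mulmxA.
  have wv : dot w v = a * dot w w.
    by move: wv0; rewrite /v0 -scaleNr dotDr dotZr; lra.
  have d1 := is_derive_sqn w v; have d2 := differentiable_is_derive v (dl1 w w0).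
  have d3 : is_derive w v (fun w => (l' w)^-1) (- (l' w) ^- 2 *: 'D_v l' w).
    apply: DeriveDef; first by apply: derivableV; rewrite ?gt_eqF //; exact: diff_derivable.
    by rewrite deriveV ?gt_eqF //; exact: diff_derivable.
  have := is_deriveM d1 d3 => H; apply: (is_derive_eq H).
  rewrite -![_ *: _]/(_ * _) wv /a; field; rewrite gt_eqF //.
pose e : 'rV[R]_n := 'e_(Ordinal n2).
have e0 : e != 0 by apply/rV0Pn; exists (Ordinal n2); rewrite mxE !eqxx oner_eq0.
have fc w : w != 0 -> f w = f e.
  move=> w0; apply: (constant_punctured n2 (f := f)) => // [y y0|y v y0].
    apply: differentiableM; last by apply: differentiableV; [exact: dl1|rewrite gt_eqF ?l'_pos].
    have [+ _] : Ck_on 1 setT (fun w : 'rV[R]_n => dot w w).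
      by apply: Ck_on_dot; [exact: openT|exact: Ck_on_id|exact: Ck_on_id].
    exact.
  by have [_] := df y v y0.
have fe : 0 < f e by rewrite /f divr_gt0 ?dot_gt0 ?l'_pos.
exists ((Num.sqrt (f e))^-1 *: P) => y.
rewrite -!scalemxAr dotZl dotZr mulrA -expr2 exprVn sqr_sqrtr ?ltW //.
have [->|y0] := eqVneq y 0.
  by rewrite l0 mul0mx /dot big1 ?mulr0 // => i _; rewrite mxE mul0r.
have yP : y *m P != 0 by apply: contra_neq y0 => E; rewrite -(PQ y) E mul0mx.
have := fc _ yP; rewrite /f /l' PQ => <-.
rewrite invf_div mulfVK // gt_eqF // dot_gt0 //.
Qed.

(** A dimension count: the image of [A] lies in the hyperplane of rows killed by [b], and its rank
    is at least [n - 1] because its kernel lies in a line. *)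
Lemma kernel_image {F : fieldType} {n : nat} (A : 'M[F]_n) (b : 'cV[F]_n) (y : 'rV[F]_n) :
  b != 0 -> A *m b = 0 -> (forall u : 'rV[F]_n, u *m A = 0 -> exists a, u = a *: y) ->
  forall w : 'rV[F]_n, w *m b = 0 -> exists u, u *m A = w.
Proof.
move=> b0 Ab kerA w wb.
have sAb : (A <= kermx b)%MS by apply/sub_kermxP.
have rb : \rank b = 1.
  apply/eqP; rewrite eqn_leq rank_leq_col lt0n mxrank_eq0; exact: b0.
have ky : (kermx A <= y)%MS.
  apply/rV_subP => u /sub_kermxP /kerA[a ->]; exact: scalemx_sub.
have rA : (\rank (kermx b) <= \rank A)%N.
  have := leq_trans (mxrankS ky) (rank_leq_row y); rewrite !mxrank_ker rb.
  have := rank_leq_row A; lia.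
have := mxrank_leqif_sup sAb => -[le /esym].
rewrite eqn_leq le rA => sbA.
have /submxP[u wu] : (w <= A)%MS.
  have skb : (kermx b <= A)%MS by rewrite sbA.
  by apply: (submx_trans _ skb); apply/sub_kermxP.
by exists u.
Qed.

(** * Berwald metrics in a chart *)

Section PairCalculus.
Context {R : realType} {n : nat}.
Local Notation E := 'rV[R]_n.
Implicit Types (f : E * E -> R) (u v x y : E).

Lemma derive_fiber f x y v : 'D_v (fun z => f (x, z)) y = 'D_((0 : E, v)) f (x, y).
Proof.
rewrite /derive; set g1 := fun k => k^-1 *: _; set g2 := fun k => k^-1 *: _.
suff -> : g1 = g2 by [].
by apply/funext => k; rewrite /g1 /g2 /= -[k *: (0, v) + (x, y)]/(k *: 0 + x, k *: v + y) scaler0 add0r.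
Qed.

Lemma derive_base f x y u : 'D_u (fun z => f (z, y)) x = 'D_((u, 0 : E)) f (x, y).
Proof.
rewrite /derive; set g1 := fun k => k^-1 *: _; set g2 := fun k => k^-1 *: _.
suff -> : g1 = g2 by [].
by apply/funext => k; rewrite /g1 /g2 /= -[k *: (u, 0) + (x, y)]/(k *: u + x, k *: 0 + y) scaler0 add0r.
Qed.

Lemma differentiable_fiber f x y : differentiable f (x, y) -> differentiable (fun z => f (x, z)) y.
Proof.
move=> df; apply: (differentiable_comp (f := fun z => (x, z))) => //.
Qed.

Lemma differentiable_base f x y : differentiable f (x, y) -> differentiable (fun z => f (z, y)) x.
Proof.
move=> df; apply: (differentiable_comp (f := fun z => (z, y))) => //.
Qed.

Lemma is_derive_fiber (W : normedModType R) (g : E * E -> W) x y v dg :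
  is_derive y v (fun z => g (x, z)) dg -> is_derive (x, y) ((0, v) : E * E) g dg.
Proof.
have E1 : (fun k : R => k^-1 *: ((g \o shift (x, y)) (k *: ((0, v) : E * E)) - g (x, y))) =
    (fun k => k^-1 *: (((fun z => g (x, z)) \o shift y) (k *: v) - g (x, y))).
  by apply/funext => k; rewrite /= -[k *: (0, v) + (x, y)]/(k *: 0 + x, k *: v + y) scaler0 add0r.
by move=> [D <-]; apply: DeriveDef; rewrite /derivable /derive E1.
Qed.

Lemma is_derive_base (W : normedModType R) (g : E * E -> W) x y u dg :
  is_derive x u (fun z => g (z, y)) dg -> is_derive (x, y) ((u, 0) : E * E) g dg.
Proof.
have E1 : (fun k : R => k^-1 *: ((g \o shift (x, y)) (k *: ((u, 0) : E * E)) - g (x, y))) =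
    (fun k => k^-1 *: (((fun z => g (z, y)) \o shift x) (k *: u) - g (x, y))).
  by apply/funext => k; rewrite /= -[k *: (u, 0) + (x, y)]/(k *: u + x, k *: 0 + y) scaler0 add0r.
by move=> [D <-]; apply: DeriveDef; rewrite /derivable /derive E1.
Qed.

Lemma derive_fiberE f x y v : differentiable f (x, y) ->
  'D_((0 : E, v)) f (x, y) = \sum_j v 0 j * 'D_((0 : E, 'e_j)) f (x, y).
Proof.
move=> df; rewrite -derive_fiber deriveE_rV; last exact: differentiable_fiber.
by apply: eq_bigr => j _; rewrite derive_fiber.
Qed.

Lemma derive_baseE f x y u : differentiable f (x, y) ->
  'D_((u, 0 : E)) f (x, y) = \sum_j u 0 j * 'D_(('e_j, 0 : E)) f (x, y).
Proof.
move=> df; rewrite -derive_base deriveE_rV; last exact: differentiable_base.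
by apply: eq_bigr => j _; rewrite derive_base.
Qed.

Definition slit (U : set E) : set (E * E) := [set xy | U xy.1 /\ xy.2 != 0].

Lemma open_slit U : open U -> open (slit U).
Proof.
move=> oU; have -> : slit U = (fst @^-1` U) `&` (snd @^-1` [set y : E | y != 0]) by [].
have fc : continuous (fst : E * E -> E) by move=> z; exact: cvg_fst.
have sc : continuous (snd : E * E -> E) by move=> z; exact: cvg_snd.
apply: openI; first by move/continuousP: fc; apply.
by move/continuousP: sc; apply; exact: open_punctured.
Qed.

Lemma Ck_on_snd k (U : set (E * E)) : Ck_on k U snd.
Proof. by apply: Ck_on_linear => z; exact: cvg_snd. Qed.

Lemma Ck_on_base k U f y0 : y0 != 0 -> Ck_on k (slit U) f -> Ck_on k U (fun x => f (x, y0)).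
Proof.
move=> y00; elim: k f => [|k IH] f.
  move=> fc x Ux; apply: (continuous_comp (f := fun x => (x, y0)) (g := f)).
    by apply: differentiable_continuous.
  exact: fc.
move=> [df Df]; split=> [x Ux|u]; first by apply: differentiable_base; exact: df.
have -> : 'D_u (fun x => f (x, y0)) = fun x => ('D_((u, 0 : E)) f) (x, y0).
  by apply/funext => x; rewrite derive_base.
by apply: (IH ('D_((u, 0 : E)) f)); exact: Df.
Qed.

Lemma Ck_on_fiber k U f x0 : U x0 -> Ck_on k (slit U) f ->
  Ck_on k [set y : E | y != 0] (fun y => f (x0, y)).
Proof.
move=> Ux0; elim: k f => [|k IH] f.
  move=> fc y y0; apply: (continuous_comp (f := fun y => (x0, y)) (g := f)).
    by apply: differentiable_continuous.
  exact: fc.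
move=> [df Df]; split=> [y y0|u]; first by apply: differentiable_fiber; exact: df.
have -> : 'D_u (fun y => f (x0, y)) = fun y => ('D_((0 : E, u)) f) (x0, y).
  by apply/funext => y; rewrite derive_fiber.
by apply: (IH ('D_((0 : E, u)) f)); exact: Df.
Qed.

Lemma smooth_derive (V W : normedModType R) (U : set V) (f : V -> W) (v : V) :
  smooth_on U f -> smooth_on U ('D_v f).
Proof. by move=> Cf k; have [_ H] := Cf k.+1; exact: H. Qed.

Lemma smooth_differentiable (V W : normedModType R) (U : set V) (f : V -> W) (x : V) :
  smooth_on U f -> U x -> differentiable f x.
Proof. by move=> Cf; have [H _] := Cf 1%N; exact: H. Qed.

Section Homogeneous.
Variables (U : set E) (f : E * E -> R).
Hypothesis df : forall z, slit U z -> differentiable f z.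

Definition fiber_homogeneous (d : nat) (g : E * E -> R) :=
  forall x y (t : R), U x -> y != 0 -> 0 < t -> g (x, t *: y) = t ^+ d * g (x, y).

Lemma fiber_euler d x y : fiber_homogeneous d f -> U x -> y != 0 ->
  'D_((0 : E, y)) f (x, y) = d%:R * f (x, y).
Proof.
move=> hf Ux y0; rewrite -derive_fiber.
by apply: (@euler_homogeneous _ _ (fun z => f (x, z))) => t t0; exact: hf.
Qed.

Lemma fiber_homogeneous_base d u : fiber_homogeneous d f -> open U ->
  fiber_homogeneous d ('D_((u, 0 : E)) f).
Proof.
move=> hf oU x y t Ux y0 t0; rewrite -!derive_base.
have dfx : derivable (fun z => f (z, y)) x u by apply/diff_derivable/differentiable_base/df.
rewrite -[RHS](deriveZ (t ^+ d) dfx); apply: near_eq_derive.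
by apply: (open_near_eq oU Ux) => z Uz; exact: hf.
Qed.

Lemma fiber_homogeneous_fiber d v : fiber_homogeneous d.+1 f ->
  fiber_homogeneous d ('D_((0 : E, v)) f).
Proof.
move=> hf x y t Ux y0 t0; rewrite -!derive_fiber.
have ty0 : t *: y != 0 by rewrite scaler_eq0 negb_or gt_eqF.
have dfy : derivable (fun z => f (x, z)) y v by apply/diff_derivable/differentiable_fiber/df.
apply: (mulfI (x := t)); first by rewrite gt_eqF.
transitivity ('D_v (fun z => f (x, t *: z)) y).
  have -> : 'D_v (fun z => f (x, t *: z)) y = 'D_(t *: v) (fun z => f (x, z)) (t *: y).
    rewrite /derive; set g1 := fun k => k^-1 *: _; set g2 := fun k => k^-1 *: _.
    suff -> : g1 = g2 by [].
    apply/funext => k; rewrite /g1 /g2 /=.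
    by rewrite (_ : t *: (k *: v + y) = k *: (t *: v) + t *: y) // scalerDr !scalerA [t * k]mulrC.
  by rewrite deriveZv //; apply: differentiable_fiber; exact: df.
rewrite mulrA -exprS -[RHS](deriveZ (t ^+ d.+1) dfy); apply: near_eq_derive.
by apply: (open_near_eq open_punctured y0) => z z0; exact: hf.
Qed.

End Homogeneous.
End PairCalculus.

(* ['D_(hor u)] and ['D_(ver v)] are the derivatives [u^k d/dx^k] and
   [v^k d/dy^k]. *)
Definition hor {R : realType} {n : nat} (u : 'rV[R]_n) : 'rV[R]_n * 'rV[R]_n := (u, 0).
Definition ver {R : realType} {n : nat} (v : 'rV[R]_n) : 'rV[R]_n * 'rV[R]_n := (0, v).

(** * The linear connection of a Berwald metric and its curvature *)

Section LocalFinsler.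
Context {R : realType} {n : nat}.
Local Notation E := 'rV[R]_n.
Implicit Types (x y u v w : E) (z : E * E) (i j k m : 'I_n).
Variables (U : set E) (L : E * E -> R).
Hypothesis n2 : (2 <= n)%N.
Hypothesis oU : open U.
Local Notation O := (slit U).
Hypothesis CL : smooth_on O L.
Hypothesis L_hom : fiber_homogeneous U 2 L.
Hypothesis L_posdef : forall x y u, U x -> y != 0 -> u != 0 ->
  0 < 'D_(ver u) ('D_(ver u) L) (x, y).

Let oO : open O. Proof. exact: open_slit. Qed.

Let CD (f : E * E -> R) (w : E * E) : smooth_on O f -> smooth_on O ('D_w f).
Proof. exact: smooth_derive. Qed.

Let dS (f : E * E -> R) z : smooth_on O f -> O z -> differentiable f z.
Proof. exact: smooth_differentiable. Qed.

Let sw (f : E * E -> R) (w w' : E * E) z : smooth_on O f -> O z -> 'D_w ('D_w' f) z = 'D_w' ('D_w f) z.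
Proof. by move=> Cf Oz; apply: (schwarz w w' oO (Cf 2) Oz). Qed.

Let verE (f : E * E -> R) x y v : smooth_on O f -> O (x, y) ->
  'D_(ver v) f (x, y) = \sum_j v 0 j * 'D_(ver 'e_j) f (x, y).
Proof. by move=> Cf Oz; apply: derive_fiberE; exact: dS. Qed.

Let horE (f : E * E -> R) x y u : smooth_on O f -> O (x, y) ->
  'D_(hor u) f (x, y) = \sum_j u 0 j * 'D_(hor 'e_j) f (x, y).
Proof. by move=> Cf Oz; apply: derive_baseE; exact: dS. Qed.

Let euler (f : E * E -> R) d x y : smooth_on O f -> fiber_homogeneous U d f -> O (x, y) ->
  'D_(ver y) f (x, y) = d%:R * f (x, y).
Proof. by move=> Cf hf [Ux y0]; apply: fiber_euler hf Ux y0. Qed.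

Let hom_hor (f : E * E -> R) d u : smooth_on O f -> fiber_homogeneous U d f ->
  fiber_homogeneous U d ('D_(hor u) f).
Proof. by move=> Cf hf; apply: fiber_homogeneous_base => // z Oz; exact: dS. Qed.

Let hom_ver (f : E * E -> R) d v : smooth_on O f -> fiber_homogeneous U d.+1 f ->
  fiber_homogeneous U d ('D_(ver v) f).
Proof. by move=> Cf hf; apply: fiber_homogeneous_fiber => // z Oz; exact: dS. Qed.

(** This and [spray] restate [metric_coef] and [spray_coef] as functions of the pair, with
    directional derivatives in place of partial ones; [metric_coefE] and [spray_coefE] identify
    them. *)
Definition metric_at z : 'M[R]_n :=
  \matrix_(i, j) (2^-1 * 'D_(ver 'e_i) ('D_(ver 'e_j) L) z).

Definition spray i z : R := 4^-1 * \sum_m invmx (metric_at z) i m *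
  (\sum_k 'D_(hor 'e_k) ('D_(ver 'e_m) L) z * z.2 0 k - 'D_(hor 'e_m) L z).

Lemma ver_ver_sum x y u v : O (x, y) -> 'D_(ver u) ('D_(ver v) L) (x, y) =
  \sum_i \sum_j u 0 i * v 0 j * 'D_(ver 'e_i) ('D_(ver 'e_j) L) (x, y).
Proof.
move=> Oz; apply: (etrans (verE u (CD (ver v) CL) Oz)); apply: eq_bigr => i _.
have E1 := etrans (sw (ver 'e_i) (ver v) CL Oz) (verE v (CD (ver 'e_i) CL) Oz).
apply: (etrans (congr1 ( *%R _) E1)); rewrite mulr_sumr; apply: eq_bigr => j _.
by rewrite mulrA; apply: (congr1 ( *%R _)); exact: sw.
Qed.

Lemma metric_unit z : O z -> metric_at z \in unitmx.
Proof.
case: z => x y Oz; apply: unitmx_kernel => v vg; apply/eqP/negPn/negP => v0.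
have [Ux y0] := Oz; have := L_posdef Ux y0 v0; rewrite ver_ver_sum //.
rewrite exchange_big /= big1 ?ltxx // => j _.
transitivity (2 * (v *m metric_at (x, y)) 0 j * v 0 j); last by rewrite vg mxE mulr0 mul0r.
rewrite mxE mulr_sumr mulr_suml; apply: eq_bigr => i _; rewrite mxE.
by field.
Qed.

Lemma smooth_spray i : smooth_on O (spray i).
Proof.
move=> d; apply: Ck_onM => //; first exact: Ck_on_cst.
apply: Ck_on_sum => // m; apply: Ck_onM => //.
  apply: Ck_on_invmx => // [a b|z Oz]; last exact: metric_unit.
  apply: (Ck_on_eq oO (f := fun z => 2^-1 * 'D_(ver 'e_a) ('D_(ver 'e_b) L) z)) => [z _|].
    by rewrite mxE.
  by apply: Ck_onM => //; [exact: Ck_on_cst|exact/CD/CD].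
apply: Ck_onB => //; last exact: CD.
apply: Ck_on_sum => // k; apply: Ck_onM => //; first exact/CD/CD.
by apply: (Ck_on_mxP _ _ oO).1; exact: Ck_on_snd.
Qed.

Lemma spray_homogeneous i : fiber_homogeneous U 2 (spray i).
Proof.
move=> x y t Ux y0 t0; have t_neq0 : t != 0 by rewrite gt_eqF.
have gE : metric_at (x, t *: y) = metric_at (x, y).
  apply/matrixP => a b; apply: (etrans (mxE _ _ _ _)); apply: (etrans _ (esym (mxE _ _ _ _))).
  apply: (congr1 ( *%R _)).
  by apply: (etrans (hom_ver 'e_a (CD (ver 'e_b) CL) (hom_ver 'e_b CL L_hom) Ux y0 t0)); rewrite expr0 mul1r.
pose b z m := \sum_k 'D_(hor 'e_k) ('D_(ver 'e_m) L) z * z.2 0 k - 'D_(hor 'e_m) L z.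
have bE m : b (x, t *: y) m = t ^+ 2 * b (x, y) m.
  rewrite /b mulrBr mulr_sumr; have -> := hom_hor 'e_m CL L_hom Ux y0 t0.
  apply: (congr1 (fun a => a - t ^+ 2 * 'D_(hor 'e_m) L (x, y))); apply: eq_bigr => k _.
  have -> := hom_hor 'e_k (CD (ver 'e_m) CL) (hom_ver 'e_m CL L_hom) Ux y0 t0.
  by rewrite /= mxE; ring.
rewrite /spray gE -/(b _ _) [RHS]mulrCA.
have -> : \sum_m invmx (metric_at (x, y)) i m * b (x, t *: y) m =
    t ^+ 2 * \sum_m invmx (metric_at (x, y)) i m * b (x, y) m; last by [].
by rewrite mulr_sumr; apply: eq_bigr => m _; rewrite bE mulrCA.
Qed.

Hypothesis berwald_flat : forall i j k m z, O z ->
  'D_(ver 'e_j) ('D_(ver 'e_k) ('D_(ver 'e_m) (spray i))) z = 0.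

(** An arbitrary nonzero reference vector: by [spray_hessian] the choice does not affect the
    Christoffel symbols. *)
Let y0 : E := 'e_(Ordinal n2).
Let y0_neq0 : y0 != 0.
Proof. by apply/rV0Pn; exists (Ordinal n2); rewrite mxE !eqxx oner_eq0. Qed.

(* The Christoffel symbols, as matrices acting on row vectors: the row
   [w *m conn Gam x u] is [Gam^i_(jk) w^j u^k]. *)
Definition Gam k x : 'M[R]_n :=
  \matrix_(j, i) 'D_(ver 'e_k) ('D_(ver 'e_j) (spray i)) (x, y0).

Lemma smooth_Gam k : smooth_on U (Gam k).
Proof.
move=> d; apply/(Ck_on_mxP _ _ oU) => j i.
apply: (Ck_on_eq oU (f := fun x => 'D_(ver 'e_k) ('D_(ver 'e_j) (spray i)) (x, y0))) => [x _|].
  by rewrite mxE.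
by apply: (Ck_on_base (f := 'D_(ver 'e_k) ('D_(ver 'e_j) (spray i))) y0_neq0); exact/CD/CD/smooth_spray.
Qed.

Lemma spray_hessian i j k x y : O (x, y) ->
  'D_(ver 'e_k) ('D_(ver 'e_j) (spray i)) (x, y) = Gam k x j i.
Proof.
move=> [Ux y_neq0]; rewrite mxE; pose f : E * E -> R := 'D_(ver 'e_k) ('D_(ver 'e_j) (spray i)).
have Cf : smooth_on O f by exact/CD/CD/smooth_spray.
rewrite -[LHS]/((fun y => f (x, y)) y) -[RHS]/((fun y => f (x, y)) y0).
apply: (constant_punctured n2 (f := fun y => f (x, y))) => //.
  by move=> w w0; apply: differentiable_fiber; exact: dS.
move=> w v w0; rewrite derive_fiber -/(ver v) verE // big1 // => m _.
by rewrite berwald_flat ?mulr0.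
Qed.

Lemma conn_entry x u w i : (w *m conn Gam x u) 0 i = \sum_j w 0 j * \sum_k u 0 k * Gam k x j i.
Proof.
rewrite mxE; apply: eq_bigr => j _; congr (_ * _).
by rewrite /conn summxE; apply: eq_bigr => k _; rewrite mxE.
Qed.

Lemma spray_hessianE i x y u w : O (x, y) ->
  'D_(ver u) ('D_(ver w) (spray i)) (x, y) = (w *m conn Gam x u) 0 i.
Proof.
move=> Oz; have CG := smooth_spray i.
rewrite (sw _ _ CG Oz) (verE w (CD _ CG) Oz) conn_entry; apply: eq_bigr => j _.
rewrite (sw _ _ CG Oz) (verE u (CD _ CG) Oz); congr (_ * _); apply: eq_bigr => k _.
by rewrite spray_hessian.
Qed.

Lemma Gam_torsion_free x u w : U x -> w *m conn Gam x u = u *m conn Gam x w.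
Proof.
move=> Ux; have Oz : O (x, y0) by [].
apply/rowP => i; rewrite -(@spray_hessianE i x y0 u w Oz) -(@spray_hessianE i x y0 w u Oz).
exact: (sw (ver u) (ver w) (smooth_spray i) Oz).
Qed.

(** Euler's relation for the first derivative of the spray, which has degree 1. Applied again to the
    spray, of degree 2, it produces [sprayE]. *)
Lemma spray_derive i x y w : O (x, y) -> 'D_(ver w) (spray i) (x, y) = (w *m conn Gam x y) 0 i.
Proof.
move=> Oz; have CG := smooth_spray i.
have h1 := hom_ver w CG (spray_homogeneous i).
rewrite -(@spray_hessianE i x y y w Oz).
by have := euler (CD (ver w) CG) h1 Oz; rewrite mul1r.
Qed.

Lemma sprayE i x y : O (x, y) -> spray i (x, y) = 2^-1 * (y *m conn Gam x y) 0 i.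
Proof.
move=> Oz; rewrite -spray_derive // (euler (smooth_spray i) (spray_homogeneous i) Oz).
by rewrite mulrA mulVf ?mul1r // pnatr_eq0.
Qed.

(** The product rule when the direction of differentiation moves with the point; [inj] stands for
    [ver] or [hor]. *)
Lemma derive_moving (inj : E -> E * E) (f : E * E -> R) (w : E * E -> E) z d dw :
  (forall g z v, smooth_on O g -> O z -> 'D_(inj v) g z = \sum_j v 0 j * 'D_(inj 'e_j) g z) ->
  smooth_on O f -> O z -> is_derive z d w dw ->
  is_derive z d (fun z => 'D_(inj (w z)) f z)
    ('D_(inj dw) f z + 'D_d ('D_(inj (w z)) f) z).
Proof.
move=> inj_sum Cf Oz /is_derive_mxP Hw.
pose g z := \sum_j w z 0 j * 'D_(inj 'e_j) f z.
have Hg : is_derive z d g (\sum_j (w z 0 j * 'D_d ('D_(inj 'e_j) f) z + dw 0 j * 'D_(inj 'e_j) f z)).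
  apply: is_derive_bigsum => j; have d1 := Hw 0 j.
  have d2 : is_derive z d ('D_(inj 'e_j) f) ('D_d ('D_(inj 'e_j) f) z).
    by apply: differentiable_is_derive; apply: dS => //; exact: CD.
  by apply: (is_derive_eq (is_deriveM d1 d2)); rewrite -![_ *: _]/(_ * _) [dw 0 j * _]mulrC.
have -> : 'D_(inj dw) f z + 'D_d ('D_(inj (w z)) f) z =
    \sum_j (w z 0 j * 'D_d ('D_(inj 'e_j) f) z + dw 0 j * 'D_(inj 'e_j) f z).
  have E1 := etrans (sw d (inj (w z)) Cf Oz) (inj_sum _ _ (w z) (CD d Cf) Oz).
  apply: (etrans (congr2 +%R (inj_sum _ _ dw Cf Oz) E1)).
  rewrite -big_split /=; apply: eq_bigr => j _; rewrite addrC.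
  by apply: (congr1 (fun a => w z 0 j * a + _)); exact: sw.
have gE : \forall y \near z, g y = 'D_(inj (w y)) f y.
  by apply: (open_near_eq oO Oz) => y Oy; rewrite (inj_sum _ _ _ Cf Oy).
by apply: near_eq_is_derive Hg.
Qed.

Let verE' (f : E * E -> R) z v : smooth_on O f -> O z ->
  'D_(ver v) f z = \sum_j v 0 j * 'D_(ver 'e_j) f z.
Proof. by case: z => x y; exact: verE. Qed.

Let horE' (f : E * E -> R) z u : smooth_on O f -> O z ->
  'D_(hor u) f z = \sum_j u 0 j * 'D_(hor 'e_j) f z.
Proof. by case: z => x y; exact: horE. Qed.

(* The defining property of the spray, contracted with [u]. *)
Lemma spray_metric x y u : O (x, y) ->
  'D_(ver u) ('D_(ver (y *m conn Gam x y)) L) (x, y) =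
  'D_(hor y) ('D_(ver u) L) (x, y) - 'D_(hor u) L (x, y).
Proof.
move=> Oz.
pose b m := \sum_k 'D_(hor 'e_k) ('D_(ver 'e_m) L) (x, y) * y 0 k - 'D_(hor 'e_m) L (x, y).
have gG i : \sum_m metric_at (x, y) i m * spray m (x, y) = 4^-1 * b i.
  pose bc := \col_m b m.
  transitivity (4^-1 * (metric_at (x, y) *m (invmx (metric_at (x, y)) *m bc)) i 0).
    rewrite mxE mulr_sumr; apply: eq_bigr => m _; rewrite mxE /spray mulrCA; apply: (congr1 ( *%R _)).
    by apply: (congr1 ( *%R _)); rewrite [RHS]mxE; apply: eq_bigr => k _; rewrite /bc [(\col__ _) _ _]mxE.
  by rewrite mulKVmx ?metric_unit // mxE.
apply: (etrans _ (esym (congr2 (fun p q => p - q) (horE y (CD (ver u) CL) Oz) (horE u CL Oz)))).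
transitivity (\sum_i u 0 i * b i); last first.
  rewrite /b (eq_bigr (fun i => u 0 i * (\sum_k 'D_(hor 'e_k) ('D_(ver 'e_i) L) (x, y) * y 0 k)
     - u 0 i * 'D_(hor 'e_i) L (x, y))) => [|i _]; last by rewrite mulrBr.
  rewrite sumrB; apply: (congr1 (fun a => a - _)).
  rewrite (eq_bigr _ (fun i _ => mulr_sumr _ _ _ _)) exchange_big /=; apply: eq_bigr => k _.
  have E1 := etrans (sw (hor 'e_k) (ver u) CL Oz) (verE u (CD (hor 'e_k) CL) Oz).
  apply: (etrans _ (esym (congr1 ( *%R _) E1))); rewrite mulr_sumr; apply: eq_bigr => i _.
  have E2 := sw (hor 'e_k) (ver 'e_i) CL Oz.
  by apply: (etrans (congr1 (fun a => u 0 i * (a * y 0 k)) E2)); rewrite mulrA mulrC.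
rewrite ver_ver_sum //; apply: eq_bigr => i _.
have -> : b i = 4 * (4^-1 * b i) by rewrite mulrA mulfV ?mul1r // pnatr_eq0.
rewrite -gG !mulr_sumr; apply: eq_bigr => m _; rewrite sprayE // [metric_at _ _ _]mxE.
by field.
Qed.

(** Taking [u = y] in [spray_metric], Euler's relation removes one derivative on each side: fibre
    derivatives of [L] have degree 1, and [L] has degree 2. *)
Lemma spray_metric_contracted x y : O (x, y) ->
  'D_(ver (y *m conn Gam x y)) L (x, y) = 'D_(hor y) L (x, y).
Proof.
move=> Oz; set c := y *m _.
have E1 : 'D_(ver y) ('D_(ver c) L) (x, y) = 'D_(ver c) L (x, y).
  by have := euler (CD (ver c) CL) (hom_ver c CL L_hom) Oz; rewrite mul1r.
have E2 : 'D_(hor y) ('D_(ver y) L) (x, y) = 2 * 'D_(hor y) L (x, y).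
  by rewrite (sw (hor y) (ver y) CL Oz) (euler (CD (hor y) CL) (hom_hor y CL L_hom) Oz).
by rewrite -E1 (spray_metric y Oz) E2; ring.
Qed.

Lemma derive_conn_fiber x y u d :
  is_derive (x, y) (ver d) (fun z : E * E => z.2 *m conn Gam z.1 u) (d *m conn Gam x u).
Proof.
apply: is_derive_fiber.
have := is_derive_mulmx (@is_derive_id _ _ y d) (@is_derive_cst _ _ _ (conn Gam x u) y d).
by rewrite mulmx0 addr0.
Qed.

Lemma derive_conn_base x y u d : U x ->
  is_derive (x, y) (hor d) (fun z : E * E => z.2 *m conn Gam z.1 u) (y *m dconn Gam x d u).
Proof.
move=> Ux; apply: is_derive_base.
have := is_derive_mulmx (@is_derive_cst _ _ _ y x d) (conn_derive (fun k => smooth_Gam k 2) d u Ux).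
by rewrite mul0mx add0r.
Qed.

(** The vector occurs twice, and torsion-freeness makes both contributions equal. *)
Lemma derive_conn_diag x y d : U x ->
  is_derive (x, y) (ver d) (fun z : E * E => z.2 *m conn Gam z.1 z.2) (2 *: (d *m conn Gam x y)).
Proof.
move=> Ux; apply: is_derive_fiber.
have dc : is_derive y d (conn Gam x) (conn Gam x d).
  apply: is_derive_bigsum => k.
  have /is_derive_mxP/(_ 0 k) d1 := @is_derive_id _ _ y d.
  have := is_derive_scale d1 (@is_derive_cst _ _ _ (Gam k x) y d).
  by rewrite scaler0 addr0.
have := is_derive_mulmx (@is_derive_id _ _ y d) dc.
by rewrite -(Gam_torsion_free d y Ux) scaler_nat mulr2n.
Qed.

Let cancel_half (a b c : R) : 2 * b + (c - a) = a + c -> a = b.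
Proof. lra. Qed.

(* Differentiates the contracted spray identity along the fibre and subtracts
   the uncontracted one. *)
Lemma horizontal_invariance x y u : O (x, y) ->
  'D_(hor u) L (x, y) = 'D_(ver (y *m conn Gam x u)) L (x, y).
Proof.
move=> Oz; have [Ux y_neq0] := Oz.
have d1 := derive_moving verE' CL Oz (derive_conn_diag y u Ux).
have d2 : is_derive (x, y) (ver u) (fun z : E * E => z.2) u.
  by apply: is_derive_fiber; exact: is_derive_id.
have {}d2 := derive_moving horE' CL Oz d2.
have E : \forall z \near (x, y), 'D_(ver (z.2 *m conn Gam z.1 z.2)) L z = 'D_(hor z.2) L z.
  by apply: (open_near_eq oO Oz) => -[x' y'] Oz'; exact: spray_metric_contracted.
have {}E : 'D_(ver (2 *: (u *m conn Gam x y))) L (x, y) +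
    'D_(ver u) ('D_(ver (y *m conn Gam x y)) L) (x, y) =
    'D_(hor u) L (x, y) + 'D_(ver u) ('D_(hor y) L) (x, y).
  by have [_ <-] := d1; have [_ <-] := d2; exact: near_eq_derive E.
have E1 := spray_metric u Oz; have E2 := sw (hor y) (ver u) CL Oz.
have {}E1 := etrans E1 (congr1 (fun a => a - _) E2).
have {E1}E := etrans (esym (congr1 (+%R _) E1)) E.
rewrite -[y *m conn Gam x u](Gam_torsion_free y u Ux); move: E.
have -> : 'D_(ver (2 *: (u *m conn Gam x y))) L (x, y) = 2 * 'D_(ver (u *m conn Gam x y)) L (x, y).
  rewrite (verE _ CL Oz) (verE (u *m conn Gam x y) CL Oz) mulr_sumr.
  by apply: eq_bigr => j _; rewrite mxE mulrA.
exact: cancel_half.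
Qed.

(** The row [y *m Rm x u v] holds the components of the curvature operator applied to [y]; products
    appear reversed because matrices act from the right. *)
Definition Rm x u v : 'M[R]_n := dconn Gam x u v - dconn Gam x v u +
  (conn Gam x v *m conn Gam x u - conn Gam x u *m conn Gam x v).

Let verB (f : E * E -> R) z v w : smooth_on O f -> O z ->
  'D_(ver (v - w)) f z = 'D_(ver v) f z - 'D_(ver w) f z.
Proof.
move=> Cf Oz; rewrite !(verE' _ Cf Oz) -sumrB; apply: eq_bigr => j _.
by rewrite !mxE mulrBl.
Qed.

Let verD (f : E * E -> R) z v w : smooth_on O f -> O z ->
  'D_(ver (v + w)) f z = 'D_(ver v) f z + 'D_(ver w) f z.
Proof.
move=> Cf Oz; rewrite !(verE' _ Cf Oz) -big_split; apply: eq_bigr => j _.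
by rewrite !mxE mulrDl.
Qed.

(** [horizontal_invariance] is used twice, the second time after moving the fibre derivative
    outside. The last term is symmetric in [u] and [v], so it drops out of the commutator. *)
Lemma horizontal_second_derivative x y u v : O (x, y) ->
  'D_(hor v) ('D_(hor u) L) (x, y) =
  'D_(ver (y *m dconn Gam x v u + y *m conn Gam x u *m conn Gam x v)) L (x, y) +
  'D_(ver (y *m conn Gam x u)) ('D_(ver (y *m conn Gam x v)) L) (x, y).
Proof.
move=> Oz; have [Ux y_neq0] := Oz; set w := y *m conn Gam x u.
have near_inv d : \forall z \near (x, y), 'D_(hor d) L z = 'D_(ver (z.2 *m conn Gam z.1 d)) L z.
  by apply: (open_near_eq oO Oz) => -[x' y'] Oz'; exact: horizontal_invariance.
have d1 := derive_moving verE' CL Oz (derive_conn_base y u v Ux).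
have d2 := derive_moving verE' CL Oz (derive_conn_fiber x y v w).
have E1 : 'D_(hor v) ('D_(hor u) L) (x, y) =
    'D_(ver (y *m dconn Gam x v u)) L (x, y) + 'D_(hor v) ('D_(ver w) L) (x, y).
  by have [_ <-] := d1; exact: near_eq_derive (near_inv u).
have E2 : 'D_(ver w) ('D_(hor v) L) (x, y) =
    'D_(ver (w *m conn Gam x v)) L (x, y) + 'D_(ver w) ('D_(ver (y *m conn Gam x v)) L) (x, y).
  by have [_ <-] := d2; exact: near_eq_derive (near_inv v).
have E3 := sw (hor v) (ver w) CL Oz.
have E4 := verD (y *m dconn Gam x v u) (w *m conn Gam x v) CL Oz.
apply: (etrans E1); apply: (etrans (congr1 (+%R _) (etrans E3 E2))).
by rewrite addrA; apply: (congr1 (fun a => a + _) (esym E4)).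
Qed.

Lemma curvature_invariance x y u v : O (x, y) -> 'D_(ver (y *m Rm x u v)) L (x, y) = 0.
Proof.
move=> Oz.
have E1 := horizontal_second_derivative u v Oz; have E2 := horizontal_second_derivative v u Oz.
have E3 := sw (hor u) (hor v) CL Oz.
have E4 := sw (ver (y *m conn Gam x v)) (ver (y *m conn Gam x u)) CL Oz.
have {E1 E2 E3}E5 := etrans (esym E2) (etrans E3 E1).
move: E5; move/(etrans (esym (congr1 (+%R _) E4))); move/addIr => E.
have -> : y *m Rm x u v = y *m dconn Gam x u v + y *m conn Gam x v *m conn Gam x u -
    (y *m dconn Gam x v u + y *m conn Gam x u *m conn Gam x v).
  by rewrite /Rm mulmxDr !mulmxBr !mulmxA opprD addrACA.
by apply: (etrans (verB _ _ CL Oz)); apply/eqP; rewrite subr_eq0; apply/eqP.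
Qed.

Lemma Rm_anti x u v : Rm x v u = - Rm x u v.
Proof. by rewrite /Rm opprD !opprB. Qed.

Lemma Rm_sum x u v : U x -> Rm x u v = \sum_k u 0 k *: Rm x 'e_k v.
Proof.
move=> Ux; have e_sum (G : 'I_n -> 'M[R]_n) k : \sum_i ('e_k : E) 0 i *: G i = G k.
  rewrite (bigD1 k) //= mxE !eqxx scale1r big1 ?addr0 // => i /negPf ik.
  by rewrite mxE eqxx ik scale0r.
have cE k : conn Gam x 'e_k = Gam k x by exact: e_sum.
have dE k : dconn Gam x v 'e_k = 'D_v (Gam k) x by exact: e_sum.
have E k : u 0 k *: Rm x 'e_k v = u 0 k *: dconn Gam x 'e_k v - u 0 k *: 'D_v (Gam k) x +
    (conn Gam x v *m (u 0 k *: Gam k x) - (u 0 k *: Gam k x) *m conn Gam x v).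
  by rewrite /Rm cE dE scalerDr !scalerBr -scalemxAr -scalemxAl.
rewrite (eq_bigr _ (fun k _ => E k)) big_split !sumrB /=.
by rewrite -mulmx_sumr -mulmx_suml -(dconn_sum (fun k => smooth_Gam k 2)).
Qed.

Lemma RmDl x u u' v : U x -> Rm x (u + u') v = Rm x u v + Rm x u' v.
Proof.
move=> Ux; rewrite !(Rm_sum _ v Ux) -big_split; apply: eq_bigr => k _.
by rewrite mxE scalerDl.
Qed.

Let mxE_sum4 (a b c d : E) i : (a - b + (c - d)) 0 i = a 0 i - b 0 i + c 0 i - d 0 i.
Proof. by rewrite !mxE addrA. Qed.

(* The contraction with [u] of the components of the Riemann curvature. *)
Lemma riemann_spray i x y u : O (x, y) ->
  2 * 'D_(hor u) (spray i) (x, y)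
  - \sum_j 'D_(hor 'e_j) ('D_(ver u) (spray i)) (x, y) * y 0 j
  + 2 * \sum_j spray j (x, y) * 'D_(ver 'e_j) ('D_(ver u) (spray i)) (x, y)
  - \sum_j 'D_(ver 'e_j) (spray i) (x, y) * 'D_(ver u) (spray j) (x, y) = (y *m Rm x u y) 0 i.
Proof.
move=> Oz; have [Ux y_neq0] := Oz; have CG := smooth_spray i.
have E1 : 2 * 'D_(hor u) (spray i) (x, y) = (y *m dconn Gam x u y) 0 i.
  have /is_derive_mxP/(_ 0 i) d1 := derive_conn_base y y u Ux.
  rewrite -(@derive_val _ _ _ _ _ _ _ d1) -!derive_base.
  rewrite -[2 * _]/(2 *: _) -deriveZ; last exact/diff_derivable/differentiable_base/dS.
  apply: near_eq_derive; apply: (open_near_eq oU Ux) => x' Ux'; rewrite /= sprayE //.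
  by rewrite -[_ *: _]/(_ * _) mulrA mulfV ?mul1r // pnatr_eq0.
have E2 : \sum_j 'D_(hor 'e_j) ('D_(ver u) (spray i)) (x, y) * y 0 j = (y *m dconn Gam x y u) 0 i.
  have /is_derive_mxP/(_ 0 i) d1 := derive_conn_base y u y Ux.
  transitivity ('D_(hor y) ('D_(ver u) (spray i)) (x, y)).
    by rewrite (horE y (CD _ CG) Oz); apply: eq_bigr => j _; rewrite mulrC.
  rewrite -(@derive_val _ _ _ _ _ _ _ d1); apply: near_eq_derive.
  apply: (open_near_eq oO Oz) => -[x' y'] Oz'; have [Ux' _] := Oz'.
  by rewrite spray_derive //= (Gam_torsion_free y' u Ux').
have E3 : 2 * \sum_j spray j (x, y) * 'D_(ver 'e_j) ('D_(ver u) (spray i)) (x, y) =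
    (y *m conn Gam x y *m conn Gam x u) 0 i.
  have Gu := Gam_torsion_free u (y *m conn Gam x y) Ux; rewrite Gu.
  rewrite -(spray_hessianE i (y *m conn Gam x y) u Oz) (verE _ (CD _ CG) Oz) mulr_sumr.
  apply: eq_bigr => j _; rewrite sprayE // !mulrA mulfV ?mul1r // pnatr_eq0 //.
have E4 : \sum_j 'D_(ver 'e_j) (spray i) (x, y) * 'D_(ver u) (spray j) (x, y) =
    (y *m conn Gam x u *m conn Gam x y) 0 i.
  rewrite -(Gam_torsion_free y u Ux) -(spray_derive i _ Oz) (verE _ CG Oz).
  by apply: eq_bigr => j _; rewrite (spray_derive j u Oz) mulrC.
rewrite E1 E2 E3 E4 /Rm mulmxDr !mulmxBr !mulmxA.
exact: esym (mxE_sum4 _ _ _ _ _).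
Qed.

(** Euler's relation applied twice gives [2 L] for the second derivative along [y], which is
    positive by hypothesis. *)
Lemma fiber_gt0 x y : O (x, y) -> 0 < L (x, y).
Proof.
move=> Oz; have [Ux y_neq0] := Oz; have := L_posdef Ux y_neq0 y_neq0.
have E1 := euler (CD (ver y) CL) (hom_ver y CL L_hom) Oz.
have E2 := euler CL L_hom Oz.
by rewrite E1 E2 mul1r pmulr_rgt0 // ltr0n.
Qed.

(** [kernel_image] with [A] the matrix of [u |-> y *m Rm x u y] and [b] the fibre gradient of [L].
    Invariance gives [A b = 0], and [b] is nonzero because the derivative along [y] is [2 L > 0]. *)
Lemma curvature_transitive x y w : O (x, y) ->
  (forall u, (forall a : R, u <> a *: y) -> y *m Rm x u y <> 0) ->
  'D_(ver w) L (x, y) = 0 -> exists u, y *m Rm x u y = w.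
Proof.
move=> Oz R_neq0 Dw; have [Ux y_neq0] := Oz.
pose A : 'M[R]_n := \matrix_(k, j) (y *m Rm x 'e_k y) 0 j.
have AE u : u *m A = y *m Rm x u y.
  rewrite (Rm_sum u y Ux) mulmx_sumr; apply/rowP => j; rewrite mxE summxE.
  by apply: eq_bigr => k _; rewrite mxE -scalemxAr [RHS]mxE.
pose b : 'cV[R]_n := \col_j 'D_(ver 'e_j) L (x, y).
have bE u : (u *m b) 0 0 = 'D_(ver u) L (x, y).
  by rewrite mxE (verE u CL Oz); apply: eq_bigr => j _; rewrite mxE.
have b0 : b != 0.
  apply/eqP => E; have := fiber_gt0 Oz; have E2 := euler CL L_hom Oz.
  by move: E2; rewrite -bE E mulmx0 mxE => /esym/eqP; rewrite mulf_eq0 pnatr_eq0 /= => /eqP ->; rewrite ltxx.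
have [u <-] : exists u, u *m A = w; last by exists u; rewrite AE.
apply: (kernel_image (b := b) (y := y)) => //.
- apply/row_matrixP => k; rewrite row_mul row0.
  have -> : row k A = y *m Rm x 'e_k y by rewrite -AE rowE.
  by apply/rowP => j; rewrite !ord1 bE (curvature_invariance 'e_k y Oz) mxE.
- move=> u; rewrite AE => E; apply: contrapT => nu; apply: (R_neq0 u) => // a ua.
  by apply: nu; exists a.
- by apply/matrixP => i j; rewrite !ord1 bE Dw mxE.
Qed.

Definition gform x y u v : R := 2^-1 * 'D_(ver u) ('D_(ver v) L) (x, y).

Section FundamentalForm.
Variables x y : E.
Hypothesis Oz : O (x, y).
Local Notation g := (gform x y).

Lemma gformC u v : g u v = g v u.
Proof. exact: (congr1 ( *%R _) (sw (ver u) (ver v) CL Oz)). Qed.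

Let derZ (f : E * E -> R) (a : R) v w : smooth_on O f ->
  'D_(ver (a *: v + w)) f (x, y) = a * 'D_(ver v) f (x, y) + 'D_(ver w) f (x, y).
Proof.
move=> Cf; apply: (etrans (verE _ Cf Oz)).
apply: (etrans _ (esym (congr2 (fun p q => a * p + q) (verE v Cf Oz) (verE w Cf Oz)))).
rewrite mulr_sumr -big_split; apply: eq_bigr => j _.
by rewrite !mxE mulrDl -mulrA.
Qed.

Lemma gform_linear (a : R) u v w : g (a *: u + v) w = a * g u w + g v w.
Proof.
apply: (etrans (congr1 ( *%R _) (derZ a u v (CD (ver w) CL)))).
by rewrite mulrDr mulrCA.
Qed.

Lemma gformDl u v w : g (u + v) w = g u w + g v w.
Proof. by rewrite -[u in LHS]scale1r gform_linear mul1r. Qed.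

Lemma gformDr u v w : g w (u + v) = g w u + g w v.
Proof. by rewrite gformC gformDl !(gformC w). Qed.

Lemma gformZl (a : R) u w : g (a *: u) w = a * g u w.
Proof.
have g0 : g 0 w = 0.
  by apply: (addrI (g 0 w)); rewrite addr0 -gformDl addr0.
by rewrite -[a *: u]addr0 gform_linear g0 addr0.
Qed.

Lemma gform_gt0 u : u != 0 -> 0 < g u u.
Proof. by move=> u0; have [Ux y_neq0] := Oz; rewrite mulr_gt0 ?invr_gt0 ?L_posdef. Qed.

Lemma gform_cauchy_schwarz u v : u != 0 -> (forall a : R, v <> a *: u) ->
  0 < g u u * g v v - g u v ^+ 2.
Proof.
(* [z] is [g u u] times the component of [v] orthogonal to [u], so [g z z] is [g u u] times the Gram
   determinant. *)
move=> u0 uv; have gu := gform_gt0 u0; pose z := g u u *: v + (- g u v) *: u.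
have z0 : z != 0.
  apply/eqP => E0; apply: (uv (g u v / g u u)); apply: (scalerI (a := g u u)).
    by rewrite gt_eqF.
  rewrite scalerA mulrC divfK ?gt_eqF //; apply/eqP; rewrite -subr_eq0 -scaleNr.
  exact/eqP.
have := gform_gt0 z0; have -> : g z z = g u u * (g u u * g v v - g u v ^+ 2).
  rewrite /z !gform_linear !gformZl (gformC v) (gformC u (_ + _)) !gform_linear !gformZl (gformC v u).
  by move: (g u u) (g u v) (g v v) => p q r; ring.
by rewrite pmulr_rgt0.
Qed.

(** [curvature_invariance] differentiated in the fibre along [z]; Euler's relation then rewrites the
    remaining first derivative of [L] as a value of the form against [y]. *)
Lemma gform_curvature (a b z : E) : g z (y *m Rm x a b) + g y (z *m Rm x a b) = 0.
Proof.
have [Ux y_neq0] := Oz; pose l := fun v => L (x, v).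
have Cl : Ck_on 2 [set v : E | v != 0] l by apply: (Ck_on_fiber Ux (CL 2)).
have Dl v : 'D_v l = fun w => 'D_(ver v) L (x, w) by apply/funext => w; rewrite derive_fiber.
have lR v : v != 0 -> 'D_(v *m Rm x a b) l v = 0.
  by move=> v0; apply: (etrans (derive_fiber L x v (v *m Rm x a b))); apply: curvature_invariance.
have := derive_linear_field (A := Rm x a b) z open_punctured Cl y_neq0 lR.
have E0 : 'D_z ('D_(y *m Rm x a b) l) y = 'D_(ver z) ('D_(ver (y *m Rm x a b)) L) (x, y).
  by rewrite Dl; exact: derive_fiber.
move/(etrans (congr2 +%R (esym E0) (esym (derive_fiber L x y (z *m Rm x a b))))) => H; rewrite /gform.
have E1 := euler (CD (ver (z *m Rm x a b)) CL) (hom_ver (z *m Rm x a b) CL L_hom) Oz.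
apply: (etrans (congr1 (fun p => _ + 2^-1 * p) E1)); rewrite mul1r -mulrDr.
by apply: (etrans (congr1 ( *%R _) H)); rewrite mulr0.
Qed.

Lemma gform_radial_curvature (a b : E) : g y (y *m Rm x a b) = 0.
Proof. by have := gform_curvature a b y; lra. Qed.

Lemma dconn_torsion_free u v w : w *m dconn Gam x u v = v *m dconn Gam x u w.
Proof.
have [Ux y_neq0] := Oz.
have c (w' v' : E) := is_derive_mulmx (@is_derive_cst _ _ _ w' x u) (conn_derive (fun k => smooth_Gam k 2) u v' Ux).
have := near_eq_derive u (open_near_eq oU Ux (fun x' Ux' => Gam_torsion_free v w Ux')).
have [_ ->] := c w v; have [_ ->] := c v w.
by rewrite !mul0mx !add0r.
Qed.

Let cyclic_cancel (a1 a1' a2 a2' a3 a3' b1 b1' b2 b2' b3 b3' : E) :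
  a1 = a1' -> a2 = a2' -> a3 = a3' -> b1 = b1' -> b2 = b2' -> b3 = b3' ->
  a1 - a2 + (b1 - b2) + (a2' - a3 + (b2' - b3)) + (a3' - a1' + (b3' - b1')) = 0.
Proof.
move=> -> -> -> -> -> ->; apply/rowP => i; rewrite !mxE.
ring.
Qed.

(** The first Bianchi identity: torsion-freeness and its derivative match the twelve terms in
    cancelling pairs. *)
Lemma bianchi u v w : w *m Rm x u v + u *m Rm x v w + v *m Rm x w u = 0.
Proof.
have [Ux y_neq0] := Oz.
have RE (a b c : E) : a *m Rm x b c = a *m dconn Gam x b c - a *m dconn Gam x c b +
    (a *m conn Gam x c *m conn Gam x b - a *m conn Gam x b *m conn Gam x c).
  by rewrite /Rm mulmxDr !mulmxBr !mulmxA.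
have cE a b c : a *m conn Gam x b *m conn Gam x c = b *m conn Gam x a *m conn Gam x c.
  by rewrite (Gam_torsion_free b a Ux).
rewrite !RE.
exact: (cyclic_cancel (dconn_torsion_free u v w) (dconn_torsion_free v u w) (dconn_torsion_free w v u)
  (cE w v u) (cE w u v) (cE u v w)).
Qed.

(** The Bianchi identity for [u], [y], [v] is paired with [y]. One term vanishes by
    [gform_radial_curvature]; [gform_curvature] turns the other two into the two sides. *)
Lemma gform_jacobi_sym u v : g v (y *m Rm x u y) = g u (y *m Rm x v y).
Proof.
have gN (a b : E) : g a (- b) = - g a b by rewrite -scaleN1r gformC gformZl mulN1r gformC.
have E1 := gform_curvature u y v; have E2 := gform_curvature v y u.
have := congr1 (g y) (bianchi u y v).
rewrite !gformDr gform_radial_curvature addr0 (Rm_anti x v y) mulmxN gN.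
have -> : g y 0 = 0 by rewrite -(scale0r 0) gformC gformZl mul0r.
move: E1 E2; move: (g v _) (g u _) (g y _) (g y _) => p q r s; lra.
Qed.

(** Polarisation of a self-adjoint operator: evaluating the vanishing form at [u + v], with [v] the
    image of [u], leaves [2 g v v = 0]. *)
Lemma jacobi_eq0 : (forall u, g u (y *m Rm x u y) = 0) -> forall u, y *m Rm x u y = 0.
Proof.
move=> H u; set v := y *m Rm x u y; apply/eqP/negPn/negP => v0.
have [Ux y_neq0] := Oz.
have E1 : g v v = g u (y *m Rm x v y) by exact: gform_jacobi_sym u v.
have E2 : g u v = 0 by exact: H u.
have := H (u + v); rewrite (RmDl u v y Ux) mulmxDr gformDl !gformDr (H v) -/v E2 -E1 add0r addr0 => E3.
have := gform_gt0 v0; rewrite -[g v v]addr0 -[X in _ + X](subrr (g v v)) addrA E3 add0r oppr_gt0.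
by move=> /lt_trans/(_ (gform_gt0 v0)); rewrite ltxx.
Qed.
End FundamentalForm.

(** Polarising in [y] makes [a *m Rm x b c] antisymmetric in [a] and [c]. It is also antisymmetric
    in [b] and [c], so the three Bianchi terms are equal and three times each vanishes. *)
Lemma curvature_eq0 x : U x -> (forall y u, y *m Rm x u y = 0) -> forall u v, Rm x u v = 0.
Proof.
move=> Ux H; have Oz : O (x, y0) by [].
have anti (a b c : E) : a *m Rm x b c = - (c *m Rm x b a).
  have := H (a + c) b; have -> : Rm x b (a + c) = Rm x b a + Rm x b c.
    by rewrite !(Rm_anti x _ b) (RmDl a c b Ux) opprD.
  rewrite mulmxDl (mulmxDr a) (mulmxDr c) (H a b) (H c b) add0r addr0 => /eqP; rewrite addr_eq0 => /eqP.
  by [].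
move=> u v; apply/row_matrixP => i; rewrite row0 rowE; set w := 'e_i.
have := bianchi Oz u v w.
have -> : u *m Rm x v w = w *m Rm x u v by rewrite anti (Rm_anti x u v) mulmxN opprK.
have -> : v *m Rm x w u = w *m Rm x u v by rewrite (Rm_anti x u w) mulmxN [in LHS]anti opprK.
move=> E3; have /eqP : (w *m Rm x u v) *+ 3 = 0 by rewrite !mulrS mulr0n addr0 addrA.
by rewrite -scaler_nat scaler_eq0 pnatr_eq0 /= => /eqP.
Qed.

Theorem fiber_quadratic x : U x -> L (x, 0) = 0 ->
  (forall y u, y != 0 -> (forall a : R, u <> a *: y) -> gform x y u (y *m Rm x u y) <> 0) ->
  exists P : 'M[R]_n, forall y, L (x, y) = dot (y *m P) (y *m P).
Proof.
move=> Ux Lx0 R_neq0.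
pose h := [set A : 'M[R]_n | forall y : E, y != 0 -> 'D_(y *m A) (fun v => L (x, v)) y = 0].
apply: (transitive_isometries_quadratic (l := fun y => L (x, y)) (h := h)) => //.
- by apply: (Ck_on_fiber Ux (CL 2)).
- move=> y t t0; have [->|y_neq0] := eqVneq y 0; first by rewrite scaler0 Lx0 mulr0.
  exact: L_hom.
- by move=> y y_neq0; exact: fiber_gt0.
move=> y w y_neq0; rewrite derive_fiber => Dw; have Oz : O (x, y) by [].
have [|u yu] := curvature_transitive Oz _ Dw.
  move=> u uy Ru; apply: (R_neq0 y u) => //; rewrite Ru (gformC Oz) -(scale0r 0) gformZl //.
  by rewrite mul0r.
exists (Rm x u y) => // z z0; rewrite derive_fiber; exact: curvature_invariance.
Qed.

Lemma derive_pair_comp (p q : E -> E) y h :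
  differentiable p y -> differentiable q y -> differentiable L (p y, q y) ->
  is_derive y h (fun y => L (p y, q y)) ('D_(hor ('D_h p y)) L (p y, q y) + 'D_(ver ('D_h q y)) L (p y, q y)).
Proof.
move=> dp dq dL; have dpq : differentiable (fun y => (p y, q y)) y by exact: differentiable_pair.
have dLpq : differentiable (L \o (fun y => (p y, q y))) y by exact: differentiable_comp.
apply: DeriveDef; first exact: diff_derivable.
have E1 : 'd (fun y => (p y, q y)) y h = hor ('D_h p y) + ver ('D_h q y).
  rewrite (diff_pair dp dq) (deriveE h dp) (deriveE h dq).
  by rewrite -[RHS]/('d p y h + 0, 0 + 'd q y h) addr0 add0r.
apply: (etrans (deriveE h dLpq)); apply: (etrans (congr1 (fun D : E -> R => D h) (diff_comp dpq dL))).
apply: (etrans (congr1 ('d L (p y, q y)) E1)).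
by apply: (etrans (linearD _ _ _)); rewrite -!(deriveE _ dL).
Qed.

Theorem minkowski_coordinates x0 : U x0 -> (forall x, U x -> L (x, 0) = 0) ->
  (forall x y u, U x -> y != 0 -> (forall a : R, u <> a *: y) ->
     gform x y u (y *m Rm x u y) = 0) ->
  exists (U' W : set E) (phi psi : E -> E),
  [/\ [/\ open U', U' x0, U' `<=` U & open W],
      forall x, U' x -> W (phi x) /\ psi (phi x) = x,
      forall y, W y -> U' (psi y) /\ phi (psi y) = y,
      smooth_on U' phi /\ smooth_on W psi &
      forall x y v, W x -> W y -> L (psi x, 'D_v psi x) = L (psi y, 'D_v psi y)].
Proof.
move=> Ux0 L0 R0.
have flat x u v : U x -> Rm x u v = 0.
  move=> Ux; apply: (curvature_eq0 Ux) => y w.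
  have [->|y_neq0] := eqVneq y 0; first by rewrite mul0mx.
  have Oz : O (x, y) by [].
  apply: (jacobi_eq0 Oz) => {}w.
  have [[a ->]|wy] := pselect (exists a : R, w = a *: y); last first.
    by apply: R0 => // a E; apply: wy; exists a.
  by rewrite (gformZl Oz) gform_radial_curvature // mulr0.
have [U' [W [phi [psi [J [[oU' U'x0 U'U] [e e0 We] [phiW psiU Cphi Cpsi] HJ Dpsi]]]]]] :=
  flat_coordinates oU Ux0 smooth_Gam Gam_torsion_free flat.
have oW : open W by rewrite We; exact: open_norm_ball.
exists U', W, phi, psi; split => // x y v Wx Wy.
have [->|v0] := eqVneq v 0.
  have D0 (z : E) : W z -> 'D_(0 : E) psi z = 0 by move=> Wz; rewrite Dpsi // mul0mx.
  have [[Ux _] [Uy _]] := (psiU x Wx, psiU y Wy).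
  by rewrite !D0 // !L0 //; exact: U'U.
have dpsi (p : E) : W p -> differentiable psi p.
  by move=> Wp; exact: smooth_differentiable Cpsi Wp.
have dDpsi (p : E) : W p -> differentiable ('D_v psi) p.
  by move=> Wp; exact: (smooth_differentiable (smooth_derive v Cpsi) Wp).
have OL (p : E) : W p -> O (psi p, 'D_v psi p).
  move=> Wp; have [Up _] := psiU p Wp; split; first exact: U'U.
  have [_ uJ _] := HJ _ Up; rewrite /= Dpsi //.
  by apply: contra_neq v0 => E0; rewrite -(mulmxKV uJ v) E0 mul0mx.
(* Differentiating the constant [v = 'D_v psi q *m J (psi q)] shows that the coordinate field
   ['D_v psi] is parallel. *)
have dDpsiE (p h : E) : W p -> 'D_h ('D_v psi) p = - ('D_v psi p *m conn Gam (psi p) ('D_h psi p)).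
  move=> Wp; have [Up _] := psiU p Wp; have [dJ uJ DJ] := HJ _ Up.
  have dJpsi : differentiable (J \o psi) p by apply: differentiable_comp => //; exact: dpsi.
  have DJpsi : 'D_h (J \o psi) p = conn Gam (psi p) ('D_h psi p) *m J (psi p).
    rewrite (deriveE h dJpsi) (diff_comp (dpsi p Wp) dJ) /= -(deriveE _ (dpsi p Wp)).
    by rewrite -(deriveE _ dJ).
  have := is_derive_mulmx (differentiable_is_derive h (dDpsi p Wp)) (differentiable_is_derive h dJpsi).
  have Ev : \forall q \near p, cst v q = 'D_v psi q *m (J \o psi) q.
    apply: (open_near_eq oW Wp) => q Wq; have [Uq _] := psiU q Wq; have [_ uJq _] := HJ _ Uq.
    by rewrite Dpsi //= mulmxKV.
  move=> [_]; rewrite -(near_eq_derive h Ev) derive_cst DJpsi mulmxA -mulmxDl => /esym E0.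
  by apply/eqP; rewrite -addr_eq0 -(mulmxK uJ (_ + _)) E0 mul0mx.
pose f q := L (psi q, 'D_v psi q).
have df (p : E) : W p -> differentiable f p.
  move=> Wp; apply: (differentiable_comp (f := fun q => (psi q, 'D_v psi q))).
    by apply: differentiable_pair; [exact: dpsi|exact: dDpsi].
  exact: dS CL (OL p Wp).
(* The base part of the derivative and the fibre part, which comes from parallelism, are opposite by
   [horizontal_invariance]. *)
have Df (p h : E) : W p -> 'D_h f p = 0.
  move=> Wp; have [_ ->] := derive_pair_comp h (dpsi p Wp) (dDpsi p Wp) (dS CL (OL p Wp)).
  rewrite (dDpsiE p h Wp) -sub0r; set u := 'D_h psi p; set w := 'D_v psi p.
  have E1 := horizontal_invariance u (OL p Wp); rewrite -/w in E1.
  apply: (etrans (congr2 +%R E1 (verB _ _ CL (OL p Wp)))).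
  have D0 : 'D_(ver 0) L (psi p, w) = 0.
    by apply: (etrans (verE _ CL (OL p Wp))); rewrite big1 // => j _; rewrite mxE mul0r.
  by apply: (etrans (congr1 (fun a => _ + (a - _)) D0)); rewrite sub0r subrr.
have Wt (t : R) : 0 <= t <= 1 -> W (t *: (x - y) + y).
  by move=> t01; move: Wx Wy; rewrite We /= => Wx Wy; exact: ball_segment.
have [t t01|t /andP[t0 t1]] := @MVT_line _ _ f y (x - y); first exact/df/Wt.
rewrite Df ?subrK; first by move/eqP; rewrite subr_eq0 => /eqP.
by apply: Wt; rewrite !ltW.
Qed.

End LocalFinsler.

(** * Berwald manifolds *)

Section ChartExpression.
Context {R : realType} {n : nat} {M : manifold R n}.
Local Notation E := 'rV[R]_n.
Variable F : forall p : M, tangent p -> R.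
Implicit Types (p : M) (c : chart R n M) (x y u v : E) (i j k m : 'I_n).

Lemma tangent_of_linear c p (a : R) u v :
  tangent_of c p (a *: u + v) = a *: tangent_of c p u + tangent_of c p v.
Proof.
apply: val_inj; apply/funext => c'; rewrite /= /tangent_comp.
rewrite -[RHS]/(a *: (tangent_comp c p u c') + tangent_comp c p v c') /tangent_comp.
by case: asboolP => _; rewrite ?linearP // scaler0 addr0.
Qed.

Lemma tangent_of0 c p : tangent_of c p 0 = 0.
Proof. by have := tangent_of_linear c p (-1) 0 0; rewrite scaler0 addr0 scaleN1r addNr. Qed.

Lemma tangent_ofZ c p (a : R) u : tangent_of c p (a *: u) = a *: tangent_of c p u.
Proof. by rewrite -[a *: u]addr0 tangent_of_linear tangent_of0 addr0. Qed.

Lemma tangent_of_inj c p u v : chart_at p c -> tangent_of c p u = tangent_of c p v -> u = v.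
Proof. by move=> cp /(congr1 (fun w : tangent p => w c)); rewrite !tangent_ofE. Qed.

Lemma chart_at_param c x : atlas c -> img c x -> chart_at (param c x) c.
Proof. by move=> ac cx; split=> //; exact: param_dom. Qed.

Lemma local_exprE c p (y : tangent p) : chart_at p c -> F y = local_expr F c (coord c p) (y c).
Proof.
move=> cp; have [_ dp] := cp; rewrite -[in LHS](tangent_ofK y cp) /local_expr.
by rewrite coordK.
Qed.

Definition energy c (z : E * E) : R := local_expr F c z.1 z.2 ^+ 2.

Lemma fundamental_formE c p (y u v : tangent p) : chart_at p c ->
  fundamental_form F y u v = gform (energy c) (coord c p) (y c) (u c) (v c).
Proof.
move=> cp; rewrite /fundamental_form derive1E; apply: (congr1 ( *%R _)).
pose l z := energy c (coord c p, z).
have E1 : (fun s : R => derive1 (fun t : R => F (y + s *: u + t *: v) ^+ 2) 0) =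
    fun s => 'D_(v c) l (s *: u c + y c).
  apply/funext => s; rewrite derive1E -[in RHS](add0r (s *: u c + y c)) -(scale0r (v c)) -derive_line.
  apply: (congr1 (fun f => 'D_1 f (0 : R))); apply/funext => t.
  rewrite (local_exprE _ cp) /l /energy /=; apply: (congr1 (fun w => local_expr F c (coord c p) w ^+ 2)).
  by rewrite -[LHS]/(y c + s *: u c + t *: v c) addrC [y c + _]addrC.
rewrite E1 (derive_line ('D_(v c) l)) scale0r add0r -[RHS]derive_fiber; apply: (congr1 (fun f => 'D_(u c) f (y c))).
by apply/funext => z; rewrite /l derive_fiber.
Qed.

Lemma partial_xE k (f : E * E -> R) x y : partial_x k (fun x y => f (x, y)) x y = 'D_(hor 'e_k) f (x, y).
Proof. exact: derive_base. Qed.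

Lemma partial_yE k (f : E * E -> R) x y : partial_y k (fun x y => f (x, y)) x y = 'D_(ver 'e_k) f (x, y).
Proof. exact: derive_fiber. Qed.

Lemma metric_coefE c x y : atlas c -> img c x -> metric_coef F c x y = metric_at (energy c) (x, y).
Proof.
move=> ac cx; have cp := chart_at_param ac cx; apply/matrixP => i j.
apply: (etrans (mxE _ _ _ _)); apply: (etrans _ (esym (mxE _ _ _ _))).
apply: (etrans (fundamental_formE _ _ _ cp)).
have E1 := @tangent_ofE R n M (param c x) c; rewrite (E1 y cp) (E1 _ cp) (E1 _ cp) (paramK cx).
by [].
Qed.

Lemma spray_coefE c i x y : atlas c -> img c x -> spray_coef F c i x y = spray (energy c) i (x, y).
Proof.
move=> ac cx; rewrite /spray_coef metric_coefE // /spray.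
have E1 m : partial_y m (fun x y => local_expr F c x y ^+ 2) = fun x y => 'D_(ver 'e_m) (energy c) (x, y).
  by apply/funext => x'; apply/funext => y'; exact: (partial_yE m (energy c)).
apply: (congr1 ( *%R _)); apply: eq_bigr => m _; apply: (congr1 ( *%R _)).
rewrite E1; apply: (congr2 (fun a b => a - b)); last exact: (partial_xE m (energy c)).
by apply: eq_bigr => k _; rewrite (partial_xE k ('D_(ver 'e_m) (energy c))).
Qed.

Lemma berwald_curvatureE c i j k m x y : atlas c -> img c x ->
  berwald_curvature F c i j k m x y =
  'D_(ver 'e_j) ('D_(ver 'e_k) ('D_(ver 'e_m) (spray (energy c) i))) (x, y).
Proof.
move=> ac cx.
have ext j' (f : E -> E -> R) (h : E * E -> R) : (forall w, f x w = h (x, w)) ->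
    forall w, partial_y j' f x w = 'D_(ver 'e_j') h (x, w).
  move=> fh w; rewrite -[RHS]derive_fiber; apply: (congr1 (fun f => 'D_('e_j') f w)).
  by apply/funext => z; exact: fh.
exact: (ext _ _ _ (ext _ _ _ (ext _ _ _ (fun w => spray_coefE i w ac cx)))).
Qed.

Lemma riemann_coefE c i k x y : atlas c -> img c x ->
  riemann_coef F c i k x y =
  2 * 'D_(hor 'e_k) (spray (energy c) i) (x, y)
  - \sum_j 'D_(hor 'e_j) ('D_(ver 'e_k) (spray (energy c) i)) (x, y) * y 0 j
  + 2 * \sum_j spray (energy c) j (x, y) * 'D_(ver 'e_j) ('D_(ver 'e_k) (spray (energy c) i)) (x, y)
  - \sum_j 'D_(ver 'e_j) (spray (energy c) i) (x, y) * 'D_(ver 'e_k) (spray (energy c) j) (x, y).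
Proof.
move=> ac cx.
have Ey j m x' y' : img c x' ->
    partial_y m (spray_coef F c j) x' y' = 'D_(ver 'e_m) (spray (energy c) j) (x', y').
  move=> cx'; rewrite -derive_fiber; apply: (congr1 (fun f => 'D_('e_m) f y')).
  by apply/funext => w; rewrite spray_coefE.
(* Derivatives in [x] need agreement of the two expressions near [x], which the open set [img c]
   provides. *)
have near_img (f g : E -> R) v : (forall x, img c x -> f x = g x) -> 'D_v f x = 'D_v g x.
  by move=> fg; apply: near_eq_derive; apply: (open_near_eq (img_open (c := c)) cx fg).
have Ex j m : partial_x m (spray_coef F c j) x y = 'D_(hor 'e_m) (spray (energy c) j) (x, y).
  by rewrite -derive_base; apply: near_img => z cz; rewrite spray_coefE.
have Exy j l m : partial_x m (partial_y l (spray_coef F c j)) x y =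
    'D_(hor 'e_m) ('D_(ver 'e_l) (spray (energy c) j)) (x, y).
  by rewrite -derive_base; apply: near_img => z cz; rewrite Ey.
have Eyy j l m : partial_y m (partial_y l (spray_coef F c j)) x y =
    'D_(ver 'e_m) ('D_(ver 'e_l) (spray (energy c) j)) (x, y).
  rewrite -derive_fiber; apply: (congr1 (fun f => 'D_('e_m) f y)).
  by apply/funext => w; rewrite Ey.
rewrite /riemann_coef Ex.
apply: (congr2 (fun a b : R => a - b)); last by apply: eq_bigr => j _; rewrite !Ey.
apply: (congr2 +%R); first by apply: (congr1 (fun a : R => _ - a)); apply: eq_bigr => j _; rewrite Exy.
by apply: (congr1 ( *%R 2)); apply: eq_bigr => j _; rewrite Eyy spray_coefE.
Qed.

End ChartExpression.

(** * Restricting a chart and changing its coordinates *)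

Section Subchart.
Context {R : realType} {n : nat} {M : manifold R n}.
Local Notation E := 'rV[R]_n.

Lemma open_coord_image (c : chart R n M) (A : set M) : open A -> open (coord c @` (dom c `&` A)).
Proof.
move=> oA; rewrite openE => x [p [dp Ap] <-].
have cx := coord_img dp.
have pc := param_continuous cx; have A1 : nbhs (param c (coord c p)) (dom c `&` A).
  by rewrite coordK //; apply: open_nbhs_nbhs; split; [exact: openI (dom_open c) oA|].
have A2 : nbhs (coord c p) (img c `&` param c @^-1` (dom c `&` A)).
  apply: filterI; last exact: pc _ A1.
  by apply: open_nbhs_nbhs; split=> //; exact: img_open.
by apply: filterS A2 => z [cz zA]; exists (param c z); rewrite ?paramK.
Qed.

Variables (c : chart R n M) (U' W : set E) (phi psi : E -> E).
Hypothesis oU' : open U'.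
Hypothesis oW : open W.
Hypothesis U'c : U' `<=` img c.
Hypothesis phiW : forall x, U' x -> W (phi x) /\ psi (phi x) = x.
Hypothesis psiU' : forall y, W y -> U' (psi y) /\ phi (psi y) = y.
Hypothesis Cphi : smooth_on U' phi.
Hypothesis Cpsi : smooth_on W psi.

Let sdom := dom c `&` coord c @^-1` U'.
Let scoord p := phi (coord c p).
Let sparam x := param c (psi x).

Let sdom_open : open sdom.
Proof.
rewrite openE => p [dp Up]; apply: filterI.
  by apply: open_nbhs_nbhs; split=> //; exact: dom_open.
by apply: (coord_continuous dp); apply: open_nbhs_nbhs.
Qed.

Let scoord_img p : sdom p -> W (scoord p). Proof. by move=> [_ /phiW[]]. Qed.

Let sparam_dom x : W x -> sdom (sparam x).
Proof.
move=> /psiU'[Ux _]; split; first exact/param_dom/U'c.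
by rewrite /sparam /= paramK //; exact: U'c.
Qed.

Let scoordK p : sdom p -> sparam (scoord p) = p.
Proof. by move=> [dp /phiW[_ E0]]; rewrite /sparam /scoord E0 coordK. Qed.

Let sparamK x : W x -> scoord (sparam x) = x.
Proof. by move=> /psiU'[Ux E0]; rewrite /sparam /scoord paramK //; exact: U'c. Qed.

Let scoord_continuous p : sdom p -> {for p, continuous scoord}.
Proof.
move=> [dp Up]; apply: continuous_comp; first exact: coord_continuous.
exact: (Cphi 0).
Qed.

Let sparam_continuous x : W x -> {for x, continuous sparam}.
Proof.
move=> Wx; have [Ux _] := psiU' Wx; apply: continuous_comp; first exact: (Cpsi 0).
by apply: param_continuous; exact: U'c.
Qed.

Definition subchart : chart R n M :=
  Chart sdom_open oW scoord_img sparam_dom scoordK sparamK scoord_continuous sparam_continuous.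

Hypothesis ac : atlas c.

(** By maximality of the atlas only the transitions matter, and these are transitions of [c]
    composed with [psi] or [phi]. *)
Lemma subchart_atlas : atlas subchart.
Proof.
apply: atlas_maximal => c'' ac''.
have [C1 C2] := atlas_compatible ac ac''.
have o1 := open_coord_image (c := c) (dom_open c'').
have o2 : open (coord subchart @` (dom subchart `&` dom c'')) by exact/open_coord_image/dom_open.
have o3 : open (coord c'' @` (dom subchart `&` dom c'')).
  by rewrite setIC; exact/open_coord_image/dom_open.
split=> k.
- apply: (Ck_on_comp_mx o1 o2 _ (C1 k)).
    move=> x [q [[dq Uq] d''q] <-]; exists q; first by [].
    by have [_ E0] := phiW Uq; rewrite -[coord subchart q]/(phi (coord c q)) E0.
  by apply: (Ck_on_sub _ (Cpsi k)) => x [q [dq _] <-]; exact: scoord_img.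
- apply: (Ck_on_comp_mx oU' o3 _ (Cphi k)).
    by move=> x [q [[dq Uq] d''q] <-]; rewrite /transition coordK.
  by apply: (Ck_on_sub _ (C2 k)) => x [q [[dq _] d''q] <-]; exists q.
Qed.

(** The transition back to [c] is [psi] near [x], so components [v] become ['D_v psi x]; this is the
    form in which [minkowski_coordinates] states its invariance. *)
Lemma subchart_local_expr (F : forall p : M, tangent p -> R) x v : W x ->
  local_expr F subchart x v = local_expr F c (psi x) ('D_v psi x).
Proof.
move=> Wx; have [Ux E0] := psiU' Wx; have cU := U'c Ux.
set p := param c (psi x); have cp : chart_at p c by exact: chart_at_param.
have c'p : chart_at p subchart by split; [exact: subchart_atlas|exact: (sparam_dom Wx)].
rewrite -[LHS]/(F p (tangent_of subchart p v)) (local_exprE F _ cp) (paramK cU).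
apply: (congr1 (local_expr F c (psi x))).
rewrite /= /tangent_comp asboolT // -[coord subchart p]/(scoord (sparam x)) sparamK //.
have dt := transition_differentiable c'p cp.
rewrite -[coord subchart p]/(scoord (sparam x)) sparamK // in dt.
rewrite -deriveE //; apply: near_eq_derive; apply: (open_near_eq oW Wx) => z Wz.
have [Uz _] := psiU' Wz.
by rewrite /transition /= paramK //; exact: U'c.
Qed.

End Subchart.

(** * From charts to the manifold *)

Section BerwaldManifold.
Context {R : realType} {n : nat} {M : manifold R n}.
Local Notation E := 'rV[R]_n.
Variable F : forall p : M, tangent p -> R.
Hypothesis n2 : (2 <= n)%N.
Hypothesis F_finsler : finsler_metric F.
Hypothesis F_berwald : berwald F.
Implicit Types (p : M) (x y u v : E).

Lemma finsler0 p : F (0 : tangent p) = 0.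
Proof.
have := finsler_homogeneous F_finsler (0 : tangent p) (ltr0n R 2); rewrite scaler0.
by move: (F 0) => r; lra.
Qed.

Lemma finsler_eq_sqr p q (y : tangent p) (z : tangent q) : F y ^+ 2 = F z ^+ 2 -> F y = F z.
Proof.
by move=> /eqP; rewrite eqrXn2 ?(finsler_ge0 F_finsler) // => /eqP.
Qed.

Section Chart.
Variable c : chart R n M.
Hypothesis ac : atlas c.
Local Notation L := (energy F c).

Lemma energy0 x : L (x, 0) = 0.
Proof. by rewrite /energy /local_expr tangent_of0 finsler0 expr0n. Qed.

Lemma energy_smooth : smooth_on (slit (img c)) L.
Proof.
move=> k; apply: (Ck_onX (f := fun xy => local_expr F c xy.1 xy.2)).
  exact/open_slit/img_open.
exact: finsler_smooth F_finsler c ac k.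
Qed.

Lemma energy_homogeneous : fiber_homogeneous (img c) 2 L.
Proof.
move=> x y t cx y0 t0.
by rewrite /energy /local_expr /= tangent_ofZ (finsler_homogeneous F_finsler) // exprMn.
Qed.

Lemma energy_posdef x y u : img c x -> y != 0 -> u != 0 -> 0 < 'D_(ver u) ('D_(ver u) L) (x, y).
Proof.
move=> cx y0 u0; have cp := chart_at_param ac cx.
have E1 := @tangent_ofE R n M (param c x) c.
have T0 v : v != 0 -> tangent_of c (param c x) v != 0.
  by apply: contra_neq => E0; apply: (tangent_of_inj cp); rewrite tangent_of0.
have := finsler_posdef F_finsler (T0 y y0) (T0 u u0).
rewrite (fundamental_formE F _ _ _ cp) (E1 y cp) (E1 u cp) (paramK cx) /gform.
by rewrite pmulr_rgt0 ?invr_gt0.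
Qed.

Lemma energy_berwald i j k m z : slit (img c) z ->
  'D_(ver 'e_j) ('D_(ver 'e_k) ('D_(ver 'e_m) (spray L i))) z = 0.
Proof.
case: z => x y [cx y0]; rewrite -berwald_curvatureE //; exact: F_berwald.
Qed.

Lemma jacobi_operatorE x y u : img c x -> y != 0 ->
  \row_i \sum_k riemann_coef F c i k x y * u 0 k = y *m Rm L n2 x u y.
Proof.
move=> cx y0; have Oz : slit (img c) (x, y) by [].
rewrite (Rm_sum n2 (img_open (c := c)) energy_smooth energy_posdef u y cx) mulmx_sumr.
apply/rowP => i; rewrite mxE summxE; apply: eq_bigr => k _.
rewrite riemann_coefE // (riemann_spray n2 (img_open (c := c)) energy_smooth energy_homogeneous
  energy_posdef energy_berwald i 'e_k Oz).
by rewrite -scalemxAr [RHS]mxE mulrC.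
Qed.

Lemma flag_curvatureE p y u : dom c p -> y != 0 ->
  flag_curvature F c (tangent_of c p y) (tangent_of c p u) =
  gform L (coord c p) y u (y *m Rm L n2 (coord c p) u y) /
  (gform L (coord c p) y y y * gform L (coord c p) y u u - gform L (coord c p) y y u ^+ 2).
Proof.
move=> dp y0; have cp : chart_at p c by [].
have E1 := @tangent_ofE R n M p c.
rewrite /flag_curvature !(fundamental_formE F _ _ _ cp) (E1 y cp) (E1 u cp).
by rewrite /riemann_curvature (E1 y cp) (E1 u cp) (E1 _ cp) jacobi_operatorE //; exact: coord_img.
Qed.

Lemma flag_span p y u : dom c p -> y != 0 -> (forall a : R, u <> a *: y) ->
  flag (span2 (tangent_of c p y) (tangent_of c p u)) (tangent_of c p y).
Proof.
move=> dp y0 uy; have cp : chart_at p c by [].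
split.
- exists (tangent_of c p y), (tangent_of c p u); split=> // a b.
  rewrite -(tangent_ofZ c p b) -tangent_of_linear -(tangent_of0 c p) => /(tangent_of_inj cp) E0.
  have b0 : b = 0.
    apply/eqP/negPn/negP => b0; apply: (uy (- a / b)); apply: (scalerI b0).
    rewrite scalerA mulrC divfK // scaleNr; apply/eqP; rewrite -addr_eq0 addrC; exact/eqP.
  by move/eqP: E0; rewrite b0 scale0r addr0 scaler_eq0 (negPf y0) orbF => /eqP.
- by exists 1 => //; exists 0 => //; rewrite scale1r scale0r addr0.
- by apply: contra_neq y0 => E0; apply: (tangent_of_inj cp); rewrite tangent_of0.
Qed.

End Chart.

Lemma nonzero_curvature_riemannian :
  (forall p (P : set (tangent p)) (y : tangent p), flag P y ->
      forall (c : chart R n M) (u : tangent p),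
        chart_at p c -> P = span2 y u -> flag_curvature F c y u <> 0) ->
  riemannian F.
Proof.
move=> K0 p; have [c ac dp] := atlas_cover p; have cp : chart_at p c by [].
have cx := coord_img dp; set x := coord c p in cx.
have [|P HP] := fiber_quadratic (n2 := n2) (img_open (c := c)) (energy_smooth ac) (energy_homogeneous (c := c))
    (energy_posdef ac) (energy_berwald ac) cx (energy0 c x).
  move=> y u y0 uy g0.
  apply: (K0 p _ _ (flag_span ac dp y0 uy) c (tangent_of c p u) cp erefl).
  by rewrite flag_curvatureE // g0 mul0r.
have FP (u : tangent p) : F u ^+ 2 = dot (u c *m P) (u c *m P).
  by rewrite (local_exprE F u cp) -HP.
exists (fun u v : tangent p => dot (u c *m P) (v c *m P)); split=> //.
- move=> u a v w; rewrite -[LHS]/(dot (u c *m P) ((a *: v c + w c) *m P)).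
  by rewrite mulmxDl -scalemxAl dotDr dotZr.
- by move=> u v; exact: dotC.
- move=> u u0;  have uc0 : u c != 0.
    by apply: contra_neq u0 => E0; rewrite -(tangent_ofK u cp) E0 tangent_of0.
  rewrite -HP; apply: (fiber_gt0 (energy_smooth ac) (energy_homogeneous (c := c)) (energy_posdef ac)).
  by [].
Qed.

Lemma zero_curvature_minkowskian :
  (forall p (P : set (tangent p)) (y : tangent p), flag P y ->
      forall (c : chart R n M) (u : tangent p),
        chart_at p c -> P = span2 y u -> flag_curvature F c y u = 0) ->
  locally_minkowskian F.
Proof.
move=> K0 p; have [c ac dp] := atlas_cover p.
have R0 x y u : img c x -> y != 0 -> (forall a : R, u <> a *: y) ->
    gform (energy F c) x y u (y *m Rm (energy F c) n2 x u y) = 0.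
  move=> cx y0 uy; have [_ dx] := chart_at_param ac cx.
  have := K0 _ _ _ (flag_span ac dx y0 uy) c (tangent_of c _ u) (conj ac dx) erefl.
  (* Division by zero yields zero, so a vanishing quotient gives a vanishing numerator only once the
     Gram determinant is known to be positive. *)
  rewrite flag_curvatureE // (paramK cx) => /eqP; rewrite mulf_eq0 => /orP[/eqP //|].
  have Oz : slit (img c) (x, y) by [].
  by rewrite invr_eq0 gt_eqF // (gform_cauchy_schwarz (img_open (c := c)) (energy_smooth ac) (energy_posdef ac) Oz).
have [U' [W [phi [psi [[oU' U'x0 U'c oW] phiW psiU' [Cphi Cpsi] HL]]]]] :=
  minkowski_coordinates (n2 := n2) (img_open (c := c)) (energy_smooth ac) (energy_homogeneous (c := c))
    (energy_posdef ac) (energy_berwald ac) (coord_img dp) (fun x _ => energy0 c x) R0.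
pose c' := subchart oU' oW U'c phiW psiU' Cphi Cpsi.
have ac' : atlas c' by exact: subchart_atlas.
exists c'; first by split.
move=> x x' y Wx Wx'; apply: finsler_eq_sqr.
have LE z v : W z -> local_expr F c' z v = local_expr F c (psi z) ('D_v psi z).
  exact: subchart_local_expr.
exact: (etrans (congr1 (fun a : R => a ^+ 2) (LE x y Wx))
  (etrans (HL x x' y Wx Wx') (esym (congr1 (fun a : R => a ^+ 2) (LE x' y Wx'))))).
Qed.

End BerwaldManifold.

Theorem theorem1p1 (R : realType) (n : nat) (M : manifold R n)
    (F : forall p : M, tangent p -> R) :
  (2 <= n)%N -> finsler_metric F -> berwald F ->
  ((forall (p : M) (P : set (tangent p)) (y : tangent p), flag P y ->
      forall (c : chart R n M) (u : tangent p),
        chart_at p c -> P = span2 y u -> flag_curvature F c y u = 0) ->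
    locally_minkowskian F) /\
  ((forall (p : M) (P : set (tangent p)) (y : tangent p), flag P y ->
      forall (c : chart R n M) (u : tangent p),
        chart_at p c -> P = span2 y u -> flag_curvature F c y u <> 0) ->
    riemannian F).
Proof.
move=> n2 hF hB; split.
- exact: zero_curvature_minkowskian n2 hF hB.
- exact: nonzero_curvature_riemannian n2 hF hB.
Qed.
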